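(* Let $\Theta$ be the almost sure limit of $\Theta_n$, and let $\mathcal D_0=\{\Theta\in\Sigma\setminus\partial\Sigma\}$ and $\mathcal D_p=\{\Theta\in\partial\Sigma\setminus V\}$. Then $\mathbb P(\mathcal D_0)>0$ and $\mathbb P(\mathcal D_p)>0$.
   Context: Process. $I=\{1,2,3\}$ labels the vertices and the edges of a triangle, edge $i$ being the one not adjacent to vertex $i$; $\oplus,\ominus$ are addition and subtraction modulo three on $I$; $\mathbb N_0=\mathbb N\cup\{0\}$; $\|\cdot\|$ is the $\ell_1$-norm on $\mathbb R^3$. The offspring variable $Z$ is $\mathbb N_0$-valued with $\mathbb P(Z=0)=0$, $\mu=\mathbb E(Z)\in(1,\infty)$, $\mathbb E(Z^2)<\infty$. Let $N_0\in\mathbb N_0^3\setminus\{(0,0,0)\}$ and $T_0\in(0,\infty)^3$ be deterministic, and $\mathcal F_0=\{\emptyset,\Omega\}$. Inductively for $n\ge 0$: let $(Z^{(i)}_{n+1,k})_{i\in I,k\in\mathbb N}$ be i.i.d. copies of $Z$ independent of $\mathcal F_n$, and $\mathcal F_n^\star=\sigma(\mathcal F_n,(Z^{(i)}_{n+1,k})_{i,k})$. Conditionally on $\mathcal F_n^\star$, let $B^{(i)}_{n+1}$, $i\in I$, be independent, $B^{(i)}_{n+1}\sim\mathrm{Bin}\big(\sum_{k=1}^{N_n^{(i)}}Z^{(i)}_{n+1,k},P_n^{(i)}\big)$ with $P_n^{(i)}=\frac{T_n^{(i\ominus1)}}{T_n^{(i\ominus1)}+T_n^{(i\oplus1)}}$,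 and put $\bar B^{(i)}_{n+1}=\sum_{k=1}^{N_n^{(i)}}Z^{(i)}_{n+1,k}-B^{(i)}_{n+1}$. Then $T^{(i)}_{n+1}=T^{(i)}_n+B^{(i\oplus1)}_{n+1}+\bar B^{(i\ominus1)}_{n+1}$, $N^{(i)}_{n+1}=B^{(i\ominus1)}_{n+1}+\bar B^{(i\oplus1)}_{n+1}$, and $\mathcal F_{n+1}=\sigma(\mathcal F_n^\star,(B^{(i)}_{n+1})_{i\in I})$. ($N_n^{(i)}$ is the number of particles at vertex $i$ at time $n$; $T_n^{(i)}$ is the initial weight plus the number of traversals of edge $i$ by time $n$.) Put $\Theta_n=T_n/\|T_n\|$. Notation. $\Sigma=\{p\in[0,1]^3:\|p\|=1\}$ is the unit simplex, $\partial\Sigma$ its triangular boundary, $V$ the set of its three vertices. It is known (another result of the same work) that $\Theta_n$ converges almost surely to a $\Sigma$-valued random variable, denoted $\Theta$. *)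

(* Defs.v *)
From HB Require Import structures.
From mathcomp Require Export all_boot all_order all_algebra.
From mathcomp Require Export all_classical all_reals all_analysis measurable_realfun.
Export numFieldNormedType.Exports.
Export Order.TTheory GRing.Theory Num.Theory.

Set Implicit Arguments.
Unset Strict Implicit.
Unset Printing Implicit Defensive.

Local Open Scope classical_set_scope.
Local Open Scope ring_scope.

Section Probability.
Context d (Omega : measurableType d) (R : realType) (P : probability Omega R).

(* Generators of sigma((X i)_i); every subset of nat is measurable. *)
Definition generators (I : Type) (X : I -> Omega -> nat) : set (set Omega) :=
  \bigcup_(i in [set: I]) preimage_set_system setT (X i) measurable.

Definition mutually_independent (I : choiceType) (X : I -> Omega -> nat) : Prop :=
  forall (J : seq I) (S : I -> set nat), uniq J ->
    P [set w | forall j, j \in J -> S j (X j w)] =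
    (\prod_(j <- J) P (X j @^-1` S j))%E.

Definition independent_systems (G H : set (set Omega)) : Prop :=
  forall A C, G A -> H C -> P (A `&` C) = (P A * P C)%E.

(* f is a version of the conditional probability P(E | G), G a sub-sigma-algebra. *)
Definition is_cond_prob (G : set (set Omega)) (E : set Omega)
    (f : Omega -> \bar R) : Prop :=
  preimage_set_system setT f measurable `<=` G /\
  forall A, G A -> P (A `&` E) = (\int[P]_(w in A) f w)%E.

(* Conditionally on G, the X i are independent and X i has the (random) law
   nu w i. Taking S i = setT for some of the i gives the marginals. *)
Definition cond_independent_laws (G : set (set Omega)) (I : finType)
    (X : I -> Omega -> nat) (nu : Omega -> I -> set nat -> \bar R) : Prop :=
  forall S : I -> set nat,
    is_cond_prob G [set w | forall i, S i (X i w)]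
      (fun w => \prod_(i : I) nu w i (S i))%E.

End Probability.

Section Simplex.
Context {R : realType}.

Definition norm1 (x : 'rV[R]_3) : R := \sum_(i < 3) `|x 0 i|.

Definition simplex : set 'rV[R]_3 :=
  [set p : 'rV[R]_3 | (forall i, 0 <= p 0 i <= 1) /\ norm1 p = 1].

(* The union of the three closed sides; it contains the vertices. *)
Definition simplex_boundary : set 'rV[R]_3 :=
  [set p : 'rV[R]_3 | simplex p /\ exists i, p 0 i = 0].

Definition simplex_vertices : set 'rV[R]_3 :=
  [set delta_mx 0 i | i in [set: 'I_3]].

End Simplex.

(* The triangle's vertices and edges are labelled by 'I_3, viewed as Z/3 (label 3
   becomes 0), so that i + 1 and i - 1 are addition and subtraction modulo 3.
   Z n i k is the offspring variable Z_{n, k+1}^{(i)} and B n i is B_n^{(i)};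
   Z 0 and B 0 are never used. *)
Section Process.
Context d (Omega : measurableType d) (R : realType).
Variables (N0 : 'I_3 -> nat) (T0 : 'rV[R]_3).
Variables (Z : nat -> 'I_3 -> nat -> Omega -> nat) (B : nat -> 'I_3 -> Omega -> nat).

(* The subtractions below are truncated, which is harmless: the binomial law
   gives B_{n+1}^{(i)} <= offspring n i almost surely. *)
Fixpoint particles (n : nat) (w : Omega) : 'I_3 -> nat :=
  match n with
  | 0%N => N0
  | m.+1 => fun i =>
      let total j := (\sum_(k < particles m w j) Z m.+1 j k w)%N in
      (B m.+1 (i - 1)%R w + (total (i + 1)%R - B m.+1 (i + 1)%R w))%N
  end.

Definition offspring (n : nat) (i : 'I_3) (w : Omega) : nat :=
  (\sum_(k < particles n w i) Z n.+1 i k w)%N.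

Definition Bbar (n : nat) (i : 'I_3) (w : Omega) : nat :=
  (offspring n i w - B n.+1 i w)%N.

Fixpoint weights (n : nat) (w : Omega) : 'rV[R]_3 :=
  match n with
  | 0%N => T0
  | m.+1 => \row_i (weights m w 0 i + (B m.+1 (i + 1) w)%:R
                                    + (Bbar m (i - 1) w)%:R)
  end.

Definition step_prob (n : nat) (i : 'I_3) (w : Omega) : R :=
  weights n w 0 (i - 1) / (weights n w 0 (i - 1) + weights n w 0 (i + 1)).

Definition proportions (n : nat) (w : Omega) : 'rV[R]_3 :=
  (norm1 (weights n w))^-1 *: weights n w.

Definition gen_offspring (n : nat) : set (set Omega) :=
  generators (fun ik : 'I_3 * nat => Z n ik.1 ik.2).

(* Fn n is F_n; the intermediate sigma-algebra is F_n^star. *)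
Fixpoint Fn (n : nat) : set (set Omega) :=
  match n with
  | 0%N => [set set0; setT]
  | m.+1 => <<s <<s Fn m `|` gen_offspring m.+1 >> `|` generators (B m.+1) >>
  end.

Definition Fstar (n : nat) : set (set Omega) :=
  <<s Fn n `|` gen_offspring n.+1 >>.

End Process.

Record triangle_process d d' (Omega : measurableType d) (Omega' : measurableType d')
    (R : realType) (P : probability Omega R) (Q : probability Omega' R)
    (zeta : {RV Q >-> nat}) (N0 : 'I_3 -> nat) (T0 : 'rV[R]_3)
    (Z : nat -> 'I_3 -> nat -> {RV P >-> nat})
    (B : nat -> 'I_3 -> {RV P >-> nat}) : Prop := TriangleProcess {
  offspring_copies : forall n i k S,
    distribution P (Z n.+1 i k) S = distribution Q zeta S ;
  offspring_independent : forall n,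
    mutually_independent P (fun ik : 'I_3 * nat => Z n.+1 ik.1 ik.2 : Omega -> nat) ;
  offspring_independent_past : forall n,
    independent_systems P (Fn Z B n) <<s gen_offspring Z n.+1 >> ;
  steps_cond_law : forall n,
    cond_independent_laws P (Fstar Z B n) (fun i => B n.+1 i : Omega -> nat)
      (fun w i => binomial_prob (offspring N0 Z B n i w)
                                (step_prob N0 T0 Z B n i w))
}.

(* Main.v *)
Require Import Defs.
From mathcomp Require Import ring lra zify.
Set Implicit Arguments.
Unset Strict Implicit.
Unset Printing Implicit Defensive.
Local Open Scope classical_set_scope.
Local Open Scope ring_scope.

(** Divide everything by its total. Write [x] for the distribution of the
particles over the vertices ([density]), [theta] for the distribution of the
weight over the edges ([portion]) and [s] for the number of particles divided
by the total weight ([fresh_share]). In one generation [x] makes a step of the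
random walk on the triangle with edge weights [theta]. A traversal avoids edge
[i] exactly when it starts or ends at vertex [i], so that edge [i] receives the
share [1 - x i - x' i] of the new traversals; thus [theta] moves by
[s' * (1 - theta - x - x')]. When there are many particles, the laws of large
numbers for the offspring and for the binomial splittings make this recursion
([noisy_step]) true up to a small error. Every interior [theta], together with
the stationary law [(1 - theta) / 2] of its walk, is an equilibrium, and so
[theta] can come to rest at many places; each part of the theorem asks for a
region in which the recursion keeps [theta] for ever.

Near the centre, as long as every [theta i] is at least [1 / 6], the walk
contracts the distance from [x] to equilibrium by a fixed factor, and [theta]
moves by at most a multiple of this distance. Hence [theta] travels a short
way in total and stays at least [1 / 6] in every coordinate, if it starts in
near equilibrium close to the centre ([interior_persists]).

Near a side, put all the particles at vertex [0], and let edge [0], which is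
opposite to it, have very small weight. The particles then go from the hub [0]
to the leaves [1], [2] and back, and hardly ever cross edge [0]. A trip away
from the hub multiplies [theta 0] by about [1 - s'], the trip back by at most
about [1 + s''], and the product is at most [1 - 2 * k] for some [k > 0]
because [s] is of the order of [(mu - 1) / mu] or more ([share_product]). So
[theta 0] decays geometrically. The split of the remaining weight between the
edges [1] and [2] changes through the [skew] of the particles at the leaves,
which contracts as well. The Lyapunov function [hub_potential] combines the
three small quantities, and [theta 1], [theta 2] stay at least [1 / 4]
([hub_persists]).

Both regions are reached with positive probability. The offspring variable
takes with positive probability some value [z >= mu] ([atom_above_mean]), and
every splitting of the children is possible, so every evolution in which each
particle has exactly [z] children has positive probability in finitely many
generations ([reachable_step]). One such evolution gathers everybody at the
hub and shuttles back and forth ([hub_scenario]); continuing it with equal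
splittings leads to the centre ([balanced_scenario]). In both cases the number
of particles may be taken as large as desired.

From there the errors stay under a summable bound for ever with positive
probability. A generation of [m] particles violates the error [e] with
probability at most a constant over [e ^+ 2 * m] ([atypical_step]), by
Chebyshev's inequality for the offspring and for the binomial splittings. The
population grows geometrically, so that with geometrically decreasing errors
the sum of these bounds is small ([typical_forever]).

On the first event all [Theta i] are at least [1 / 6]; on the second one
[Theta 0 = 0] while [Theta 1], [Theta 2] are at least [1 / 4]. *)

(** * Indices modulo three *)

Lemma ord3P (i : 'I_3) : [\/ i = 0, i = 1 | i = 2%:R].
Proof.
by case: i => [[|[|[|//]]] h]; [apply: Or31|apply: Or32|apply: Or33]; exact: val_inj.
Qed.

Lemma ord3E : (((0 - 1)%R = 2%:R :> 'I_3) * ((1 - 1)%R = 0%R :> 'I_3) * ((2%:R - 1)%R = 1%R :> 'I_3) *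
  ((0 + 1)%R = 1%R :> 'I_3) * ((1 + 1)%R = 2%:R :> 'I_3) * ((2%:R + 1)%R = 0%R :> 'I_3))%type.
Proof. by do !split; exact: val_inj. Qed.

Lemma sum3 (V : nmodType) (f : 'I_3 -> V) : \sum_i f i = f 0 + f 1 + f 2%:R.
Proof.
rewrite !big_ord_recl big_ord0 addr0 addrA.
by congr (f _ + f _ + f _); exact: val_inj.
Qed.

(** * The normalised dynamics near the centre of the simplex *)

Section Contraction.
Variable R : realType.
Implicit Types (p u : R).

(** Dobrushin's contraction: from two different vertices the walk may step to the
third one, with probability at least [c] from each, so mass of opposite signs
cancels there at the rate [c]. The left-hand side is the [l1] norm of the image
of [u] under the step that leads from [i] to [i + 1] with probability [p i]. *)
Lemma mix_contraction (c : R) u0 u1 u2 p0 p1 p2 : 0 <= c ->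
  c <= p0 <= 1 - c -> c <= p1 <= 1 - c -> c <= p2 <= 1 - c -> u0 + u1 + u2 = 0 ->
  `|u2 * p2 + u1 * (1 - p1)| + `|u0 * p0 + u2 * (1 - p2)| + `|u1 * p1 + u0 * (1 - p0)|
   <= (1 - c) * (`|u0| + `|u1| + `|u2|).
Proof.
move=> c0 /andP[a0 b0] /andP[a1 b1] /andP[a2 b2] s0.
have bnd u p : c <= p -> p <= 1 - c -> (0 <= u -> c * u <= u * p <= u - c * u) /\
                    (u <= 0 -> u - c * u <= u * p <= c * u).
  by move=> *; split=> ?; apply/andP; split; nra.
have [P0 N0] := bnd u0 p0 a0 b0; have [P1 N1] := bnd u1 p1 a1 b1.
have [P2 N2] := bnd u2 p2 a2 b2.
have E : c * u0 + c * u1 + c * u2 = 0 by rewrite -!mulrDr s0 mulr0.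
rewrite !mulrBr !mulr1 mulrBl mul1r !mulrDr.
have cn u : c * `|u| = `|c * u| by rewrite normrM (ger0_norm c0).
have C u : 0 <= u -> 0 <= c * u by move=> ?; rewrite mulr_ge0.
have C' u : u <= 0 -> c * u <= 0 by move=> ?; rewrite mulr_ge0_le0.
rewrite !cn; move: P0 N0 P1 N1 P2 N2 E.
move: (C u0) (C' u0) (C u1) (C' u1) (C u2) (C' u2).
move: (c * u0) (c * u1) (c * u2) (u0 * p0) (u1 * p1) (u2 * p2).
move=> w0 w1 w2 q0 q1 q2 A0 B0 A1 B1 A2 B2.
(* The sign patterns of [u] decide those of [c * u]; each of them is a linear problem. *)
have sgn (x y : R) : (0 <= x -> 0 <= y) -> (x <= 0 -> y <= 0) ->
   (0 <= x /\ 0 <= y /\ `|x| = x /\ `|y| = y) \/ (x <= 0 /\ y <= 0 /\ `|x| = - x /\ `|y| = - y).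
  move=> h h'; have [x0|/ltW x0] := lerP 0 x; [left|right].
    by rewrite !ger0_norm ?h.
  by rewrite !ler0_norm ?h'.
move=> P0 N0 P1 N1 P2 N2 E.
have [[h0 [k0 [-> ->]]]|[h0 [k0 [-> ->]]]] := sgn _ _ A0 B0;
have [[h1 [k1 [-> ->]]]|[h1 [k1 [-> ->]]]] := sgn _ _ A1 B1;
have [[h2 [k2 [-> ->]]]|[h2 [k2 [-> ->]]]] := sgn _ _ A2 B2.
all: try (move: (P0 h0) => /andP[{}P0 {N0}P0']); try (move: (N0 h0) => /andP[{P0}P0 {N0}P0']).
all: try (move: (P1 h1) => /andP[{}P1 {N1}P1']); try (move: (N1 h1) => /andP[{P1}P1 {N1}P1']).
all: try (move: (P2 h2) => /andP[{}P2 {N2}P2']); try (move: (N2 h2) => /andP[{P2}P2 {N2}P2']).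
all: clear A0 B0 A1 B1 A2 B2 sgn C C' cn bnd c0 a0 b0 a1 b1 a2 b2 s0 p0 p1 p2.
all: do 3 (match goal with |- context [`|?x|] => case: (ger0P x) => ? end); lra.
Qed.
End Contraction.

Section Dynamics.
Variable R : realType.
Implicit Types (x th : 'I_3 -> R) (e s : R).

(** Probability to cross edge [i - 1] from vertex [i], which leads to vertex
[i + 1]. *)
Definition turn th (i : 'I_3) : R := th (i - 1) / (th (i - 1) + th (i + 1)).

Definition arrivals th x (i : 'I_3) : R :=
  x (i - 1) * turn th (i - 1) + x (i + 1) * (1 - turn th (i + 1)).

(** One generation up to the error [e]. The parameter [s] is the ratio of the new
particles to the new total weight, and [1 - x i - arrivals th x i] is the part
of the traversals that neither start nor end at vertex [i], that is, which use
edge [i]. *)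
Definition noisy_step e s x th x' th' := forall i,
  `|x' i - arrivals th x i| <= e /\
  `|th' i - (th i + s * (1 - th i - x i - arrivals th x i))| <= e.

Definition prob_vec x := (forall i, 0 <= x i) /\ \sum_i x i = 1.

(** Distance to equilibrium: [(1 - th i) / 2] is the stationary law of the walk with
edge weights [th], as [1 - th i] is the weight of the edges at [i]. *)
Definition imbalance x th : R := \sum_i `|x i - (1 - th i) / 2|.

Lemma turn_bounds (c : R) th i : 0 < c -> prob_vec th -> (forall j, c <= th j) ->
  c <= turn th i <= 1 - c.
Proof.
move=> c0 [th0 th1] cth; rewrite /turn.
have E : th (i - 1) + th (i + 1) <= 1.
  move: (th0 0) (th0 1) (th0 2%:R) th1; rewrite sum3.
  by case: (ord3P i) => ->; rewrite !ord3E => *; lra.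
have D : 0 < th (i - 1) + th (i + 1).
  by apply: addr_gt0; exact: lt_le_trans (cth _).
move: (cth (i - 1)) (cth (i + 1)) E D.
move: (th (i - 1)) (th (i + 1)) => a b ca cb E D.
by rewrite ler_pdivlMr // ler_pdivrMr //; apply/andP; split; nra.
Qed.

(** [arrivals th] is linear and fixes the stationary law, so only the deviation
from the stationary law matters. *)
Lemma arrivals_shift x th i : (forall j, 0 < th j) -> \sum_i th i = 1 ->
  arrivals th x i =
  (1 - th i) / 2 + arrivals th (fun j => x j - (1 - th j) / 2) i.
Proof.
move=> th0; rewrite sum3 => S.
have E j : 1 - th j = th (j - 1) + th (j + 1).
  by case: (ord3P j) => ->; rewrite !ord3E -S; ring.
rewrite /arrivals /turn !E.
have n j : th (j - 1) + th (j + 1) != 0 by rewrite gt_eqF ?addr_gt0.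
by move: (n 0) (n 1) (n 2%:R); case: (ord3P i) => ->; rewrite !ord3E => *; field;
  repeat (apply/andP; split).
Qed.

(** With [u] the deviation of [x] from the stationary law and [w] its image under
the walk, [th' - th] is [- s * (u + w)] up to the error. So the deviation of [x']
is [(1 - s / 2) * w - (s / 2) * u], and the contraction of [w] by [5 / 6] gives a
contraction by at most [11 / 12]. *)
Lemma imbalance_step e s x th x' th' : 0 <= s <= 1 ->
  prob_vec x -> prob_vec th -> (forall i, 1 / 6%:R <= th i) ->
  noisy_step e s x th x' th' ->
  imbalance x' th' <= 11%:R / 12%:R * imbalance x th + 9%:R / 2 * e /\
  forall i, th i - 2 * imbalance x th - e <= th' i.
Proof.
move=> /andP[s0 s1] [x0 x1] th01 cth step.
have [th0 th1] := th01.
have thp j : 0 < th j by apply: lt_le_trans (cth j); lra.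
(* [u] sums to zero, as [mix_contraction] requires. *)
pose u j := x j - (1 - th j) / 2; pose w := arrivals th u.
have us : u 0 + u 1 + u 2%:R = 0.
  by move: x1 th1; rewrite !sum3 /u => *; lra.
have Sw : `|w 0| + `|w 1| + `|w 2%:R| <= (1 - 1 / 6%:R) * (`|u 0| + `|u 1| + `|u 2%:R|).
  rewrite /w /arrivals !ord3E.
  by apply: mix_contraction => //; try exact: turn_bounds; lra.
have arr i : arrivals th x i = (1 - th i) / 2 + w i by exact: arrivals_shift.
have i0 : 0 <= `|u 0| by []; have i1 : 0 <= `|u 1| by [].
have i2 : 0 <= `|u 2%:R| by [].
have j0 : 0 <= `|w 0| by []; have j1 : 0 <= `|w 1| by [].
have j2 : 0 <= `|w 2%:R| by [].
have dth i : `|th' i - (th i - s * (u i + w i))| <= e.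
  have [_] := step i; rewrite arr; congr (`| _ - (_ + _) | <= _).
  by rewrite /u; field.
have du i : `|x' i - (1 - th' i) / 2| <= (1 - s / 2) * `|w i| + s / 2 * `|u i| + 3%:R / 2 * e.
  have [] := step i; rewrite arr => + _; move: (dth i).
  have -> : x' i - (1 - th' i) / 2 = (1 - s / 2) * w i + (- (s / 2)) * u i +
     ((x' i - ((1 - th i) / 2 + w i)) + (th' i - (th i - s * (u i + w i))) / 2).
    by field.
  move=> A B; apply: (le_trans (ler_normD _ _)); apply: lerD.
    apply: (le_trans (ler_normD _ _)); rewrite !normrM normrN.
    by rewrite (ger0_norm (_ : 0 <= 1 - s / 2)) ?(ger0_norm (_ : 0 <= s / 2)) //; lra.
  apply: (le_trans (ler_normD _ _)); rewrite normrM (ger0_norm (_ : 0 <= 2^-1)); lra.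
have ibE : imbalance x th = `|u 0| + `|u 1| + `|u 2%:R| by rewrite /imbalance sum3.
split.
  rewrite ibE /imbalance sum3; move: (du 0) (du 1) (du 2%:R).
  move: Sw i0 i1 i2 j0 j1 j2.
  move: (`|_|) (`|_|) (`|_|) (`|_|) (`|_|) (`|_|) (`|_|) (`|_|) (`|_|) => *.
  nra.
move=> i; rewrite ibE; have := dth i; rewrite ler_norml => /andP[+ _].
have W : `|w i| + `|u i| <= 2 * (`|u 0| + `|u 1| + `|u 2%:R|).
  by case: (ord3P i) => ->; lra.
have : - (`|w i| + `|u i|) <= - (s * (u i + w i)).
  rewrite lerN2; apply: le_trans (_ : `|s * (u i + w i)| <= _); first exact: ler_norm.
  rewrite normrM (ger0_norm s0); apply: le_trans (_ : `|u i + w i| <= _).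
    by rewrite ler_piMl.
  by rewrite addrC; exact: ler_normD.
lra.
Qed.

(** The contraction pays for the motion of the weights: since
[2 = 24 * (1 - 11 / 12)], the quantity [th i - 24 * imbalance] never decreases
by more than a multiple of the error. The errors being summable, [th] stays
away from the boundary, and the hypothesis under which the walk contracts
reproduces itself. *)
Lemma interior_persists (x th : nat -> 'I_3 -> R) (s e : nat -> R) :
  (forall n, 0 <= s n <= 1) ->
  (forall n, prob_vec (x n)) -> (forall n, prob_vec (th n)) ->
  (forall n, noisy_step (e n) (s n) (x n) (th n) (x n.+1) (th n.+1)) ->
  (forall i, 1 / 4%:R <= th 0%N i) -> imbalance (x 0%N) (th 0%N) <= 1 / 10%:R ^+ 3 ->
  (forall n, \sum_(k < n) e k <= 1 / 10%:R ^+ 4) ->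
  forall n i, 1 / 6%:R <= th n i.
Proof.
move=> s01 px pth step th0 im0 se.
suff H n : forall i, th 0%N i - 24%:R * imbalance (x 0%N) (th 0%N) -
    109%:R * \sum_(k < n) e k <= th n i - 24%:R * imbalance (x n) (th n).
  move=> n i; have := H n i; have := th0 i; have := se n.
  have : 0 <= imbalance (x n) (th n) by exact: sumr_ge0.
  by lra.
elim: n => [|n IH] i; first by rewrite big_ord0 mulr0 subr0.
have c6 j : 1 / 6%:R <= th n j.
  have := IH j; have := th0 j; have := se n.
  have : 0 <= imbalance (x n) (th n) by exact: sumr_ge0.
  by lra.
have [A B] := imbalance_step (s01 n) (px n) (pth n) c6 (step n).
by have := IH i; have := B i; rewrite big_ord_recr /=; lra.
Qed.

End Dynamics.

(** If every vertex splits its children evenly, the deviation of the particles from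
[1 / 3] is multiplied by [- 1 / 2], up to rounding, and the deviation of the
weights satisfies [f' = (1 - s) * f - s * (u + u')]. As
[1 + 1 / 2 + 4 / 2 = 7 / 8 * 4], the factor [4] absorbs the influence of the
particles on the weights. *)
Lemma split_contraction (R : realType) (z M S n t n' t' sg : R) :
  2 <= z -> 0 < M -> 0 < S -> 0 <= sg <= 1 / 8%:R ->
  sg * (S + z * M) <= z * M ->
  `|2 * n' - z * (M - n)| <= 1 -> t' = t + (z * M - z * n - n') ->
  `|t' / (S + z * M) - 1 / 3%:R| + 4%:R * `|n' / (z * M) - 1 / 3%:R| <=
  (1 - sg) * (`|t / S - 1 / 3%:R| + 4%:R * `|n / M - 1 / 3%:R|) + 2 / M.
Proof.
move=> z2 M0 S0 /andP[sg0 sg8] sgS nE tE.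
have z0 : 0 < z by lra.
have zM0 : 0 < z * M by rewrite mulr_gt0.
have S'0 : 0 < S + z * M by rewrite addr_gt0.
have [s sE] : {s : R | s = z * M / (S + z * M)} by eexists.
have s01 : 0 <= s <= 1.
  by rewrite sE divr_ge0 ?(ltW zM0) ?(ltW S'0) //= ler_pdivrMr // mul1r lerDr ltW.
have [s0 s1] := andP s01.
have sgs : sg <= s by rewrite sE ler_pdivlMr.
set u := n / M - 1 / 3%:R; set f := t / S - 1 / 3%:R.
set u' := n' / (z * M) - 1 / 3%:R.
pose r := (2 * n' - z * (M - n)) / (2 * (z * M)).
have r0 : `|r| <= 4%:R^-1 / M.
  rewrite normrM normfV (gtr0_norm (_ : 0 < 2 * (z * M))) ?mulr_gt0 // ler_pdivrMr ?mulr_gt0 //.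
  apply: (le_trans nE); rewrite mulrAC -mulrA.
  rewrite (_ : 2 * (z * M) / M = 2 * z) ?mulrA; first lra.
  by field; rewrite gt_eqF.
have u'E : u' = - (u / 2) + r by rewrite /u' /u /r; field; rewrite !gt_eqF.
have fE : t' / (S + z * M) - 1 / 3%:R = (1 - s) * f - s * (u + u').
  by rewrite tE sE /f /u /u'; field; rewrite !gt_eqF.
have A1 : `|u'| <= `|u| / 2 + `|r|.
  rewrite u'E (le_trans (ler_normD _ _)) // normrN normrM (ger0_norm (_ : 0 <= 2^-1)) //.
have A2 : `|t' / (S + z * M) - 1 / 3%:R| <= (1 - s) * `|f| + (`|u| + `|u'|).
  rewrite fE (le_trans (ler_normB _ _)) // !normrM (ger0_norm s0).
  rewrite (ger0_norm (_ : 0 <= 1 - s)); last by lra.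
  rewrite lerD2l (le_trans (ler_piMl _ s1)) //; exact: ler_normD.
have A3 : (1 - s) * `|f| <= (1 - sg) * `|f| by rewrite ler_wpM2r //; lra.
have A4 : 7%:R / 8%:R * `|u| <= (1 - sg) * `|u| by rewrite ler_wpM2r //; lra.
have Mi : 0 < M^-1 by rewrite invr_gt0.
lra.
Qed.

(** * The normalised dynamics near a side of the simplex *)

Section HubAlgebra.
Variable R : realType.
Implicit Types (a b c t u v x p e s : R).

Lemma convex_diff t a b c : 0 <= t <= 1 -> `|a| <= c -> `|b| <= c ->
  `|t * a - (1 - t) * b| <= c.
Proof. by rewrite !ler_norml => /andP[? ?] /andP[? ?] /andP[? ?]; apply/andP; split; nra. Qed.

(** The hub is vertex [0]; [a], [b], [c] are the weights of the edges [0], [1], [2],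
and [t] is the probability to go from the hub to vertex [1], along edge [2]. The
last equation says that the skew is, up to the factor [1 - a], the excess of the
leaf [1] over its share [t] of the particles at the leaves. *)
Lemma leaf_split a b c t x1 x2 : 0 < a -> a + b + c = 1 ->
  1 / 5%:R <= b -> 1 / 5%:R <= c -> t * (b + c) = c ->
  [/\ 0 <= t <= 1, b = (1 - t) * (1 - a), c = t * (1 - a) &
      b * x1 - c * x2 = (1 - a) * ((1 - t) * x1 - t * x2)].
Proof.
move=> a0 S b5 c5 tE; have bc : b + c = 1 - a by lra.
have cE : c = t * (1 - a) by rewrite -bc.
have bE : b = (1 - t) * (1 - a) by rewrite mulrBl mul1r -cE; lra.
by split=> //; [apply/andP; split; nra|rewrite bE cE; ring].
Qed.

Lemma skew_normalized a v : 0 < a <= 1 -> `|v| <= 1 -> `|v| <= `|(1 - a) * v| + a.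
Proof.
move=> /andP[a0 a1] v1; rewrite normrM (ger0_norm (_ : 0 <= 1 - a)); last by lra.
by have : 0 <= `|v| by []; nra.
Qed.

(** A particle at a leaf crosses the thin edge with probability [a / (a + c)], which
is at most [5 * a]. *)
Lemma crossing_bound a c p x : 0 < a -> 1 / 5%:R <= c -> p * (a + c) = a ->
  0 <= x <= 1 -> 0 <= x * p <= 5%:R * a.
Proof.
move=> a0 c5 pE /andP[x0 x1].
have p0 : 0 <= p by nra.
have p5 : p <= 5%:R * a by nra.
by rewrite mulr_ge0 //= (le_trans _ p5) // ler_piMl.
Qed.

(** The particles which leave the hub are split in the proportions [t] and [1 - t],
that is [c] to [b], so their skew with respect to the old weights vanishes. Only
the change of the weights contributes, which is [s] times the old skew, with
opposite signs on the two edges. The remaining terms come from the traffic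
[q1], [q2] and [f1], [f2] on the thin edge and from the errors. *)
Lemma skew_step a b' c' t v x0 q1 q2 e1 e2 e3 e4 f1 f2 e s b c :
  0 <= s <= 1 -> 0 <= t <= 1 -> 0 <= a -> t * b = (1 - t) * c -> 0 <= x0 <= 1 ->
  0 <= b' -> 0 <= c' -> b' + c' <= 1 ->
  `|q1| <= 5%:R * a -> `|q2| <= 5%:R * a -> `|f1| <= 5%:R * a -> `|f2| <= 5%:R * a ->
  `|e1| <= e -> `|e2| <= e -> `|e3| <= e -> `|e4| <= e ->
  b' = b + s * (- v + f1) + e3 -> c' = c + s * (v + f2) + e4 ->
  `|b' * (x0 * t + q1 + e1) - c' * (x0 * (1 - t) + q2 + e2)| <=
  s * `|v| + 10%:R * a + 2 * e.
Proof.
move=> /andP[s0 s1] t01 a0 tbc /andP[x00 x01] b0 c0 bc q1a q2a f1a f2a e1e e2e e3e e4e bE cE.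
have -> : b' * (x0 * t + q1 + e1) - c' * (x0 * (1 - t) + q2 + e2) =
   x0 * (s * (- v + (t * f1 - (1 - t) * f2)) + (t * e3 - (1 - t) * e4)) +
   (b' * (q1 + e1) - c' * (q2 + e2)).
  have -> : b' * (x0 * t + q1 + e1) - c' * (x0 * (1 - t) + q2 + e2) =
    x0 * (t * b' - (1 - t) * c') + (b' * (q1 + e1) - c' * (q2 + e2)) by ring.
  congr (_ * _ + _); rewrite bE cE.
  have -> : t * (b + s * (- v + f1) + e3) - (1 - t) * (c + s * (v + f2) + e4) =
    t * b - (1 - t) * c + (s * (- v + (t * f1 - (1 - t) * f2)) + (t * e3 - (1 - t) * e4)) by ring.
  by rewrite tbc subrr add0r.
have K1 : `|- v + (t * f1 - (1 - t) * f2)| <= `|v| + 5%:R * a.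
  by apply: (le_trans (ler_normD _ _)); rewrite normrN lerD // convex_diff.
have K2 : `|t * e3 - (1 - t) * e4| <= e by exact: convex_diff.
have K4 : `|x0 * (s * (- v + (t * f1 - (1 - t) * f2)) + (t * e3 - (1 - t) * e4))|
   <= s * `|v| + 5%:R * a + e.
  rewrite normrM (ger0_norm x00); apply: le_trans (_ : 1 * _ <= _); first exact: ler_wpM2r.
  rewrite mul1r; apply: (le_trans (ler_normD _ _)); rewrite normrM (ger0_norm s0) lerD //.
  apply: (le_trans (ler_wpM2l s0 K1)); rewrite mulrDr lerD2l ler_piMl //.
  by rewrite mulr_ge0.
have K3 : `|b' * (q1 + e1) - c' * (q2 + e2)| <= 5%:R * a + e.
  have Q (q f : R) : `|q| <= 5%:R * a -> `|f| <= e -> `|q + f| <= 5%:R * a + e.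
    by move=> *; apply: (le_trans (ler_normD _ _)); exact: lerD.
  have e0 : 0 <= 5%:R * a + e by exact: le_trans (normr_ge0 _) (Q _ _ q1a e1e).
  apply: (le_trans (ler_normB _ _)); rewrite !normrM (ger0_norm b0) (ger0_norm c0).
  apply: le_trans (_ : b' * (5%:R * a + e) + c' * (5%:R * a + e) <= _).
    by apply: lerD; apply: ler_wpM2l => //; exact: Q.
  by rewrite -mulrDl ler_piMl.
apply: (le_trans (ler_normD _ _)); lra.
Qed.

Lemma leaf_weight_step a v f e s b b' : 0 <= s <= 1 -> 0 <= a ->
  `|f| <= 5%:R * a -> `|b' - (b + s * (v + f))| <= e ->
  b - (`|v| + 5%:R * a + e) <= b'.
Proof.
move=> /andP[s0 s1] a0 fa; rewrite ler_norml => /andP[+ _].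
have : `|s * (v + f)| <= `|v| + 5%:R * a.
  rewrite normrM (ger0_norm s0) (le_trans (ler_piMl _ s1)) //.
  by rewrite (le_trans (ler_normD _ _)) // lerD2l.
by rewrite ler_norml => /andP[+ _]; lra.
Qed.

(** When the particles at the leaves are split as [t] to [1 - t], the number which
crosses the thin edge is [2 * (x1 + x2) * a / (1 - a)] to first order: each end
of the edge contributes the same. The skew measures the distance to this split. *)
Lemma thin_edge_traffic a b c t x1 x2 p1 p2 : 0 < a -> a + b + c = 1 ->
  1 / 5%:R <= b -> 1 / 5%:R <= c -> b = (1 - t) * (1 - a) -> c = t * (1 - a) ->
  0 <= x1 -> 0 <= x2 -> x1 + x2 <= 1 -> p1 * c <= a -> p2 * b <= a ->
  x1 * p1 + x2 * p2 <=
  a * (2 * (x1 + x2) + 5%:R * `|(1 - t) * x1 - t * x2| + 5%:R * a).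
Proof.
move=> a0 S b5 c5 bE cE x10 x20 x12 p1c p2b.
set v := (1 - t) * x1 - t * x2.
have [i iE] : {i | c * i = 1} by exists c^-1; rewrite divff // gt_eqF //; lra.
have [k kE] : {k | b * k = 1} by exists b^-1; rewrite divff // gt_eqF //; lra.
have [r rE] : {r | (1 - a) * r = 1} by exists (1 - a)^-1; rewrite divff // gt_eqF //; lra.
have i0 : 0 <= i <= 5%:R by clear -c5 iE; apply/andP; split; nra.
have k0 : 0 <= k <= 5%:R by clear -b5 kE; apply/andP; split; nra.
have ti : t * i = r.
  transitivity (t * (1 - a) * i * r); last by rewrite -cE iE mul1r.
  by rewrite -[LHS]mulr1 -[X in _ * X = _]rE; ring.
have tk : (1 - t) * k = r.
  transitivity ((1 - t) * (1 - a) * k * r); last by rewrite -bE kE mul1r.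
  by rewrite -[LHS]mulr1 -[X in _ * X = _]rE; ring.
have a35 : a <= 3%:R / 5%:R by lra.
have r0 : 0 <= r <= 5%:R / 2 by clear -a35 rE; apply/andP; split; nra.
have rr : r - 1 <= 5%:R / 2 * a.
  by move/andP: r0 => [r00 r52]; clear -rE r52 a0; nra.
(* [i] and [k] are the inverses of [c] and [b]. *)
have vik : v * (i - k) <= 5%:R * `|v|.
  rewrite mulrC; apply: le_trans (ler_norm _) _; rewrite normrM ler_wpM2r //.
  by rewrite ler_norml; apply/andP; split; lra.
have E : x1 * i + x2 * k = 2 * (x1 + x2) * r + v * (i - k).
  rewrite (_ : x1 * i + x2 * k = (x1 + x2) * (t * i) + (x1 + x2) * ((1 - t) * k) + v * (i - k)).
    by rewrite ti tk; ring.
  by rewrite /v; ring.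
have Yr : (x1 + x2) * (r - 1) <= 5%:R / 2 * a.
  apply: le_trans (_ : (x1 + x2) * (5%:R / 2 * a) <= _).
    by apply: ler_wpM2l => //; exact: addr_ge0.
  by rewrite ler_piMl // mulr_ge0 // ltW.
have A1 : x1 * p1 <= a * (x1 * i).
  by rewrite mulrCA ler_wpM2l // -[p1]mulr1 -iE mulrA ler_wpM2r //; case/andP: i0.
have A2 : x2 * p2 <= a * (x2 * k).
  by rewrite mulrCA ler_wpM2l // -[p2]mulr1 -kE mulrA ler_wpM2r //; case/andP: k0.
have A3 : a * (x1 * i + x2 * k) <= a * (2 * (x1 + x2) + 5%:R * `|v| + 5%:R * a).
  by rewrite ler_pM2l // E; clear -Yr vik; lra.
by rewrite (le_trans (lerD A1 A2)) // -mulrDr.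
Qed.

End HubAlgebra.

Section HubStep.
Variable R : realType.
Implicit Types (x th : 'I_3 -> R) (e s : R).

(** Vanishes when the particles at the leaves [1], [2] are split in the proportion
in which the hub distributes its particles. *)
Definition skew x th : R := th 1 * x 1 - th 2%:R * x 2%:R.

(** Hub and leaves exchange their particles, apart from the traffic on the thin
edge. The last bound is the heart of the matter: [th 0] shrinks by [1 - s] when
the particles are at the hub, since the total weight grows and edge [0] is not
used; particles at the leaves contribute [2 * (x 1 + x 2)] by their traffic on
edge [0], so that the growth is at most [1 + s] on the way back to the hub. *)
Lemma hub_step e s x th x' th' : 0 <= s <= 1 ->
  prob_vec x -> prob_vec th -> prob_vec th' ->
  0 < th 0 -> 1 / 5%:R <= th 1 -> 1 / 5%:R <= th 2%:R ->
  noisy_step e s x th x' th' ->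
  [/\ x' 0 <= x 1 + x 2%:R + e,
      x' 1 + x' 2%:R <= x 0 + 10%:R * th 0 + 2 * e,
      `|skew x' th'| <= s * `|skew x th| + 11%:R * th 0 + 2 * e,
      th 1 - (`|skew x th| + 6%:R * th 0 + e) <= th' 1 /\
      th 2%:R - (`|skew x th| + 6%:R * th 0 + e) <= th' 2%:R &
      th' 0 <= th 0 * (1 + s * (2 * (x 1 + x 2%:R) - 1 +
                 5%:R * `|skew x th| + 10%:R * th 0)) + e].
Proof.
move=> s01 [x0 x1] [th0 th1] [th'0 th'1] a0 c1 c2 step.
have [A0 B0] := step 0; have [A1 B1] := step 1; have [A2 B2] := step 2%:R.
move: A0 B0 A1 B1 A2 B2; rewrite /arrivals !ord3E /skew.
move: (x0 0) (x0 1) (x0 2%:R) x1 th1 (th'0 0) (th'0 1) (th'0 2%:R) th'1; rewrite !sum3.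
set t := turn th 0; set p1 := turn th 1; have [p2 p2E] : {p2 | turn th 2%:R = 1 - p2}.
  by exists (1 - turn th 2%:R); ring.
rewrite p2E (_ : 1 - (1 - p2) = p2); last by ring.
have tE : t * (th 1 + th 2%:R) = th 2%:R.
  by rewrite /t /turn !ord3E [th 1 + _]addrC divfK // gt_eqF //; lra.
have p1E : p1 * (th 0 + th 2%:R) = th 0.
  by rewrite /p1 /turn !ord3E divfK // gt_eqF //; lra.
have {}p2E : p2 * (th 0 + th 1) = th 0.
  rewrite (_ : p2 = 1 - turn th 2%:R); last by rewrite p2E; ring.
  by rewrite /turn !ord3E; field; rewrite gt_eqF //; lra.
clearbody t p1.
move: (x 0) (x 1) (x 2%:R) (th 0) (th 1) (th 2%:R) c1 c2 a0 tE p1E p2E.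
move: (x' 0) (x' 1) (x' 2%:R) (th' 0) (th' 1) (th' 2%:R).
clear x x' th th' x0 th0 th'0 step.
move=> y0 y1 y2 a' b' c' x0 x1 x2 a b c cb cc a0 tE p1E p2E px0 px1 px2 xs ths qa qb qc ths'.
have [t01 bE cE gE] := leaf_split x1 x2 a0 ths cb cc tE.
have x1p : 0 <= x1 * p1 <= 5%:R * a.
  by apply: crossing_bound p1E _ => //; clear -px0 px1 px2 xs; lra.
have x2p : 0 <= x2 * p2 <= 5%:R * a.
  by apply: crossing_bound p2E _ => //; clear -px0 px1 px2 xs; lra.
have [x1p0 x1p5] := andP x1p; have [x2p0 x2p5] := andP x2p.
have a1 : a <= 1 by clear -ths cb cc; lra.
set v := (1 - t) * x1 - t * x2 in gE.
have v1 : `|v| <= 1.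
  rewrite /v; case/andP: t01 => t0 t1; clear -t0 t1 px0 px1 px2 xs.
  by rewrite ler_norml; apply/andP; split; nra.
have vg : `|v| <= `|b * x1 - c * x2| + a.
  by rewrite gE; apply: skew_normalized; rewrite ?a0.
have ta0 : 0 <= t * a <= a.
  by case/andP: t01 => t0 t1; rewrite mulr_ge0 ?(ltW a0) // ler_piMl // ltW.
have [ta00 ta1] := andP ta0.
pose f1 := (1 - t) * a - x2 * p2; pose f2 := t * a - x1 * p1.
have f1a : `|f1| <= 5%:R * a.
  by rewrite /f1 ler_norml; clear -ta00 ta1 x2p0 x2p5; apply/andP; split; lra.
have f2a : `|f2| <= 5%:R * a.
  by rewrite /f2 ler_norml; clear -ta00 ta1 x1p0 x1p5; apply/andP; split; lra.
have x0E : x0 = 1 - x1 - x2 by rewrite -xs; ring.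
have -> : 1 - b - x1 - (x0 * t + x2 * p2) = - v + f1.
  by rewrite /f1 /v bE x0E; ring.
have -> : 1 - c - x2 - (x1 * p1 + x0 * (1 - t)) = v + f2.
  by rewrite /f2 /v cE x0E; ring.
move=> A0 B0 A1 B1 A2 B2; have [s0 s1] := andP s01.
have a0' := ltW a0.
split.
- move: A0; rewrite ler_norml => /andP[_]; clear -x1p0 x1p5 x2p0 x2p5; lra.
- move: A1 A2; rewrite !ler_norml => /andP[_ +] /andP[_].
  by clear -x1p0 x1p5 x2p0 x2p5; lra.
- pose e1 := y1 - (x0 * t + x2 * p2); pose e2 := y2 - (x1 * p1 + x0 * (1 - t)).
  have -> : b' * y1 - c' * y2 =
      b' * (x0 * t + x2 * p2 + e1) - c' * (x0 * (1 - t) + x1 * p1 + e2).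
    by rewrite /e1 /e2; ring.
  apply: le_trans (_ : s * `|v| + 10%:R * a + 2 * e <= _); last first.
    have : s * `|v| <= s * `|b * x1 - c * x2| + s * a by rewrite -mulrDr ler_wpM2l.
    have : s * a <= a by rewrite ler_piMl.
    by clear; lra.
  apply: (@skew_step _ a b' c' t v x0 _ _ _ _ (b' - (b + s * (- v + f1)))
           (c' - (c + s * (v + f2))) f1 f2 e s b c) => //.
  + by rewrite bE cE; ring.
  + by clear -px0 px1 px2 xs; lra.
  + by clear -qa qb qc ths'; lra.
  + by rewrite ger0_norm; case/andP: x2p.
  + by rewrite ger0_norm; case/andP: x1p.
  + by ring.
  + by ring.
- split.
    have := leaf_weight_step s01 a0' f1a B1; rewrite normrN; clear -vg; lra.
  have := leaf_weight_step s01 a0' f2a B2; clear -vg; lra.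
- move: B0; rewrite ler_norml => /andP[_].
  have p1c : p1 * c <= a by clear -p1E a0 cc; nra.
  have p2b : p2 * b <= a by clear -p2E a0 cb; nra.
  have W : x1 * p1 + x2 * p2 <=
      a * (2 * (x1 + x2) + 5%:R * `|b * x1 - c * x2| + 10%:R * a).
    apply: le_trans (thin_edge_traffic a0 ths cb cc bE cE px1 px2 _ p1c p2b) _.
      by clear -px0 xs; lra.
    by rewrite ler_pM2l // -/v; clear -vg; lra.
  have : s * (x1 * p1 + x2 * p2) <=
      s * (a * (2 * (x1 + x2) + 5%:R * `|b * x1 - c * x2| + 10%:R * a)) by exact: ler_wpM2l.
  by rewrite x0E; clear; lra.
Qed.

(** Perturbation of the two-step factor: an error [h] in the rates costs at most
[4 * h]. *)
Lemma thin_edge_factor (k h s s' : R) : 0 <= s <= 1 -> 0 <= s' <= 1 ->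
  0 <= h <= 1 -> 4%:R * h <= k -> (1 - s) * (1 + s') <= 1 - 2 * k ->
  (1 - s * (1 - h)) * (1 + s' * (1 + h)) <= 1 - k.
Proof.
move=> /andP[s0 s1] /andP[s0' s1'] /andP[h0 h1] hk H.
have -> : (1 - s * (1 - h)) * (1 + s' * (1 + h)) =
  (1 - s) * (1 + s') + h * (s' * (1 - s)) + h * (s * (1 + s' + h * s')) by ring.
have : h * (s' * (1 - s)) <= h.
  by rewrite ler_piMr // mulr_ile1 //; lra.
have hs : 0 <= h * s' <= 1 by rewrite mulr_ge0 //= mulr_ile1.
have : h * (s * (1 + s' + h * s')) <= h * 3%:R.
  rewrite ler_wpM2l // (le_trans (ler_piMl _ s1)) //; lra.
lra.
Qed.

(** The growth of the thin edge over a trip from the hub and back: the first factor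
is close to [1 - s] because the particles start at the hub, and the second is at
most [1 + s'] up to [h = k / 4], wherever they have gone. *)
Lemma thin_edge_double (k w g a e e' s s' a' a'' g' y' : R) :
  0 <= s <= 1 -> 0 <= s' <= 1 -> k <= 1 -> 0 < a -> 0 < a' -> 0 <= e ->
  0 <= w -> 0 <= g -> y' <= 1 ->
  (1 - s) * (1 + s') <= 1 - 2 * k ->
  10%:R * (w + 2 * g + 26%:R * a + 8%:R * e) <= k ->
  g' <= g + 11%:R * a + 2 * e ->
  a' <= a * (1 + s * (2 * w - 1 + 5%:R * g + 10%:R * a)) + e ->
  a'' <= a' * (1 + s' * (2 * y' - 1 + 5%:R * g' + 10%:R * a')) + e' ->
  a' <= a + e /\ a'' <= (1 - k) * a + 3%:R * e + e'.
Proof.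
move=> s01 s01' k1 a0 a0' e0 w0 g0 y1 H hk g'E a'E a''E.
have [s0 s1] := andP s01; have [s0' s1'] := andP s01'.
have [h hE] : {h : R | 4%:R * h = k} by exists (k / 4%:R); field.
have h01 : 0 <= h <= 1 by apply/andP; split; lra.
have a1 : a' <= a * (1 - s * (1 - h)) + e.
  apply: (le_trans a'E); rewrite lerD2r ler_pM2l // -mulrN lerD2l ler_wpM2l //; lra.
have a2 : a' <= a + e.
  apply: (le_trans a1); rewrite lerD2r ler_piMr ?(ltW a0) // gerBl mulr_ge0 //; lra.
split=> //.
have a3 : a'' <= a' * (1 + s' * (1 + h)) + e'.
  apply: (le_trans a''E); rewrite lerD2r ler_pM2l // lerD2l ler_wpM2l //; lra.
have K : 0 <= 1 + s' * (1 + h) <= 3%:R.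
  have : 0 <= s' * (1 + h) by rewrite mulr_ge0 //; lra.
  have : s' * (1 + h) <= 1 + h by rewrite ler_piMl //; lra.
  by move=> *; apply/andP; split; lra.
have [K0 K1] := andP K.
apply: (le_trans a3); rewrite lerD2r.
apply: (le_trans (ler_wpM2r K0 a1)).
rewrite mulrDl -mulrA; apply: lerD; last by rewrite mulrC ler_wpM2r.
rewrite [X in _ <= X]mulrC ler_pM2l //; apply: thin_edge_factor => //; lra.
Qed.

(** A round trip from the hub. The skew and the weight of the thin edge contract,
the number of particles that have left the parity class of the hub does not grow
by more than a multiple of the thin edge, and the two thick edges move by no more
than these small quantities. *)
Lemma hub_double_step (k e e' s s' : R) x th x' th' x'' th'' :
  0 < k <= 1 -> 0 <= s <= 1 -> 0 <= s' <= 1 -> 0 <= e -> 0 <= e' ->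
  s <= 1 - k -> s' <= 1 - k -> (1 - s) * (1 + s') <= 1 - 2 * k ->
  prob_vec x -> prob_vec th -> prob_vec x' -> prob_vec th' ->
  prob_vec th'' ->
  0 < th 0 -> 0 < th' 0 ->
  noisy_step e s x th x' th' -> noisy_step e' s' x' th' x'' th'' ->
  1 / 4%:R <= th 1 -> 1 / 4%:R <= th 2%:R ->
  10%:R * (x 1 + x 2%:R + 2 * `|skew x th| + 26%:R * th 0 + 8%:R * e) <= k ->
  [/\ x'' 1 + x'' 2%:R <= x 1 + x 2%:R + 10%:R * th 0 + 11%:R * e + 2 * e',
      `|skew x'' th''| <= (1 - k) * `|skew x th| + 22%:R * th 0 + 13%:R * e + 2 * e',
      th 1 - 2 * `|skew x th| - 23%:R * th 0 - 9%:R * e - e' <= th'' 1 /\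
      th 2%:R - 2 * `|skew x th| - 23%:R * th 0 - 9%:R * e - e' <= th'' 2%:R &
      th'' 0 <= (1 - k) * th 0 + 3%:R * e + e'].
Proof.
move=> /andP[k0 k1] s01 s'01 e0 e0' sk s'k ss px pth px' pth' pth'' a0 a0' st st' c1 c2 H.
have := hub_step s'01 px' pth' pth'' a0'.
have g0 : 0 <= `|skew x th| by [].
have g0' : 0 <= `|skew x' th'| by [].
have [s0 s1] := andP s01; have [s0' s1'] := andP s'01.
have w0 : 0 <= x 1 + x 2%:R by have [X0 _] := px; rewrite addr_ge0.
have y1 : x' 1 + x' 2%:R <= 1.
  by have [Y0] := px'; rewrite sum3 => <-; have := Y0 0; clear; lra.
have [||P1 _ P3 [P4 P4'] P5] := hub_step s01 px pth pth' a0 _ _ st.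
- by clear -c1; lra.
- by clear -c2; lra.
have G1 : `|skew x' th'| <= (1 - k) * `|skew x th| + 11%:R * th 0 + 2 * e.
  by apply: (le_trans P3); rewrite -2!addrA lerD2r ler_wpM2r.
have G2 : `|skew x' th'| <= `|skew x th| + 11%:R * th 0 + 2 * e.
  by apply: (le_trans P3); rewrite -2!addrA lerD2r ler_piMl.
have Hth : `|skew x th| + 6%:R * th 0 + e <= 1 / 20%:R by clear -H w0 g0 a0 e0 k1; lra.
move=> /(_ e' x'' ltac:(clear -P4 Hth c1; lra) ltac:(clear -P4' Hth c2; lra) st').
case=> [_ P2' P3' [P4'' Q4] P5'].
(* At the middle of the trip nothing is assumed on the position of the particles. *)
have [a1 a2] := thin_edge_double s01 s'01 k1 a0 a0' e0 w0 g0 y1 ss H G2 P5 P5'.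
move: (`|skew x' th'|) (`|skew x'' th''|) (`|skew x th|) (th 0) (th' 0) P3' P4'' Q4 G1 G2
  P2' P4 P4' P1 g0 g0' a0 a1 a2 H.
clear -s'k s0' s1' s0 s1 k0 k1 e0 e0' w0.
move=> g' g'' g a a' P3' P4'' Q4 G1 G2 P2' P4 P4' P1 g0 g0' a0 a1 a2 H.
split=> //.
- by clear -P1 P2' a1; lra.
- have : s' * g' <= (1 - k) * g'.
    by rewrite ler_wpM2r.
  have : (1 - k) * g' <= (1 - k) * g + (11%:R * a + 2 * e).
    have : (1 - k) * g' <= g' by rewrite ler_piMl //; lra.
    by clear -G1; lra.
  by clear -P3' a1; lra.
- by split; [clear -P4 P4'' G2 a1|clear -P4' Q4 G2 a1]; lra.
Qed.

End HubStep.

Section Boundary.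
Variable R : realType.
Implicit Types (k K mu m s e : R).

(** The share [s] follows [s' = m * s / (1 + m * s)] with [m] close to [mu]. The map
with [m = mu] has the fixed point [p = (mu - 1) / mu], and the interval from
[3 / 4 * p] to [1] is mapped into itself with room for the deviation of [m]. *)
Lemma share_bounds mu p m s s' : 1 < mu -> p * mu = mu - 1 ->
  `|m - mu| <= (mu - 1) / 8%:R -> 3%:R / 4%:R * p <= s <= 1 ->
  s' * (1 + m * s) = m * s ->
  3%:R / 4%:R * p <= s' <= 2 * mu / (1 + 2 * mu).
Proof.
move=> mu1 pE; rewrite ler_norml => /andP[m0 m1] /andP[s0 s1] E.
have p01 : 0 < p < 1 by apply/andP; split; nra.
have [p0 p1] := andP p01.
have ms : (mu - (mu - 1) / 8%:R) * (3%:R / 4%:R * p) <= m * s.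
  by apply: ler_pM => //; [|rewrite mulr_ge0 //|]; lra.
have ms1 : m * s <= 2 * mu.
  by rewrite (le_trans (ler_piMr _ s1)) //; lra.
have ms0 : 0 < m * s.
  by apply: lt_le_trans ms; rewrite mulr_gt0 ?mulr_gt0 //; lra.
move: (m * s) E ms ms1 ms0 => y E ms ms1 ms0.
have s'1 : s' <= 1 by clear -E ms0; nra.
rewrite ler_pdivlMr; last by lra.
have M : (mu - (mu - 1) / 8%:R) * (1 - 3%:R / 4%:R * p) >= 1.
  by clear -mu1 pE p0 p1; nra.
apply/andP; split; last first.
  have E2 : s' * (1 + y) * (1 + 2 * mu) = y * (1 + 2 * mu) by rewrite E.
  by rewrite -subr_ge0 -(pmulr_lge0 _ (_ : 0 < 1 + y)); lra.
have Y : 3%:R / 4%:R * p <= (1 - 3%:R / 4%:R * p) * y.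
  apply: le_trans (ler_wpM2l _ ms); last by lra.
  rewrite mulrA ler_peMl //; [|rewrite mulrC]; lra.
by rewrite -subr_ge0 -(pmulr_lge0 _ (_ : 0 < 1 + y)); lra.
Qed.

(** The thin edge loses more on the way out than it gains on the way back: as
[s' = m * s / (1 + m * s)], the product is
[1 - s * (1 - m + 2 * m * s) / (1 + m * s)], and [1 - m + 2 * m * s] is positive
for [s] near the fixed point [p] or above, being [mu - 1] at [s = p], [m = mu]. *)
Lemma share_product mu p m s s' : 1 < mu -> p * mu = mu - 1 ->
  `|m - mu| <= (mu - 1) / 8%:R -> 3%:R / 4%:R * p <= s <= 1 ->
  s' * (1 + m * s) = m * s ->
  (1 - s) * (1 + s') <= 1 - 2 * (p ^+ 2 / (32%:R * mu)).
Proof.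
move=> mu1 pE; rewrite ler_norml => /andP[m0 m1] /andP[s0 s1] E.
have p01 : 0 < p < 1 by apply/andP; split; nra.
have [p0 p1] := andP p01.
have [k kE] : {k | 32%:R * mu * k = p ^+ 2}.
  by exists (p ^+ 2 / (32%:R * mu)); rewrite mulrC divfK // gt_eqF //; lra.
rewrite -kE [_ * k]mulrC mulfK ?gt_eqF //; last by lra.
have A : p / 4%:R <= 1 - m + 2 * m * s.
  have [s2|/ltW s2] := lerP (1 / 2) s.
    by clear -s2 p1 mu1 m0; nra.
  have : (mu + (mu - 1) / 8%:R) * (2 * s - 1) <= m * (2 * s - 1).
    by clear -m1 s2; nra.
  have : (mu + (mu - 1) / 8%:R) * (2 * (3%:R / 4%:R * p) - 1) <=
         (mu + (mu - 1) / 8%:R) * (2 * s - 1) by apply: ler_wpM2l; lra.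
  have : p * p <= p by rewrite ler_piMl // ltW.
  have : p <= mu - 1 by clear -pE mu1 p0; nra.
  have : p * (mu - 1) >= 0 by apply: mulr_ge0; lra.
  by clear -pE p0; lra.
have ms : 0 <= m * s <= 2 * mu.
  rewrite mulr_ge0 /=; [|lra..].
  by rewrite (le_trans (ler_piMr _ s1)) //; lra.
have [ms0 ms1] := andP ms.
have k0 : 0 <= k by rewrite -(pmulr_rge0 _ (_ : 0 < 32%:R * mu)) ?kE ?sqr_ge0 //; lra.
have B : 2 * k * (1 + m * s) <= s * (1 - m + 2 * m * s).
  apply: le_trans (_ : 3%:R / 4%:R * p * (p / 4%:R) <= _); last first.
    by apply: ler_pM => //; rewrite ?mulr_ge0 //; lra.
  rewrite (_ : 3%:R / 4%:R * p * (p / 4%:R) = 3%:R / 16%:R * p ^+ 2); last by field.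
  rewrite -kE; apply: le_trans (_ : 2 * k * (3%:R * mu) <= _).
    by apply: ler_wpM2l; lra.
  by have := mulr_ge0 k0 (ltW (lt_trans ltr01 mu1)); clear; lra.
have y1 : 0 < 1 + m * s by lra.
have E3 : (1 + s') * (1 + m * s) = 1 + 2 * m * s by rewrite mulrDl mul1r E; ring.
rewrite -(ler_pM2r y1) -mulrA E3.
by clear -B; lra.
Qed.

(** Each term pays with its contraction for what it feeds into the former ones: the
skew contracts by [1 - k] and feeds the drift of the thick edges, so it carries
a factor of order [1 / k]; the thin edge feeds the skew and carries a factor of
order [1 / k ^+ 2]. *)
Definition hub_potential k (x th : 'I_3 -> R) : R :=
  x 1 + x 2%:R + 2 / k * `|skew x th| + 80%:R / k ^+ 2 * th 0.

(** Over a round trip the potential decreases by at least the amount by which the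
thick edges may shrink, up to the errors. So [th 1] and [th 2], less the
potential, are almost nondecreasing, and the smallness that [hub_double_step]
requires is preserved. *)
Lemma hub_persists k (x th : nat -> 'I_3 -> R) (s e : nat -> R) :
  0 < k <= 1 ->
  (forall n, 0 <= s n <= 1 - k) ->
  (forall n, (1 - s n) * (1 + s n.+1) <= 1 - 2 * k) ->
  (forall n, 0 <= e n) -> (forall n, \sum_(i < n) e i <= k ^+ 3 / 10%:R ^+ 6) ->
  (forall n, prob_vec (x n)) -> (forall n, prob_vec (th n)) -> (forall n, 0 < th n 0) ->
  (forall n, noisy_step (e n) (s n) (x n) (th n) (x n.+1) (th n.+1)) ->
  x 0%N 1 = 0 -> x 0%N 2%:R = 0 -> th 0%N 0 <= k ^+ 3 / 10%:R ^+ 5 ->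
  3%:R / 10%:R <= th 0%N 1 -> 3%:R / 10%:R <= th 0%N 2%:R ->
  forall n, [/\ 1 / 4%:R <= th n.*2 1, 1 / 4%:R <= th n.*2 2%:R &
     th n.*2.+2 0 <= (1 - k) * th n.*2 0 + 3%:R * e n.*2 + e n.*2.+1].
Proof.
move=> k01 s01 ss e0 se px pth a0 step x1 x2 ai b0 c0.
have [k0 k1] := andP k01.
have [K KE] : {K | k * K = 1} by exists k^-1; rewrite divff // gt_eqF.
have KV : k^-1 = K by rewrite -[LHS]mulr1 -KE mulKf // gt_eqF.
have K1 : 1 <= K by clear -k0 k1 KE; nra.
have K0 : 0 <= K by lra.
have K2 : 1 <= K ^+ 2 by rewrite exprn_ege1.
have KK : K <= K ^+ 2 by rewrite expr2 ler_peMl.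
have k3 : k ^+ 3 * K ^+ 2 = k.
  have -> : k ^+ 3 * K ^+ 2 = k * (k * K) ^+ 2 by ring.
  by rewrite KE expr1n mulr1.
have LE n : hub_potential k (x n) (th n) = x n 1 + x n 2%:R +
    2 * K * `|skew (x n) (th n)| + 80%:R * K ^+ 2 * th n 0.
  by rewrite /hub_potential KV -exprVn KV.
have L0 : hub_potential k (x 0%N) (th 0%N) <= k / 200%:R.
  rewrite LE /skew x1 x2 !mulr0 subrr normr0 mulr0 !add0r.
  have : 80%:R * K ^+ 2 * th 0%N 0 <= 80%:R * K ^+ 2 * (k ^+ 3 / 10%:R ^+ 5).
    by rewrite ler_wpM2l // mulr_ge0 // sqr_ge0.
  by move: k3; clear -k0; lra.
(* Budget of the errors: the factor dominates [80 * K ^+ 2], the largest weight in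
   the potential. *)
pose E n := 10%:R ^+ 3 * K ^+ 2 * \sum_(i < n) e i.
have E0 n : E n <= k / 200%:R.
  have : E n <= 10%:R ^+ 3 * K ^+ 2 * (k ^+ 3 / 10%:R ^+ 6).
    by rewrite ler_wpM2l // mulr_ge0 ?exprn_ge0.
  by move: k3; clear -k0; lra.
have ES n : E n.+1 = E n + 10%:R ^+ 3 * K ^+ 2 * e n.
  by rewrite /E big_ord_recr /= mulrDr.
have Ke n : e n <= K ^+ 2 * e n by rewrite ler_peMl.
have En0 n : 0 <= E n.
  by rewrite /E mulr_ge0 ?sumr_ge0 // mulr_ge0 ?exprn_ge0.
have double n :
    [/\ 1 / 4%:R <= th n 1, 1 / 4%:R <= th n 2%:R &
      hub_potential k (x n) (th n) <= k / 100%:R] ->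
    [/\ hub_potential k (x n.+2) (th n.+2) <=
        hub_potential k (x n) (th n) - 2 * `|skew (x n) (th n)| - 23%:R * th n 0 + (E n.+2 - E n) / 2,
      th n 1 - 2 * `|skew (x n) (th n)| - 23%:R * th n 0 - (E n.+2 - E n) / 2 <= th n.+2 1,
      th n 2%:R - 2 * `|skew (x n) (th n)| - 23%:R * th n 0 - (E n.+2 - E n) / 2 <= th n.+2 2%:R &
      th n.+2 0 <= (1 - k) * th n 0 + 3%:R * e n + e n.+1].
  case=> b c L.
  have g0 : 0 <= `|skew (x n) (th n)| by [].
  have w0 : 0 <= x n 1 + x n 2%:R by have [X _] := px n; rewrite addr_ge0.
  have H : 10%:R * (x n 1 + x n 2%:R + 2 * `|skew (x n) (th n)| + 26%:R * th n 0 + 8%:R * e n) <= k.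
    have A : 80%:R * th n 0 <= 80%:R * K ^+ 2 * th n 0.
      by rewrite ler_wpM2r ?(ltW (a0 n)) // ler_peMr.
    have B : 2 * `|skew (x n) (th n)| <= 2 * K * `|skew (x n) (th n)|.
      by rewrite ler_wpM2r // ler_peMr.
    have C := E0 n.+1; rewrite ES in C; have D := Ke n; have F := En0 n.
    have G := a0 n; rewrite LE in L.
    by move: A B C D F G L w0; clear -k0; lra.
  have s0 (i : nat) : 0 <= s i <= 1.
    by have /andP[-> /=] := s01 i; move=> /le_trans; apply; rewrite gerBl ltW.
  have sk (i : nat) : s i <= 1 - k by have /andP[] := s01 i.
  have := hub_double_step k01 (s0 n) (s0 n.+1) (e0 n) (e0 n.+1) (sk n) (sk n.+1) (ss n)
    (px n) (pth n) (px n.+1) (pth n.+1) (pth n.+2) (a0 n) (a0 n.+1) (step n) (step n.+1) b c H.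
  case=> P1 P2 [P3 P4] P5.
  have K2g : K * `|skew (x n.+2) (th n.+2)| <=
     (K - 1) * `|skew (x n) (th n)| + K * (22%:R * th n 0) + K * (13%:R * e n + 2 * e n.+1).
    apply: (le_trans (ler_wpM2l K0 P2)).
    have : k * K * `|skew (x n) (th n)| = `|skew (x n) (th n)| by rewrite KE mul1r.
    by clear; lra.
  have K2a : K ^+ 2 * th n.+2 0 <= (K ^+ 2 - K) * th n 0 + K ^+ 2 * (3%:R * e n + e n.+1).
    apply: (le_trans (ler_wpM2l (sqr_ge0 K) P5)).
    have : k * K * (K * th n 0) = K * th n 0 by rewrite KE mul1r.
    by clear; lra.
  have K1a : th n 0 <= K * th n 0 by rewrite ler_peMl // ltW.
  have Kee (i : nat) : K * e i <= K ^+ 2 * e i by rewrite ler_wpM2r.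
  have := Kee n; have := Kee n.+1; have := Ke n; have := Ke n.+1; have := e0 n; have := e0 n.+1.
  move=> Q1 Q2 Q3 Q4 Q5 Q6.
  split=> //; rewrite ?LE !ES.
  - have := mulr_ge0 K0 (ltW (a0 n)).
    move: P1 K2g K2a K1a Q1 Q2 Q3 Q4 Q5 Q6.
    by clear; lra.
  - by move: P3 Q1 Q2 Q3 Q4; clear; lra.
  - by move: P4 Q1 Q2 Q3 Q4; clear; lra.
have inv n : hub_potential k (x n.*2) (th n.*2) <= k / 200%:R + E n.*2 /\
    3%:R / 10%:R - k / 200%:R - E n.*2 + hub_potential k (x n.*2) (th n.*2) <= th n.*2 1 /\
    3%:R / 10%:R - k / 200%:R - E n.*2 + hub_potential k (x n.*2) (th n.*2) <= th n.*2 2%:R.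
  elim: n => [|n [I1 [I2 I3]]].
    by rewrite /E big_ord0 mulr0; move: L0 b0 c0; clear; lra.
  have [|D1 D2 D3 _] := double n.*2.
    have L : 0 <= hub_potential k (x n.*2) (th n.*2).
      rewrite LE; have [X _] := px n.*2.
      by rewrite !addr_ge0 // ?mulr_ge0 ?sqr_ge0 // ?mulr_ge0 ?ltW.
    by move: I1 I2 I3 (E0 n.*2) L k1; clear; split; lra.
  have := a0 n.*2; have g0 : 0 <= `|skew (x n.*2) (th n.*2)| by [].
  have EM : E n.*2 <= E n.*2.+2.
    by rewrite !ES -addrA lerDl addr_ge0 // mulr_ge0 // mulr_ge0 ?exprn_ge0.
  by rewrite doubleS; move: EM D1 D2 D3 I1 I2 I3 g0; clear; lra.
move=> n; have [I1 [I2 I3]] := inv n.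
have L : 0 <= hub_potential k (x n.*2) (th n.*2).
  rewrite LE; have [X _] := px n.*2.
  by rewrite !addr_ge0 // ?mulr_ge0 ?sqr_ge0 // ?mulr_ge0 ?ltW.
have b : 1 / 4%:R <= th n.*2 1 by move: I1 I2 I3 (E0 n.*2) L k1; clear; lra.
have c : 1 / 4%:R <= th n.*2 2%:R by move: I1 I2 I3 (E0 n.*2) L k1; clear; lra.
have [|_ _ _ D4] := double n.*2; last by split.
by split=> //; move: I1 (E0 n.*2); clear; lra.
Qed.

End Boundary.

(** The state reached at the hub has total weight [zr / (zr - 1) * m + c], where [c]
does not depend on the number [m] of particles. For large [m] the ratio is close
to [(zr - 1) / zr], which is at least [(mu - 1) / mu], and the other conditions
hold with room to spare. *)
Lemma hub_initial_bounds (R : realType) (mu zr c m t0 p eps S : R) : 1 < mu ->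
  2 <= zr -> mu <= zr -> p * mu = mu - 1 ->
  0 < eps -> 0 < t0 -> 1 <= m -> 3%:R * `|c| <= m -> (zr - 1) * `|c| <= m ->
  10%:R * zr * (zr ^+ 2 - 1) + 6%:R * zr * (zr - 1) * `|c| <= m ->
  t0 / eps <= m -> S = zr / (zr - 1) * m + c ->
  [/\ m <= S, 3%:R / 4%:R * p * S <= m, t0 <= eps * S &
    forall e, (1 + zr) * (m - zr) <= 2 * zr * e -> 3%:R / 10%:R * S <= e].
Proof.
move=> mu1 z2 muz pE eps0 t00 m1 cm1 cm2 cm3 tm SE.
have z1 : 0 < zr - 1 by lra.
have cle := ler_norm c; have cge := ler_norm (- c); rewrite normrN in cge.
have SzE : (zr - 1) * S = zr * m + (zr - 1) * c.
  by rewrite SE; field; rewrite gt_eqF.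
have mS : m <= S.
  rewrite -(ler_pM2l z1) SzE.
  have : (zr - 1) * (- c) <= (zr - 1) * `|c| by rewrite ler_wpM2l // ltW.
  by lra.
have p01 : 0 < p < 1 by apply/andP; split; nra.
have [p0 p1] := andP p01.
split=> //.
- have pz : p * zr <= zr - 1.
    rewrite -(ler_pM2r (lt_trans ltr01 mu1)).
    by rewrite mulrAC pE; nra.
  rewrite -(ler_pM2l z1) (_ : _ * (_ * p * S) = 3%:R / 4%:R * p * ((zr - 1) * S)); last by ring.
  rewrite SzE.
  have : p * zr * m <= (zr - 1) * m by rewrite ler_wpM2r //; lra.
  have : p * ((zr - 1) * c) <= (zr - 1) * (m / 3%:R).
    apply: le_trans (_ : p * ((zr - 1) * (m / 3%:R)) <= _).
      by apply: ler_wpM2l; [exact: ltW|rewrite ler_pM2l //; lra].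
    by rewrite ler_piMl ?(ltW p1) // mulr_ge0 ?(ltW z1) //; lra.
  by lra.
- by move: tm; rewrite ler_pdivrMr // => tm; apply: (le_trans tm); rewrite mulrC ler_wpM2l // ltW.
- move=> e He; have zz : 0 < zr * (zr - 1) by rewrite mulr_gt0 //; lra.
  rewrite -(ler_pM2l zz).
  have H1 : (zr - 1) * ((1 + zr) * (m - zr)) <= (zr - 1) * (2 * zr * e).
    by rewrite ler_wpM2l // ltW.
  have H2 : zr * ((zr - 1) * S) = zr * (zr * m + (zr - 1) * c) by rewrite SzE.
  have H3 : zr * ((zr - 1) * c) <= zr * ((zr - 1) * `|c|).
    by rewrite ler_wpM2l ?ler_wpM2l ?(ltW z1) //; lra.
  have H4 : 4%:R * m <= zr ^+ 2 * m by rewrite ler_wpM2r //; nra.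
  by lra.
Qed.

(** * Countably valued maps adapted to a sigma-algebra *)

Section Adapted.
Context (Omega : Type) (G : set (set Omega)) (sG : sigma_algebra setT G).

(** Measurability for maps whose values come from a countable type: every set of
values may be tested, without reference to a sigma-algebra on the target. *)
Definition adapted (C : Type) (f : Omega -> C) := forall U : set C, G (f @^-1` U).

Lemma sigma_setT : G setT.
Proof. by case: sG => G0 /(_ _ G0) + _; rewrite setD0. Qed.

Lemma sigma_setC A : G A -> G (~` A).
Proof. by case: sG => _ GC _ /GC; rewrite setTD. Qed.

Lemma sigma_countable_union (C : countType) (A : C -> set Omega) :
  (forall c, G (A c)) -> G (\bigcup_c A c).
Proof.
move=> GA; have [G0 _ GU] := sG.
have -> : \bigcup_c A c = \bigcup_n (if unpickle n is Some c then A c else set0).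
  apply/seteqP; split => [w [c _ Acw]|w [n _]].
    by exists (pickle c) => //; rewrite pickleK.
  by case: unpickle => // c Acw; exists c.
by apply: GU => n; case: unpickle.
Qed.

Lemma sigma_setU A A' : G A -> G A' -> G (A `|` A').
Proof.
move=> GA GA'; have -> : A `|` A' = \bigcup_b (if b then A else A').
  apply/seteqP; split => [w [?|?]|w [[] _ ?]]; [exists true|exists false|left|right] => //.
by apply: sigma_countable_union => -[].
Qed.

Lemma sigma_setI A A' : G A -> G A' -> G (A `&` A').
Proof.
move=> GA GA'; rewrite -[A `&` A']setCK setCI.
by apply: sigma_setC; apply: sigma_setU; exact: sigma_setC.
Qed.

Lemma adapted_cst C (c : C) : adapted (fun _ => c).
Proof.
move=> U; rewrite preimage_cst; case: ifP => _; first exact: sigma_setT.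
by case: sG.
Qed.

Lemma adapted_comp C D (f : Omega -> C) (g : C -> D) : adapted f -> adapted (g \o f).
Proof. by move=> Af U; rewrite comp_preimage; exact: Af. Qed.

(** Countability of [C] is what allows to choose the second map by the value of the
first, for instance to sum a random number of variables. *)
Lemma adapted_bind (C : countType) D (f : Omega -> C) (g : C -> Omega -> D) :
  adapted f -> (forall c, adapted (g c)) -> adapted (fun w => g (f w) w).
Proof.
move=> Af Ag U.
have -> : (fun w => g (f w) w) @^-1` U = \bigcup_c (f @^-1` [set c] `&` g c @^-1` U).
  by apply/seteqP; split => [w /= ?|w [c _ [/= -> ]]] //; exists (f w).
by apply: sigma_countable_union => c; apply: sigma_setI; [exact: Af|exact: Ag].
Qed.

Lemma adapted_map2 (C1 C2 : countType) D (f1 : Omega -> C1) (f2 : Omega -> C2)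
    (h : C1 -> C2 -> D) : adapted f1 -> adapted f2 -> adapted (fun w => h (f1 w) (f2 w)).
Proof.
move=> A1 A2; apply: (@adapted_bind _ _ f1 (fun c w => h c (f2 w))) => // c.
exact: (@adapted_comp _ _ f2 (h c)).
Qed.

Lemma adapted_sum (n : nat) (f : nat -> Omega -> nat) : (forall k, adapted (f k)) ->
  adapted (fun w => \sum_(k < n) f k w)%N.
Proof.
move=> Af; elim: n => [|n IH].
  by under eq_fun do rewrite big_ord0; exact: adapted_cst.
under eq_fun do rewrite big_ord_recr /=.
exact: (@adapted_map2 _ _ _ _ (f n) addn).
Qed.

Lemma adapted_ffun (C : countType) (f : 'I_3 -> Omega -> C) : (forall i, adapted (f i)) ->
  adapted (fun w => [ffun i => f i w]).
Proof.
move=> Af.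
pose h (a : C) (bc : C * C) : {ffun 'I_3 -> C} :=
  [ffun i : 'I_3 => if val i == 0%N then a else if val i == 1%N then bc.1 else bc.2].
have -> : (fun w => [ffun i => f i w]) = fun w => h (f 0 w) (f 1 w, f 2%:R w).
  apply/funext => w; apply/ffunP => i; rewrite !ffunE.
  by case: i => [[|[|[|//]]] hi] /=; congr (f _ w); exact: val_inj.
by apply: adapted_map2 => //; apply: (@adapted_map2 _ _ _ _ _ (fun a b => (a, b))).
Qed.

End Adapted.

Section Partition.
Context d (Omega : measurableType d) (R : realType) (P : probability Omega R).

(** Conditioning on a countably valued map is done by splitting along its levels:
this avoids conditional expectations altogether. *)
Lemma probability_le_levels (C : countType) (f : Omega -> C) (b : R) (X Y : set Omega) :
  (forall c, measurable (f @^-1` [set c])) -> measurable X -> measurable Y -> 0 <= b ->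
  (forall c, P (X `&` f @^-1` [set c]) <= b%:E * P (Y `&` f @^-1` [set c]))%E ->
  (P X <= b%:E * P Y)%E.
Proof.
move=> mf mX mY b0 H.
(* The levels, enumerated without repetition. *)
pose L n : set Omega := if unpickle n is Some c then
  (if pickle c == n then f @^-1` [set c] else set0) else set0.
have mL n : measurable (L n) by rewrite /L; case: unpickle => // c; case: ifP.
have tL : trivIset setT L.
  apply/trivIsetP => i j _ _ ij; rewrite /L.
  case Ei: unpickle => [c|]; last by rewrite set0I.
  case: eqP => ci; last by rewrite set0I.
  case Ej: unpickle => [c'|]; last by rewrite setI0.
  case: eqP => cj; last by rewrite setI0.
  apply/seteqP; split => // w [/= fc fc']; move: ij.
  by rewrite -ci -cj -fc -fc' eqxx.
have cover A : \bigcup_n (A `&` L n) = A.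
  apply/seteqP; split => [w [n _ []]//|w Aw].
  by exists (pickle (f w)) => //; split => //; rewrite /L pickleK eqxx.
have PA A : measurable A -> P A = (\sum_(0 <= n <oo) P (A `&` L n))%E.
  move=> mA; rewrite -[in LHS](cover A) measure_semi_bigcup //.
  - by move=> n; exact: measurableI.
  - exact: trivIset_setIl.
  - by rewrite cover.
rewrite (PA X) // (PA Y) // -nneseriesZl //; apply: lee_nneseries => // n _.
rewrite /L; case: unpickle => [c|]; last by rewrite !setI0 measure0 mule0.
by case: ifP => _; [exact: H|rewrite !setI0 measure0 mule0].
Qed.

End Partition.

(** * Second-moment bounds *)

Section BinomialTail.
Variable R : realType.

Definition binomial_mean (n : nat) (p : R) (f : nat -> R) : R :=
  \sum_(k < n.+1) binomial_pmf n p k * f k.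

Lemma binomial_pmfE n (p : R) k :
  binomial_pmf n p k = p ^+ k * (1 - p) ^+ (n - k) *+ 'C(n, k).
Proof. by []. Qed.

(** Pascal's rule: the last of the [n.+1] trials succeeds or fails. It reduces the
variance to an induction. *)
Lemma binomial_meanS n (p : R) f :
  binomial_mean n.+1 p f =
  p * binomial_mean n p (fun k => f k.+1) + (1 - p) * binomial_mean n p f.
Proof.
have S k : binomial_pmf n.+1 p k.+1 =
    p * binomial_pmf n p k + (if (k < n)%N then (1 - p) * binomial_pmf n p k.+1 else 0).
  rewrite !binomial_pmfE subSS binS addnC mulrnDr; congr (_ + _).
    by rewrite exprS -mulrA mulrnAr.
  case: ifP => kn; last by rewrite bin_small ?mulr0n // ltnS leqNgt kn.
  by rewrite mulrnAr mulrCA -exprS -subSn // subSS.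
rewrite /binomial_mean big_ord_recl /=.
under [X in _ + X]eq_bigr => k _.
  rewrite /bump /= add1n S mulrDl -mulrA; over.
rewrite big_split /= -mulr_sumr addrCA; congr (_ + _).
rewrite big_ord_recr /= ltnn mul0r addr0 [in RHS]big_ord_recl mulrDr mulr_sumr.
congr (_ + _); last by apply: eq_bigr => k _; rewrite ltn_ord mulrA.
by rewrite !binomial_pmfE /= !bin0 !expr0 !subn0 !mul1r exprS mulrA.
Qed.

Lemma binomial_mean_sqr n (p c : R) :
  binomial_mean n p (fun k => (k%:R - c) ^+ 2) = (n%:R * p - c) ^+ 2 + n%:R * p * (1 - p).
Proof.
elim: n c => [|n IH] c.
  rewrite /binomial_mean big_ord1 binomial_pmfE /= bin0 subn0 !expr0 mulr1n.
  by rewrite mulr0n; ring.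
rewrite binomial_meanS IH -natr1.
rewrite [X in p * X](_ : _ = binomial_mean n p (fun k => (k%:R - (c - 1)) ^+ 2)).
  by rewrite IH; ring.
by apply: eq_bigr => k _; rewrite -natr1; congr (_ * _ ^+ 2); ring.
Qed.

(** Chebyshev's inequality. The event contains the values above [n], which have
probability zero, so that the truncated subtraction in the process is excluded
at the same time. *)
Lemma binomial_tail n (p t : R) : 0 <= p <= 1 -> 0 < t ->
  (binomial_prob n p [set k | ~ ((k <= n)%N /\ (`|k%:R - n%:R * p| <= t)%R)] <=
   (n%:R / t ^+ 2)%:E)%E.
Proof.
move=> /andP[p0 p1] t0; set U := [set k | _].
rewrite (@binomial_probE _ n p p0 p1).
apply: (@le_trans _ _ (\sum_(k < n.+1) (binomial_pmf n p k * (k%:R - n%:R * p) ^+ 2 / t ^+ 2)%:E)%E).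
  apply: lee_sum => k _.
  have b0 : 0 <= binomial_pmf n p k by apply: binomial_pmf_ge0; rewrite p0 p1.
  rewrite diracE; case: (boolP (_ \in _)) => [|_]; last first.
    by rewrite mule0 lee_fin -mulrA mulr_ge0 // divr_ge0 ?sqr_ge0.
  rewrite inE /U /= => kU; rewrite mule1 lee_fin -mulrA ler_peMr //.
  have : t < `|k%:R - n%:R * p|.
    by rewrite ltNge; apply/negP => kt; apply: kU; split => //; rewrite -ltnS ltn_ord.
  move=> /ltW tk; rewrite ler_pdivlMr ?exprn_gt0 // mul1r.
  by rewrite -[X in _ <= X]real_normK ?num_real // ler_sqr // nnegrE ltW.
rewrite sumEFin lee_fin -mulr_suml ler_pM2r ?invr_gt0 ?exprn_gt0 //.
have -> : \sum_(i < n.+1) binomial_pmf n p i * (i%:R - n%:R * p) ^+ 2 =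
  binomial_mean n p (fun k => (k%:R - n%:R * p) ^+ 2) by [].
rewrite binomial_mean_sqr subrr expr0n add0r -mulrA ler_piMr //.
by rewrite mulr_ile1 //; lra.
Qed.

Lemma binomial_point n (p : R) k : 0 < p < 1 -> (k <= n)%N ->
  (0 < binomial_prob n p [set k])%E.
Proof.
move=> /andP[p0 p1] kn.
rewrite (@binomial_probE _ n p (ltW p0) (ltW p1)) (bigD1 (Ordinal (kn : (k < n.+1)%N))) //=.
rewrite diracE mem_set // mule1; apply: (@lt_le_trans _ _ (binomial_pmf n p k)%:E).
  by rewrite lte_fin binomial_pmfE -mulr_natr !mulr_gt0 ?exprn_gt0 ?ltr0n ?bin_gt0 //; lra.
rewrite leeDl // sume_ge0 // => j _; rewrite mule_ge0 //.
by rewrite lee_fin; apply: binomial_pmf_ge0; rewrite !ltW.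
Qed.

End BinomialTail.

Section DiscreteMoments.
Context d (Omega : measurableType d) (R : realType) (P : probability Omega R).

Let G : set (set Omega) := measurable.

Lemma measurable_sigma_algebra : sigma_algebra setT G.
Proof.
split; first exact: measurable0.
  by move=> A mA; exact: measurableD.
by move=> A mA; exact: bigcupT_measurable.
Qed.

Lemma adapted_measurable_fun d' (T : measurableType d') (f : Omega -> T) :
  adapted G f -> measurable_fun setT f.
Proof. by move=> Af _ U mU; rewrite setTI; exact: Af. Qed.

Lemma nat_layer_cake (x : nat) :
  (\sum_(0 <= a <oo) ((a < x)%N%:R : R)%:E = (x%:R : R)%:E)%E.
Proof.
rewrite (@nneseries_split _ _ 0 x); last by move=> k _; rewrite lee_fin.
rewrite add0n eseries0 ?adde0; last by move=> i xi _ /=; rewrite ltnNge xi.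
rewrite sumEFin big_mkord; congr EFin.
under eq_bigr do rewrite ltn_ord.
by rewrite sumr_const card_ord.
Qed.

Lemma expectation_indic_nat (A : set Omega) (Y : Omega -> nat) :
  measurable A -> adapted G Y ->
  (\int[P]_w (\1_A w * (Y w)%:R)%:E =
   \sum_(0 <= b <oo) P (A `&` [set w | (b < Y w)%N]))%E.
Proof.
move=> mA AY.
have mS b : measurable [set w | (b < Y w)%N] by exact: (AY [set y | (b < y)%N]).
transitivity (\int[P]_w (\sum_(0 <= b <oo) (\1_(A `&` [set w | (b < Y w)%N]) w)%:E))%E.
  apply: eq_integral => w _.
  rewrite EFinM -(nat_layer_cake (Y w)) -nneseriesZl; last by move=> i _; rewrite lee_fin.
  apply: eq_eseriesr => b _; rewrite -EFinM; congr EFin.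
  rewrite indicI /=; congr (_ * _).
  by rewrite indicE; case: (boolP (b < Y w)%N) => h; [rewrite mem_set|rewrite memNset //; apply/negP].
rewrite integral_nneseries //; last first.
  by move=> n; apply/measurable_EFinP; apply: measurable_indic; exact: measurableI.
by apply: eq_eseriesr => b _; rewrite integral_indic ?setIT //; exact: measurableI.
Qed.

(** Decomposing both variables into their layers reduces the product rule for means
to the product rule for events. *)
Lemma expectation_product (mu : R) (X Y : Omega -> nat) :
  adapted G X -> adapted G Y ->
  (forall S S', P (X @^-1` S `&` Y @^-1` S') = (P (X @^-1` S) * P (Y @^-1` S'))%E) ->
  (\int[P]_w ((X w)%:R)%:E = mu%:E)%E -> (\int[P]_w ((Y w)%:R)%:E = mu%:E)%E ->
  (\int[P]_w ((X w)%:R * (Y w)%:R)%:E = (mu * mu)%:E)%E.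
Proof.
move=> AX AY ind EX EY.
have mX b : measurable [set w | (b < X w)%N] by exact: (AX [set y | (b < y)%N]).
have mY b : measurable [set w | (b < Y w)%N] by exact: (AY [set y | (b < y)%N]).
have layer Z : adapted G Z -> (\int[P]_w ((Z w)%:R)%:E =
    \sum_(0 <= b <oo) P [set w | (b < Z w)%N])%E.
  move=> AZ; have := expectation_indic_nat measurableT AZ.
  under eq_integral do rewrite indicT /= mul1r.
  by move=> ->; apply: eq_eseriesr => b _; rewrite setTI.
have Pfin A : measurable A -> P A = (fine (P A))%:E.
  by move=> mA; rewrite fineK // fin_num_measure.
have AE a : (\int[P]_w (\1_[set w | (a < X w)%N] w * (Y w)%:R)%:E =
    (mu%:E * P [set w | (a < X w)%N]))%E.
  rewrite expectation_indic_nat // -EY layer // muleC (Pfin [set w | (a < X w)%N]) //.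
  rewrite -nneseriesZl //; apply: eq_eseriesr => b _; rewrite -Pfin //.
  exact: (ind [set x | (a < x)%N] [set y | (b < y)%N]).
transitivity (\int[P]_w (\sum_(0 <= a <oo) (\1_[set w | (a < X w)%N] w * (Y w)%:R)%:E))%E.
  apply: eq_integral => w _.
  rewrite mulrC EFinM -(nat_layer_cake (X w)) -nneseriesZl; last by move=> i _; rewrite lee_fin.
  apply: eq_eseriesr => b _; rewrite -EFinM mulrC; congr (_ * _)%:E.
  by rewrite indicE; case: (boolP (b < X w)%N) => h; [rewrite mem_set|rewrite memNset //; apply/negP].
rewrite integral_nneseries; first last.
- by move=> n w _; rewrite lee_fin mulr_ge0.
- move=> n; apply/measurable_EFinP; apply: measurable_funM; first exact: measurable_indic.
  by apply: adapted_measurable_fun; exact: (@adapted_comp _ _ _ _ Y (fun y => y%:R)).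
- exact: measurableT.
rewrite (eq_eseriesr (fun a _ => AE a)) nneseriesZl // -layer // EX.
by rewrite -EFinM.
Qed.

(** Chebyshev's inequality; pairwise independence removes the mixed terms of the
second moment. *)
Lemma sum_tail (mu V t : R) (X : nat -> Omega -> nat) (m : nat) : 0 < t ->
  (forall k, adapted G (X k)) ->
  (forall k l S S', k != l ->
     P (X k @^-1` S `&` X l @^-1` S') = (P (X k @^-1` S) * P (X l @^-1` S'))%E) ->
  (forall k, \int[P]_w ((X k w)%:R)%:E = mu%:E)%E ->
  (forall k, \int[P]_w ((X k w)%:R ^+ 2)%:E <= V%:E)%E ->
  (P [set w | (t < `|(\sum_(k < m) X k w)%:R - m%:R * mu|)%R] <= (m%:R * V / t ^+ 2)%:E)%E.
Proof.
move=> t0 AX ind EX E2.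
have sG := measurable_sigma_algebra.
pose S w := (\sum_(k < m) X k w)%N.
have AS : adapted G S by exact: adapted_sum.
have mf (f : nat -> R) : measurable_fun setT (fun w => (f (S w))%:E).
  apply: adapted_measurable_fun; exact: (@adapted_comp _ _ _ _ S (fun y => (f y)%:E)).
have mXX (f : nat -> nat -> R) k l : measurable_fun setT (fun w => (f (X k w) (X l w))%:E).
  by apply: adapted_measurable_fun; exact: (@adapted_map2 _ _ _ _ _ _ _ _ (fun x y => (f x y)%:E)).
have ES : (\int[P]_w ((S w)%:R)%:E = (m%:R * mu)%:E)%E.
  transitivity (\int[P]_w (\sum_(k < m) ((X k w)%:R)%:E))%E.
    by apply: eq_integral => w _; rewrite sumEFin -natr_sum.
  rewrite ge0_integral_sum //.
  - under eq_bigr do rewrite EX.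
    by rewrite sumEFin sumr_const card_ord mulr_natl.
  - by move=> k; exact: (mXX (fun x _ => x%:R) k k).
have ESS : (\int[P]_w ((S w)%:R ^+ 2)%:E <= (m%:R * V + (m%:R * mu) ^+ 2)%:E)%E.
  have V0 : 0 <= V.
    rewrite -lee_fin; apply: le_trans (E2 0%N); apply: integral_ge0 => w _.
    by rewrite lee_fin sqr_ge0.
  have -> : (\int[P]_w ((S w)%:R ^+ 2)%:E =
      \int[P]_w (\sum_(k < m) \sum_(l < m) ((X k w)%:R * (X l w)%:R)%:E))%E.
    apply: eq_integral => w _; under eq_bigr do rewrite sumEFin -mulr_sumr -natr_sum.
    by rewrite sumEFin -mulr_suml -natr_sum expr2.
  rewrite ge0_integral_sum //; last 2 first.
  - by move=> k; apply: emeasurable_sum => l; exact: (mXX (fun x y => x%:R * y%:R)).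
  - by move=> k w _; rewrite sume_ge0 // => l _; rewrite lee_fin mulr_ge0.
  apply: (@le_trans _ _ (\sum_(k < m) \sum_(l < m) (mu * mu + (k == l)%:R * V)%:E)%E).
    apply: lee_sum => k _; rewrite ge0_integral_sum //; last first.
      by move=> l; exact: (mXX (fun x y => x%:R * y%:R)).
    apply: lee_sum => l _; have [->|kl] := eqVneq k l.
      rewrite mul1r; apply: le_trans (_ : V%:E <= _)%E.
        by under eq_integral do rewrite -expr2; exact: E2.
      by rewrite lee_fin lerDr -expr2 sqr_ge0.
    rewrite mul0r addr0 (@expectation_product mu) // => U U'.
    exact: ind.
  under eq_bigr do rewrite sumEFin big_split /=.
  rewrite sumEFin lee_fin big_split /= addrC lerD //.
    have row (k : 'I_m) : \sum_(l < m) (k == l)%:R * V = V.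
      rewrite (bigD1 k) //= eqxx mul1r big1 ?addr0 // => l /negPf.
      by rewrite eq_sym => ->; rewrite mul0r.
    under eq_bigr do rewrite row.
    by rewrite sumr_const card_ord mulr_natl.
  under eq_bigr do rewrite sumr_const card_ord.
  by rewrite sumr_const card_ord -mulrnA -[_ *+ (_ * _)]mulr_natl natrM expr2; lra.
pose c := m%:R * mu.
have c0 : 0 <= c.
  by rewrite -lee_fin -ES; apply: integral_ge0 => w _; rewrite lee_fin.
have var : (\int[P]_w (((S w)%:R - c) ^+ 2)%:E <= (m%:R * V)%:E)%E.
  have : (\int[P]_w (((S w)%:R - c) ^+ 2)%:E + (2 * c)%:E * (c%:E) =
          \int[P]_w ((S w)%:R ^+ 2)%:E + (c ^+ 2)%:E)%E.
    rewrite -[X in (_ * X)%E]ES -ge0_integralZl //; last first.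
      by rewrite lee_fin mulr_ge0.
    have sq0 b : forall w, setT w -> (0 <= (((S w)%:R - b) ^+ 2 : R)%:E)%E.
      by move=> w _; rewrite lee_fin sqr_ge0.
    have sq1 : forall w, setT w -> (0 <= (((S w)%:R) ^+ 2 : R)%:E)%E.
      by move=> w _; rewrite lee_fin sqr_ge0.
    have lin0 : forall w, setT w -> (0 <= (2 * c)%:E * ((S w)%:R : R)%:E)%E.
      by move=> w _; rewrite -EFinM lee_fin mulr_ge0 // mulr_ge0.
    have cst0 : forall w : Omega, setT w -> (0 <= cst (c ^+ 2)%:E w)%E.
      by move=> w _; rewrite lee_fin sqr_ge0.
    have -> : ((c ^+ 2)%:E = \int[P]_w (cst (c ^+ 2)%:E w))%E.
      by rewrite integral_cst // [X in (_ * X)%E]probability_setT mule1.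
    rewrite -(ge0_integralD P measurableT (sq0 c) (mf (fun y => (y%:R - c) ^+ 2)) lin0 _).
      rewrite -(ge0_integralD P measurableT sq1 (mf (fun y => y%:R ^+ 2)) cst0 _) //.
      by apply: eq_integral => w _; rewrite /= -EFinM -!EFinD; congr EFin; ring.
    by apply: measurable_funeM; exact: (mf (fun y => y%:R)).
  move=> E; rewrite -(@leeD2rE _ (2 * c * c)%:E) //.
  rewrite [X in (X <= _)%E](_ : _ = \int[P]_w ((S w)%:R ^+ 2)%:E + (c ^+ 2)%:E)%E; last first.
    by rewrite -E EFinM.
  apply: (le_trans (leeD2r _ ESS)); rewrite -!EFinD lee_fin -/c; lra.
set A := [set w | _].
have mA : measurable A by exact: (AS [set y | t < `|y%:R - c|]).
have : (\int[P]_w ((t ^+ 2)%:E * (\1_A w)%:E) <= (m%:R * V)%:E)%E.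
  apply: le_trans var; apply: ge0_le_integral => //.
  - by move=> w _; rewrite -EFinM lee_fin mulr_ge0 ?sqr_ge0.
  - by apply: measurable_funeM; apply/measurable_EFinP; exact: measurable_indic.
  - exact: (mf (fun y => (y%:R - c) ^+ 2)).
  move=> w _; rewrite -EFinM lee_fin indicE; case: (boolP (w \in A)) => [|_].
    rewrite inE /A /= => /ltW h; rewrite mulr1.
    by rewrite -[X in _ <= X]real_normK ?num_real // ler_sqr // nnegrE ltW.
  by rewrite mulr0 sqr_ge0.
rewrite ge0_integralZl //; last 2 first.
- by apply/measurable_EFinP; exact: measurable_indic.
- by rewrite lee_fin sqr_ge0.
rewrite (integral_indic P measurableT mA) setIT.
move=> H; have : ((t ^+ 2)%:E * P A <= (m%:R * V)%:E)%E := H.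
have -> : P A = (fine (P A))%:E by rewrite fineK // fin_num_measure.
rewrite -EFinM !lee_fin => {}H.
by rewrite ler_pdivlMr ?exprn_gt0 // mulrC.
Qed.
End DiscreteMoments.

(** From numbers to shares: [o] children come from [n] of the [M] particles, and
[M'] is the number of all children. *)
Lemma ratio_error (R : realType) (o n M M' mu e : R) : 0 <= n <= M -> M <= M' -> 0 < M ->
  `|o - n * mu| <= e * M -> `|M' - mu * M| <= 3%:R * e * M -> `|o / M' - n / M| <= 4%:R * e.
Proof.
move=> /andP[n0 nM] MM' M0 h g.
have M'0 : 0 < M' by exact: lt_le_trans MM'.
have e0 : 0 <= e by rewrite -(pmulr_lge0 _ M0) (le_trans _ h).
have -> : o / M' - n / M = ((o - n * mu) - n / M * (M' - mu * M)) / M'.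
  by field; rewrite !gt_eqF.
rewrite normrM normfV (gtr0_norm M'0) ler_pdivrMr //.
apply: (le_trans (ler_normB _ _)); rewrite normrM.
have nM1 : `|n / M| <= 1 by rewrite ger0_norm ?divr_ge0 ?(ltW M0) // ler_pdivrMr // mul1r.
have : `|n / M| * `|M' - mu * M| <= 3%:R * e * M by rewrite (le_trans (ler_piMl _ nM1)).
have : e * M <= e * M' by exact: ler_wpM2l.
lra.
Qed.

(** * Series, limits and probabilities *)

Lemma geometric_sum_le (R : realType) (r : R) n : 0 <= r < 1 ->
  \sum_(k < n) r ^+ k <= (1 - r)^-1.
Proof.
move=> /andP[r0 r1]; rewrite -[leRHS]mul1r ler_pdivlMr; last by lra.
suff -> : (\sum_(k < n) r ^+ k) * (1 - r) = 1 - r ^+ n by rewrite gerBl exprn_ge0.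
elim: n => [|n IH]; first by rewrite big_ord0 mul0r expr0 subrr.
by rewrite big_ord_recr /= mulrDl IH exprS; ring.
Qed.

Section Limits.
Variable R : realType.

Lemma cvg_along (u : nat -> R) (l : R) (phi : nat -> nat) :
  (forall n, (n <= phi n)%N) -> u @ \oo --> l -> (u \o phi) @ \oo --> l.
Proof.
move=> le_phi; apply: cvg_trans => X [N _ NX]; exists N => // n Nn.
by apply: NX; exact: leq_trans (le_phi n).
Qed.

Lemma limit_ge (u : nat -> R) (l a : R) : u @ \oo --> l -> (forall n, a <= u n) -> a <= l.
Proof.
move=> ul au; rewrite -(cvg_lim _ ul) //; apply: limr_ge; first by apply/cvg_ex; exists l.
exact: nearW.
Qed.

End Limits.

(** An almost sure property may be used on an event of positive probability. *)
Lemma positive_probability d (Omega : measurableType d) (R : realType)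
    (P : probability Omega R) (E X : set Omega) (H : Omega -> Prop) :
  measurable E -> (0 < P E)%E -> {ae P, forall w, H w} -> measurable X ->
  (forall w, E w -> H w -> X w) -> (0 < P X)%E.
Proof.
move=> mE PE [N [mN PN HN]] mX EHX.
have : (P E <= P X + P N)%E.
  apply: le_trans (measureU2 _ mX mN); apply: le_measure; rewrite ?inE //.
    exact: measurableU.
  by move=> w Ew; have [Hw|nHw] := pselect (H w); [left; exact: EHX|right; exact: HN].
by rewrite PN adde0; exact: lt_le_trans.
Qed.

Lemma adapted_RV d (Omega : measurableType d) (R : realType) (P : probability Omega R)
  (X : {RV P >-> nat}) : adapted measurable (X : Omega -> nat).
Proof. by move=> U; rewrite -[_ @^-1` _]setTI; exact: measurable_funPT. Qed.

Lemma same_law_integral d d' (Omega : measurableType d) (Omega' : measurableType d')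
    (R : realType) (P : probability Omega R) (Q : probability Omega' R)
    (X : {RV P >-> nat}) (Y : {RV Q >-> nat}) (f : nat -> R) :
  (forall S, distribution P X S = distribution Q Y S) -> (forall y, 0 <= f y) ->
  (\int[P]_w (f (X w))%:E = 'E_Q[fun w => (f (Y w))%R])%E.
Proof.
move=> XY f0; rewrite expectation.unlock.
have mf : measurable_fun setT (EFin \o f) by [].
have f0' y : (0 <= (EFin \o f) y)%E by rewrite lee_fin.
have := ge0_integral_distribution X mf f0'; have := ge0_integral_distribution Y mf f0'.
move=> <- <-; apply: eq_measure_integral => A mA _; exact: XY.
Qed.

Lemma probability_union3 d (Omega : measurableType d) (R : realType)
    (P : probability Omega R) (A : 'I_3 -> set Omega) (b : 'I_3 -> \bar R) X :
  (forall i, measurable (A i)) -> measurable X -> (forall i, P (A i) <= b i)%E ->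
  X `<=` (\bigcup_i A i) -> (P X <= b 0%R + b 1%R + b 2%:R)%E.
Proof.
move=> mA mX Ab XA.
have mU : measurable (A 0 `|` A 1) by exact: measurableU.
apply: (@le_trans _ _ (P (A 0 `|` A 1 `|` A 2%:R))).
  apply: le_measure; rewrite ?inE //; first exact: measurableU.
  by move=> w /XA [i _]; case: (ord3P i) => ->; [left; left|left; right|right].
apply: (le_trans (measureU2 _ mU (mA _))).
apply: leeD; last exact: Ab.
by apply: (le_trans (measureU2 _ (mA _) (mA _))); apply: leeD; exact: Ab.
Qed.

Section Zeta.
Context d' (Omega' : measurableType d') (R : realType) (Q : probability Omega' R).
Variable zeta : {RV Q >-> nat}.

Let mzeta S : measurable (zeta @^-1` S).
Proof. by rewrite -[_ @^-1` _]setTI; exact: measurable_funPT. Qed.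

(** A variable cannot be almost surely smaller than its mean; the mean of an integer
variable below [mu] everywhere is at most the largest integer below [mu]. *)
Lemma atom_above_mean (mu : R) : 0 < mu ->
  ('E_Q[fun w => ((zeta w)%:R)%R] = mu%:E)%E ->
  exists2 z : nat, mu <= z%:R & (0 < Q (zeta @^-1` [set z]))%E.
Proof.
move=> mu0 Emu; apply: contrapT => noatom.
have exN : exists n : nat, mu <= n%:R.
  by exists (Num.bound mu); rewrite ltW // archi_boundP // ltW.
have [[|N] muN minN] := ex_minnP exN; first by move: muN; rewrite leNgt mu0.
have Nmu : N%:R < mu by rewrite ltNge; apply/negP => /minN; rewrite ltnn.
have null z : (N < z)%N -> Q (zeta @^-1` [set z]) = 0%E.
  move=> Nz; apply/eqP; rewrite eq_le measure_ge0 andbT leNgt; apply/negP => pos.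
  by apply: noatom; exists z => //; rewrite (le_trans muN) // ler_nat.
have : ('E_Q[fun w => ((zeta w)%:R)%R] <= 'E_Q[cst (N%:R)%R])%E.
  apply: expectation_le => //.
    by move=> _ U mU; rewrite setTI; exact: (mzeta [set y | U y%:R]).
  have : Q.-negligible (\bigcup_k (zeta @^-1` [set (N.+1 + k)%N])).
    apply: negligible_bigcup => k; exists (zeta @^-1` [set (N.+1 + k)%N]); split => //.
    by apply: null; rewrite addSn ltnS leq_addr.
  apply: negligibleS => w /= /negP; rewrite -ltNge ltr_nat => Nw.
  by exists (zeta w - N.+1)%N => //=; rewrite subnKC.
by rewrite Emu expectation_cst lee_fin leNgt Nmu.
Qed.

End Zeta.

(** * Measurability of the two events *)

Section Target.
Context d (Omega : measurableType d) (R : realType).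
Variables (Theta : Omega -> 'rV[R]_3).
Hypothesis Theta_meas : forall i, measurable_fun setT (fun w => Theta w 0 i).

Let coord i (a : R) : measurable [set w | Theta w 0 i = a].
Proof.
have := Theta_meas i measurableT (measurable_set1 a).
by rewrite setTI; congr measurable; apply/seteqP; split.
Qed.

Let union (A : 'I_3 -> set Omega) : (forall i, measurable (A i)) -> measurable (\bigcup_i A i).
Proof. by move=> mA; exact: (sigma_countable_union (@measurable_sigma_algebra _ Omega)). Qed.

Hypothesis Theta_simplex : forall w, simplex (Theta w).

Lemma interiorE : [set w | (simplex `\` simplex_boundary) (Theta w)] =
  ~` \bigcup_i [set w | Theta w 0 i = 0].
Proof.
apply/seteqP; split => w /=.
  by move=> [_ nb] [i _ Ti]; apply: nb; split => //; exists i.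
by move=> H; split => // -[_ [i Ti]]; apply: H; exists i.
Qed.

Lemma measurable_interior : measurable [set w | (simplex `\` simplex_boundary) (Theta w)].
Proof. by rewrite interiorE; apply: measurableC; apply: union => i; exact: coord. Qed.

Lemma measurable_open_sides :
  measurable [set w | (simplex_boundary `\` simplex_vertices) (Theta w)].
Proof.
have -> : [set w | (simplex_boundary `\` simplex_vertices) (Theta w)] =
  (\bigcup_i [set w | Theta w 0 i = 0]) `\`
  (\bigcup_i ~` \bigcup_j ~` [set w | Theta w 0 j = (delta_mx 0 i : 'rV[R]_3) 0 j]).
  apply/seteqP; split => w /=.
    move=> [[_ [i Ti]] nv]; split; first by exists i.
    move=> [k _] /= H; apply: nv; exists k => //.
    apply/rowP => j; apply: contrapT => ne; apply: H; exists j => // e; apply: ne.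
    by rewrite e.
  move=> [[i _ Ti] nv]; split; first by split => //; exists i.
  move=> [k _ kE]; apply: nv; exists k => // -[j _] /=; apply.
  by rewrite kE.
apply: measurableD; apply: union => i; first exact: coord.
by apply: measurableC; apply: union => j; apply: measurableC; exact: coord.
Qed.

End Target.

(** * The filtration and the state of the process *)

Section Process.
Context d (Omega : measurableType d) (R : realType) (P : probability Omega R).
Variables (N0 : 'I_3 -> nat) (T0 : 'rV[R]_3).
Variables (Z : nat -> 'I_3 -> nat -> Omega -> nat) (B : nat -> 'I_3 -> Omega -> nat).

Local Notation N := (particles N0 Z B).
Local Notation T := (weights N0 T0 Z B).
Local Notation off := (offspring N0 Z B).
Local Notation pr := (step_prob N0 T0 Z B).
Local Notation F := (Fn Z B).
Local Notation Fs := (Fstar Z B).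
Local Notation fresh n := <<s gen_offspring Z n >>.

(** The random part of the weights, kept apart because it is an integer: the state
then ranges over a countable type. *)
Fixpoint traversals (n : nat) (w : Omega) (i : 'I_3) : nat :=
  if n is m.+1 then (traversals m w i + B m.+1 (i + 1)%R w + Bbar N0 Z B m (i - 1)%R w)%N
  else 0%N.

Lemma weightsE n w i : weights N0 T0 Z B n w 0 i = T0 0 i + (traversals n w i)%:R.
Proof.
elim: n => [|n IH] /=; first by rewrite addr0.
by rewrite mxE IH !natrD !addrA.
Qed.

Lemma particlesS n w i : N n.+1 w i =
  (B n.+1 (i - 1)%R w + (off n (i + 1)%R w - B n.+1 (i + 1)%R w))%N.
Proof. by []. Qed.

Lemma Fn_sigma_algebra n : sigma_algebra setT (F n).
Proof.
case: n => [|n]; last exact: smallest_sigma_algebra.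
split; first by left.
  by move=> A [->|->]; rewrite ?setD0 ?setDv; [right|left].
move=> A FA; have [[n An]|nA] := pselect (exists n, A n = setT).
  by right; apply/seteqP; split => // w _; exists n => //; rewrite An.
left; apply/seteqP; split => // w [n _]; case: (FA n) => [->//|An].
by exfalso; apply: nA; exists n.
Qed.

Lemma Fstar_sigma_algebra n : sigma_algebra setT (Fs n).
Proof. exact: smallest_sigma_algebra. Qed.

Lemma Fn_sub_Fstar n : F n `<=` Fs n.
Proof. by move=> A FA; apply: sub_sigma_algebra; left. Qed.

Lemma Fstar_sub_Fn n : Fs n `<=` F n.+1.
Proof. by move=> A FA; apply: sub_sigma_algebra; left. Qed.

Lemma Fn_sub m n : (m <= n)%N -> F m `<=` F n.
Proof.
move=> /subnK <-; elim: (n - m)%N => [//|k IH] A FA.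
by rewrite addSn; apply: Fstar_sub_Fn; apply: Fn_sub_Fstar; exact: IH.
Qed.

Lemma adapted_sub (G H : set (set Omega)) C (f : Omega -> C) :
  G `<=` H -> adapted G f -> adapted H f.
Proof. by move=> GH Af U; apply: GH. Qed.

Lemma adapted_generators (I : Type) (X : I -> Omega -> nat) i :
  adapted (generators X) (X i).
Proof. by move=> U; exists i => //; exists U => //; rewrite setTI. Qed.

Lemma adapted_fresh n i k : adapted (fresh n) (Z n i k).
Proof.
apply: adapted_sub (adapted_generators (fun ik => Z n ik.1 ik.2) (i, k)).
by move=> A GA; exact: sub_sigma_algebra.
Qed.

Lemma fresh_sub_Fstar n : fresh n.+1 `<=` Fs n.
Proof. by apply: sub_smallest2r => // A; right. Qed.

Lemma adapted_B n i : adapted (F n.+1) (B n.+1 i).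
Proof.
apply: adapted_sub (adapted_generators (B n.+1) i).
by move=> A GA; apply: sub_sigma_algebra; right.
Qed.

(** The number of summands is known from the past and the summands are fresh. *)
Lemma adapted_offspring n i :
  (forall j, adapted (F n) (fun w => N n w j)) ->
  adapted (Fs n) (off n i).
Proof.
move=> AN.
apply: (@adapted_bind _ _ (Fstar_sigma_algebra n) _ _ _
  (fun c w => (\sum_(k < c) Z n.+1 i k w)%N)).
  exact: adapted_sub (@Fn_sub_Fstar n) (AN i).
move=> c; apply: (adapted_sum (Fstar_sigma_algebra n)) => k.
exact: (adapted_sub (@fresh_sub_Fstar n) (@adapted_fresh n.+1 i k)).
Qed.

Lemma adapted_particles n i : adapted (F n) (fun w => N n w i).
Proof.
elim: n i => [|n IH] i; first exact: (adapted_cst (Fn_sigma_algebra 0)).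
under eq_fun do rewrite particlesS.
have sG := Fn_sigma_algebra n.+1.
have AO j : adapted (F n.+1) (off n j).
  exact: adapted_sub (@Fstar_sub_Fn n) (adapted_offspring _ IH).
apply: (@adapted_map2 _ _ sG _ _ _ (B n.+1 (i - 1))
  (fun w => off n (i + 1)%R w - B n.+1 (i + 1)%R w)%N addn); first exact: adapted_B.
by apply: (@adapted_map2 _ _ sG _ _ _ _ _ subn) => //; exact: adapted_B.
Qed.

Lemma adapted_traversals n i : adapted (F n) (fun w => traversals n w i).
Proof.
elim: n i => [|n IH] i; first exact: (adapted_cst (Fn_sigma_algebra 0)).
have sG := Fn_sigma_algebra n.+1.
have AO j : adapted (F n.+1) (off n j).
  by apply: adapted_sub (@Fstar_sub_Fn n) (adapted_offspring _ _) => ?; exact: adapted_particles.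
rewrite /=; apply: (@adapted_map2 _ _ sG _ _ _ _ (Bbar N0 Z B n (i - 1)) addn).
  apply: (@adapted_map2 _ _ sG _ _ _ _ _ addn); last exact: adapted_B.
  by apply: adapted_sub (IH i); exact: Fn_sub.
by apply: (@adapted_map2 _ _ sG _ _ _ _ _ subn) => //; exact: adapted_B.
Qed.

Definition state (n : nat) (w : Omega) : {ffun 'I_3 -> nat} * {ffun 'I_3 -> nat} :=
  ([ffun i => N n w i], [ffun i => traversals n w i]).

Lemma adapted_state n : adapted (F n) (state n).
Proof.
have sG := Fn_sigma_algebra n.
by apply: (@adapted_map2 _ _ sG _ _ _ _ _ (fun a b => (a, b)));
  apply: adapted_ffun => // i; [exact: adapted_particles|exact: adapted_traversals].
Qed.

Variables (mu V : R) (z : nat).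
Hypothesis N0_neq0 : exists i, N0 i != 0%N.
Hypothesis T0_gt0 : forall i, 0 < T0 0 i.
Hypothesis measurable_Z : forall n i k, adapted measurable (Z n i k).
Hypothesis measurable_B : forall n i, adapted measurable (B n i).
Hypothesis mu_gt1 : 1 < mu.
Hypothesis mean_Z : forall n i k, (\int[P]_w ((Z n.+1 i k w)%:R)%:E = mu%:E)%E.
Hypothesis square_Z : forall n i k, (\int[P]_w ((Z n.+1 i k w)%:R ^+ 2)%:E <= V%:E)%E.
Hypothesis atom_Z : forall n i k, (0 < P (Z n.+1 i k @^-1` [set z]))%E.
Hypothesis mu_le_z : mu <= z%:R.
Hypothesis independent_Z : forall n,
  mutually_independent P (fun ik : 'I_3 * nat => Z n.+1 ik.1 ik.2).
Hypothesis independent_past : forall n,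
  independent_systems P (F n) <<s gen_offspring Z n.+1 >>.
Hypothesis law_B : forall n,
  cond_independent_laws P (Fs n) (B n.+1)
    (fun w i => binomial_prob (off n i w) (pr n i w)).

Local Notation zR := (z%:R : R).

Let mu_gt0 : 0 < mu. Proof. exact: lt_trans mu_gt1. Qed.

Let z_gt1 : (1 < z)%N.
Proof. by rewrite -(ltr_nat R); exact: lt_le_trans mu_le_z. Qed.

Let zR_gt1 : 2 <= zR. Proof. by rewrite (ler_nat _ 2). Qed.

Lemma measurable_Fn n A : F n A -> measurable A.
Proof.
have sM := @measurable_sigma_algebra _ Omega.
have gen (I : Type) (X : I -> Omega -> nat) : (forall i, adapted measurable (X i)) ->
    generators X `<=` measurable.
  by move=> mX {}A [i _ [U mU <-]]; rewrite setTI; exact: mX.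
move: A; elim: n => [|n IH]; first by move=> A [->|->]; [exact: measurable0|exact: measurableT].
apply: smallest_sub => // A [|]; last by exact: gen.
by apply: smallest_sub => // {}A [/IH//|]; apply: gen => -[].
Qed.

Lemma measurable_Fstar n A : Fs n A -> measurable A.
Proof. by move=> /Fstar_sub_Fn; exact: measurable_Fn. Qed.

(** * One generation, given the past *)

Lemma weights_gt0 n w i : 0 < T n w 0 i.
Proof. by rewrite weightsE ltr_wpDr. Qed.

Lemma step_prob_gt0_lt1 n w i : 0 < pr n i w < 1.
Proof.
have := weights_gt0 n w (i - 1); have := weights_gt0 n w (i + 1).
rewrite /step_prob; move: (T n w 0 _) (T n w 0 _) => b a b0 a0.
by rewrite divr_gt0 ?addr_gt0 //= ltr_pdivrMr ?addr_gt0 // mul1r ltrDl.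
Qed.

Lemma step_prob_ge0_le1 n w i : 0 <= pr n i w <= 1.
Proof. by have /andP[p0 p1] := step_prob_gt0_lt1 n w i; rewrite !ltW. Qed.

(** Where the number of parents at [i] is constant, the offspring is a fixed sum of
fresh variables, which is independent of the past. *)
Lemma offspring_tail n A nu i (t : R) : 0 < t -> F n A ->
  (forall w, A w -> N n w i = nu) ->
  (P (A `&` [set w | (t < `|(off n i w)%:R - nu%:R * mu|)%R]) <=
   (nu%:R * V / t ^+ 2)%:E * P A)%E.
Proof.
move=> t0 FA AN.
pose U := [set w | t < `|(\sum_(k < nu) Z n.+1 i k w)%N%:R - nu%:R * mu|].
have -> : A `&` [set w | t < `|(off n i w)%:R - nu%:R * mu|] = A `&` U.
  by apply/seteqP; split => w [Aw] /=; rewrite /offspring /U /= (AN _ Aw).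
have fU : <<s gen_offspring Z n.+1 >> U.
  have sG := smallest_sigma_algebra setT (gen_offspring Z n.+1).
  exact: (adapted_sum sG nu (fun k => @adapted_fresh n.+1 i k)
    [set y | t < `|y%:R - nu%:R * mu|]).
rewrite (independent_past FA fU) muleC lee_wpmul2r //.
apply: sum_tail => // k l U1 U2 kl.
have := @independent_Z n [:: (i, k); (i, l)] (fun ik => if ik.2 == k then U1 else U2).
rewrite /= !inE xpair_eqE eqxx /= kl /= => /(_ isT).
rewrite !big_cons big_nil /= eqxx [l == k]eq_sym (negPf kl) mule1 => <-.
congr (P _); apply/seteqP; split => w /=.
  by move=> [X1 X2] j; rewrite !inE => /orP[/eqP->|/eqP->] /=; rewrite ?eqxx ?[l == k]eq_sym ?(negPf kl).
move=> H; have := H (i, k); have := H (i, l).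
rewrite !inE /= !xpair_eqE !eqxx /= ?orbT eq_sym (negPf kl).
by move=> /(_ isT) ? /(_ isT).
Qed.

(** On an event on which the conditional law is constant, integrating it amounts to
a multiplication. *)
Lemma step_law n A (c : \bar R) S : Fs n A ->
  (forall w, A w -> (\prod_(i : 'I_3) binomial_prob (off n i w) (pr n i w) (S i) = c)%E) ->
  (P (A `&` [set w | forall i, S i (B n.+1 i w)]) = c * P A)%E.
Proof.
move=> FA Ac; have [_ ->//] := law_B n S.
rewrite (eq_integral (cst c)); last by move=> w /set_mem Aw; exact: Ac.
by rewrite integral_cst //; exact: measurable_Fstar FA.
Qed.

Lemma one_step_law n A i o (p : R) U : Fs n A ->
  (forall w, A w -> off n i w = o /\ pr n i w = p) ->
  (P (A `&` [set w | U (B n.+1 i w)]) = binomial_prob o p U * P A)%E.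
Proof.
move=> FA Aop; rewrite -(@step_law n A _ (fun j => if j == i then U else setT) FA).
  congr (P (_ `&` _)); apply/seteqP; split => w /=.
    by move=> Uw j; case: eqVneq => [->|].
  by move=> /(_ i); rewrite eqxx.
move=> w /Aop [<- <-]; rewrite (bigD1 i) //= eqxx big1 ?mule1 // => j ji.
rewrite (negPf ji).
exact: (probability_setT (binomial_prob (off n j w) (pr n j w))).
Qed.

(** The number of trials is still random on [A], so the binomial bound is applied on
its levels and reassembled. *)
Lemma binomial_noise n A i (t m : R) : 0 < t -> Fs n A -> 0 <= m ->
  (forall w w', A w -> A w' -> pr n i w = pr n i w') ->
  (forall w, A w -> (off n i w)%:R <= m) ->
  (P (A `&` [set w | ~ ((B n.+1 i w <= off n i w)%N /\
                (`|(B n.+1 i w)%:R - (off n i w)%:R * pr n i w| <= t)%R)]) <=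
   (m / t ^+ 2)%:E * P A)%E.
Proof.
move=> t0 FA m0 Ap Am; set X := A `&` _.
have AO : adapted (Fs n) (off n i).
  by apply: adapted_offspring => j; exact: adapted_particles.
have sG := Fstar_sigma_algebra n.
have [[w0 Aw0]|A0] := pselect (A !=set0); last first.
  have -> : X = set0 by apply/seteqP; split => // w [Aw _]; apply: A0; exists w.
  by rewrite measure0 mule_ge0 // lee_fin divr_ge0 ?sqr_ge0.
have mX o : measurable (A `&` off n i @^-1` [set o]).
  by apply: (@measurable_Fstar n); apply: (sigma_setI sG) => //; exact: AO.
pose U o := [set k : nat | ~ ((k <= o)%N /\ `|k%:R - o%:R * pr n i w0| <= t)].
have XE o : X `&` off n i @^-1` [set o] =
    (A `&` off n i @^-1` [set o]) `&` [set w | U o (B n.+1 i w)].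
  apply/seteqP; split => w /=; rewrite /X /U /=.
    by move=> [[Aw +] <-]; rewrite (Ap _ _ Aw Aw0).
  by move=> [[Aw <-]]; rewrite -(Ap _ _ Aw Aw0).
have AB : adapted measurable (B n.+1 i) by [].
apply: (@probability_le_levels _ _ _ P nat (off n i)).
- by move=> o; apply: (@measurable_Fstar n); exact: AO.
- have -> : X = \bigcup_o (X `&` off n i @^-1` [set o]).
    apply/seteqP; split => [w Xw|w [c _ [Xw _]]]; last exact: Xw.
    by exists (off n i w).
  apply: bigcupT_measurable => o; rewrite XE; apply: measurableI => //; exact: AB.
- exact: measurable_Fstar FA.
- by rewrite divr_ge0 // sqr_ge0.
move=> o; rewrite XE (@one_step_law n _ i o (pr n i w0)).
- have [[w [Aw ow]]|E] := pselect (A `&` off n i @^-1` [set o] !=set0); last first.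
    suff -> : A `&` off n i @^-1` [set o] = set0 by rewrite measure0 !mule0.
    by apply/seteqP; split => // w Aw; apply: E; exists w.
  rewrite lee_wpmul2r //; apply: (le_trans (binomial_tail _ _ t0)).
    exact: step_prob_ge0_le1.
  rewrite lee_fin ler_wpM2r ?invr_ge0 ?sqr_ge0 //.
  by rewrite -ow; exact: Am.
- by apply: (sigma_setI sG) => //; exact: AO.
by move=> w [Aw ow]; split => //; exact: Ap.
Qed.

(** * Typical generations *)

Definition population n w : nat := (\sum_i N n w i)%N.

(** The second clause makes the truncated subtractions of the process exact. *)
Definition typical_step (e : R) n w := forall i,
  [/\ `|(off n i w)%:R - (N n w i)%:R * mu| <= e * (population n w)%:R,
      (B n.+1 i w <= off n i w)%N &
      `|(B n.+1 i w)%:R - (off n i w)%:R * pr n i w| <= e * (population n w)%:R].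

Lemma populationS n w : (forall i, (B n.+1 i w <= off n i w)%N) ->
  population n.+1 w = (\sum_i off n i w)%N.
Proof.
move=> Boff; rewrite /population !sum3 !particlesS !ord3E.
have := Boff 0; have := Boff 1; have := Boff 2%:R.
move: (B _ _ w) (B _ _ w) (B _ _ w) (off _ _ w) (off _ _ w) (off _ _ w) => a b c o0 o1 o2.
by move=> *; lia.
Qed.

Lemma population_growth e n w : typical_step e n w ->
  `|(population n.+1 w)%:R - mu * (population n w)%:R| <= 3%:R * e * (population n w)%:R.
Proof.
move=> typ; rewrite populationS; last by move=> i; case: (typ i).
have [a0 _ _] := typ 0; have [a1 _ _] := typ 1; have [a2 _ _] := typ 2%:R.
have pE : (population n w)%:R = (N n w 0)%:R + (N n w 1)%:R + (N n w 2%:R)%:R :> R.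
  by rewrite /population sum3 !natrD.
move: a0 a1 a2; rewrite sum3 !natrD !ler_norml.
have : mu * (population n w)%:R = mu * (N n w 0)%:R + mu * (N n w 1)%:R + mu * (N n w 2%:R)%:R.
  by rewrite pE !mulrDr.
move=> pm /andP[? ?] /andP[? ?] /andP[? ?]; apply/andP; split; lra.
Qed.

Lemma population_ge e lam n w : typical_step e n w -> lam <= mu - 3%:R * e ->
  lam * (population n w)%:R <= (population n.+1 w)%:R.
Proof.
move=> /population_growth; rewrite ler_norml => /andP[+ _] le.
have : lam * (population n w)%:R <= (mu - 3%:R * e) * (population n w)%:R by exact: ler_wpM2r.
lra.
Qed.

(** Whatever is said in terms of the state, the offspring and the splittings of a
generation belongs to the information after this generation. *)
Lemma step_event n (g : {ffun 'I_3 -> nat} * {ffun 'I_3 -> nat} ->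
    {ffun 'I_3 -> nat} -> {ffun 'I_3 -> nat} -> Prop) :
  F n.+1 [set w | g (state n w) [ffun i => off n i w] [ffun i => B n.+1 i w]].
Proof.
have sG := Fn_sigma_algebra n.+1.
have AO i : adapted (F n.+1) (off n i).
  by apply: adapted_sub (@Fstar_sub_Fn n) (adapted_offspring _ _) => ?; exact: adapted_particles.
have : adapted (F n.+1) (fun w => (fun st (ob : {ffun 'I_3 -> nat} * {ffun 'I_3 -> nat}) =>
    g st ob.1 ob.2) (state n w) ([ffun i => off n i w], [ffun i => B n.+1 i w])).
  apply: (@adapted_map2 _ _ sG _ _ _ _ _ (fun st (ob : {ffun 'I_3 -> nat} * {ffun 'I_3 -> nat}) =>
    g st ob.1 ob.2)).
    by apply: adapted_sub (@adapted_state n); exact: Fn_sub.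
  by apply: (@adapted_map2 _ _ sG _ _ _ _ _ (fun a b => (a, b)));
    apply: adapted_ffun => // i; exact: adapted_B.
by move=> /(_ [set p : Prop | p]).
Qed.

(** [step_prob] as a function of the countably valued state. *)
Definition state_prob (st : {ffun 'I_3 -> nat} * {ffun 'I_3 -> nat}) i : R :=
  let wt j := T0 0 j + (st.2 j)%:R in wt (i - 1) / (wt (i - 1) + wt (i + 1)).

Lemma step_prob_state n i w : pr n i w = state_prob (state n w) i.
Proof. by rewrite /step_prob /state_prob !weightsE !ffunE. Qed.

Lemma typical_step_F e n : F n.+1 [set w | typical_step e n w].
Proof.
have := @step_event n (fun st o b => forall i,
  [/\ `|(o i)%:R - (st.1 i)%:R * mu| <= e * (\sum_i st.1 i)%N%:R, (b i <= o i)%N &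
    `|(b i)%:R - (o i)%:R * state_prob st i| <= e * (\sum_i st.1 i)%N%:R]).
have popE w : (\sum_i (state n w).1 i)%N = population n w.
  by apply: eq_bigr => i _; rewrite ffunE.
by congr (F n.+1 _); apply/seteqP; split => w /= H i; have := H i;
  rewrite popE step_prob_state /= !ffunE.
Qed.

Lemma V_ge0 : 0 <= V.
Proof.
rewrite -lee_fin; apply: le_trans (square_Z 0 0 0); apply: integral_ge0 => w _.
by rewrite lee_fin sqr_ge0.
Qed.

(** On a level of the state all parameters of the laws are constant; the bound is the
union of six tail estimates. *)
Lemma atypical_step_level n A nu tau (e : R) : 0 < e <= 1 -> F n A ->
  (forall w, A w -> state n w = (nu, tau)) -> (0 < \sum_i nu i)%N ->
  (P (A `&` [set w | ~ typical_step e n w]) <=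
   ((V + mu + 3%:R) / (e ^+ 2 * (\sum_i nu i)%N%:R))%:E * P A)%E.
Proof.
move=> /andP[e0 e1] FA Ast M0; set M : R := (\sum_i nu i)%N%:R; have M0' : 0 < M by rewrite ltr0n.
have sG := Fn_sigma_algebra n.
have sGs := Fstar_sigma_algebra n.
have AN w i : A w -> N n w i = nu i.
  by move=> /Ast /(congr1 fst) /ffunP /(_ i); rewrite ffunE.
have Apop w : A w -> (population n w)%:R = M.
  by move=> Aw; rewrite /M /population; congr (_%:R); apply: eq_bigr => i _; exact: AN.
have Apr w w' i : A w -> A w' -> pr n i w = pr n i w'.
  move=> /Ast /(congr1 snd) /ffunP /= E /Ast /(congr1 snd) /ffunP /= E'.
  have trE j : traversals n w j = traversals n w' j.
    by have := E j; have := E' j; rewrite !ffunE => -> ->.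
  by rewrite /step_prob !weightsE !trE.
have eM : 0 < e * M by rewrite mulr_gt0.
(* [X1] is the failure for the offspring, [X2] the failure for the splitting where the
   offspring is as it should be, so that the number of trials is bounded. *)
pose X1 i := A `&` [set w | (e * M < `|(off n i w)%:R - (nu i)%:R * mu|)%R].
pose A' i := A `&` [set w | (`|(off n i w)%:R - (nu i)%:R * mu| <= e * M)%R].
pose X2 i := A' i `&` [set w | ~ ((B n.+1 i w <= off n i w)%N /\
                (`|(B n.+1 i w)%:R - (off n i w)%:R * pr n i w| <= e * M)%R)].
have AO i : adapted (Fs n) (off n i).
  by apply: adapted_offspring => j; exact: adapted_particles.
have FsA : Fs n A by exact: Fn_sub_Fstar.
have FA' i : Fs n (A' i).
  by apply: (sigma_setI sGs) => //; exact: (AO i [set y | `|y%:R - (nu i)%:R * mu| <= e * M]).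
have mA : measurable A := measurable_Fn FA.
have mX1 i : measurable (X1 i).
  apply: (measurable_Fn (n := n.+1)); apply: Fstar_sub_Fn.
  by apply: (sigma_setI sGs) => //; exact: (AO i [set y | e * M < `|y%:R - (nu i)%:R * mu|]).
have mA' i : measurable (A' i) by apply: (measurable_Fn (n := n.+1)); exact: Fstar_sub_Fn.
have FX : F n.+1 (A `&` [set w | ~ typical_step e n w]).
  apply: (sigma_setI (Fn_sigma_algebra n.+1)).
    by apply: Fn_sub FA.
  by apply: (sigma_setC (Fn_sigma_algebra n.+1)); exact: typical_step_F.
pose m i : R := (nu i)%:R * mu + e * M.
have m0 i : 0 <= m i by rewrite addr_ge0 ?mulr_ge0 ?(ltW e0) ?(ltW M0') ?(ltW mu_gt0).
have mX2 i : measurable (X2 i).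
  apply: measurableI => //; apply: (measurable_Fn (n := n.+1)).
  have := @step_event n (fun st o b => ~ ((b i <= o i)%N /\
    `|(b i)%:R - (o i)%:R * state_prob st i| <= e * M)).
  by congr (F n.+1 _); apply/seteqP; split => w /=; rewrite step_prob_state !ffunE.
have tail1 i : (P (X1 i) <= ((nu i)%:R * V / (e * M) ^+ 2)%:E * P A)%E.
  by apply: (@offspring_tail) => // w; exact: AN.
have tail2 i : (P (X2 i) <= (m i / (e * M) ^+ 2)%:E * P A)%E.
  apply: le_trans (_ : (m i / (e * M) ^+ 2)%:E * P (A' i) <= _)%E.
    apply: (@binomial_noise) => //.
    - by move=> w w' [Aw _] [Aw' _]; exact: Apr.
    - by move=> w [Aw] /=; rewrite ler_norml /m => /andP[_]; lra.
  apply: lee_wpmul2l; first by rewrite lee_fin divr_ge0 ?sqr_ge0.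
  by apply: le_measure; rewrite ?inE // => w [].
have bnd := @probability_union3 _ _ _ P (fun i => X1 i `|` X2 i) _ _
  (fun i => measurableU _ _ (mX1 i) (mX2 i)) (measurable_Fn FX)
  (fun i => le_trans (measureU2 _ (mX1 i) (mX2 i)) (leeD (tail1 i) (tail2 i))).
apply: le_trans (bnd _) _.
  move=> w [Aw /= ntyp]; apply: contrapT => nX; apply: ntyp => i.
  rewrite (Apop _ Aw) (AN _ _ Aw).
  have nX1 : `|(off n i w)%:R - (nu i)%:R * mu| <= e * M.
    by rewrite leNgt; apply/negP => h; apply: nX; exists i => //; left.
  have [H1 H2] : (B n.+1 i w <= off n i w)%N /\
      `|(B n.+1 i w)%:R - (off n i w)%:R * pr n i w| <= e * M.
    by apply: contrapT => h; apply: nX; exists i => //; right.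
  by split.
have -> : P A = (fine (P A))%:E by rewrite fineK // fin_num_measure.
have p0 : 0 <= fine (P A) by rewrite fine_ge0.
rewrite -!EFinM -!EFinD lee_fin -!mulrDl ler_wpM2r //.
have ME : M = (nu 0)%:R + (nu 1)%:R + (nu 2%:R)%:R by rewrite /M sum3 !natrD.
have -> : (nu 0)%:R * V + m 0 + ((nu 1)%:R * V + m 1) + ((nu 2%:R)%:R * V + m 2%:R) =
    M * (V + mu + 3%:R * e).
  have MV : M * V = (nu 0)%:R * V + (nu 1)%:R * V + (nu 2%:R)%:R * V by rewrite ME !mulrDl.
  have Mmu : M * mu = (nu 0)%:R * mu + (nu 1)%:R * mu + (nu 2%:R)%:R * mu by rewrite ME !mulrDl.
  by rewrite /m; lra.
rewrite (_ : _ / _ = (V + mu + 3%:R * e) / (e ^+ 2 * M)).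
  by rewrite ler_wpM2r ?invr_ge0 ?mulr_ge0 ?sqr_ge0 ?(ltW M0') //; lra.
by field; rewrite !gt_eqF.
Qed.

(** The bound on the levels depends on the state only through the population, hence
extends to every event of the past on which the population is at least [m]. *)
Lemma atypical_step n A m (e : R) : 0 < e <= 1 -> 0 < m -> F n A ->
  (forall w, A w -> m <= (population n w)%:R) ->
  (P (A `&` [set w | ~ typical_step e n w]) <=
   ((V + mu + 3%:R) / (e ^+ 2 * m))%:E * P A)%E.
Proof.
move=> e01 m0 FA Am; have [e0 e1] := andP e01.
have sG := Fn_sigma_algebra n.
have C0 : 0 <= V + mu + 3%:R by have := V_ge0; have := mu_gt0; lra.
have FX : F n.+1 (A `&` [set w | ~ typical_step e n w]).
  apply: (sigma_setI (Fn_sigma_algebra n.+1)).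
    by apply: Fn_sub FA.
  by apply: (sigma_setC (Fn_sigma_algebra n.+1)); exact: typical_step_F.
apply: (@probability_le_levels _ _ _ P _ (state n)).
- by move=> c; apply: (measurable_Fn (n := n)); exact: adapted_state.
- exact: measurable_Fn FX.
- exact: measurable_Fn FA.
- by rewrite divr_ge0 // mulr_ge0 ?sqr_ge0 // ltW.
move=> [nu tau].
have FA' : F n (A `&` state n @^-1` [set (nu, tau)]).
  by apply: (sigma_setI sG) => //; exact: adapted_state.
have [[w [Aw Sw]]|E] := pselect (A `&` state n @^-1` [set (nu, tau)] !=set0); last first.
  have -> : A `&` state n @^-1` [set (nu, tau)] = set0.
    by apply/seteqP; split => // w Aw; apply: E; exists w.
  rewrite measure0 mule0 (_ : _ `&` _ = set0) ?measure0 //.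
  by apply/seteqP; split => // w [[Aw _] Sw]; apply: E; exists w.
have popE : (population n w)%:R = (\sum_i nu i)%N%:R :> R.
  congr (_%:R); apply: eq_bigr => i _.
  by move: Sw => /(congr1 fst) /ffunP /(_ i); rewrite ffunE.
have M0 : 0 < (\sum_i nu i)%N%:R :> R by rewrite -popE (lt_le_trans m0) // Am.
rewrite setIAC; apply: le_trans (@atypical_step_level n _ nu tau e e01 FA' _ _) _.
- by move=> w' [].
- by rewrite -(ltr0n R).
rewrite lee_wpmul2r // lee_fin ler_wpM2l // lef_pV2 ?posrE ?mulr_gt0 ?exprn_gt0 //.
by rewrite ler_wpM2l ?sqr_ge0 // -popE; exact: Am.
Qed.

(** * Typical generations forever *)

(** With the error [delta * rho ^+ k] in generation [K + k] and a population of at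
least [m * lam ^+ k], the probability of failure in this generation is at most
[(V + mu + 3) / (delta ^+ 2 * m)] times [(rho ^+ 2 * lam) ^- k]. For large [m] the sum of
these is at most one half, and half of the probability of [A] survives. *)
Lemma typical_forever (delta rho lam m : R) (A : set Omega) K :
  0 < delta <= 1 -> 0 < rho < 1 -> 1 < rho ^+ 2 * lam -> 0 < lam ->
  lam <= mu - 3%:R * delta ->
  0 < m -> 2 * ((V + mu + 3%:R) / (delta ^+ 2)) * (1 - (rho ^+ 2 * lam)^-1)^-1 <= m ->
  F K A -> (0 < P A)%E -> (forall w, A w -> m <= (population K w)%:R) ->
  let E := A `&` [set w | forall k, typical_step (delta * rho ^+ k) (K + k) w] in
  measurable E /\ (0 < P E)%E.
Proof.
move=> /andP[d0 d1] /andP[r0 r1] g1 l0 lm m0 mC FA PA Am E.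
have sG n := Fn_sigma_algebra n.
pose e k := delta * rho ^+ k.
have e0 k : 0 < e k by rewrite mulr_gt0 // exprn_gt0.
have ed k : e k <= delta by rewrite ler_piMr ?exprn_ile1 // ltW.
have e1 k : 0 < e k <= 1 by rewrite e0 (le_trans (ed k)).
(* Recursive, because the bound on generation [k] needs the growth of the population
   in all the earlier ones. *)
pose Ak := fix Ak k := if k is j.+1 then
  Ak j `&` [set w | typical_step (e j) (K + j) w] else A.
have FAk k : F (K + k) (Ak k).
  elim: k => [|k IH]; first by rewrite addn0.
  rewrite addnS [Ak k.+1]/(Ak k `&` [set w | typical_step (e k) (K + k) w]).
  apply: (sigma_setI (sG _)); last exact: typical_step_F.
  by apply: Fn_sub IH.
have popk k w : Ak k w -> m * lam ^+ k <= (population (K + k) w)%:R.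
  elim: k => [|k IH]; first by rewrite addn0 mulr1; exact: Am.
  move=> [/IH IHk typ]; rewrite addnS; apply: le_trans (population_ge typ _); last first.
    by apply: (le_trans lm); have := ed k; lra.
  by rewrite exprS mulrCA ler_pM2l.
set C := V + mu + 3%:R in mC.
pose q := (rho ^+ 2 * lam)^-1.
have g0 : 0 < rho ^+ 2 * lam by lra.
have q01 : 0 <= q < 1 by rewrite invr_ge0 (ltW g0) /= invf_lt1.
have [q0 q1] := andP q01.
have mAk k : measurable (Ak k) by exact: measurable_Fn (FAk k).
pose p k := fine (P (Ak k)).
have pE k : P (Ak k) = (p k)%:E by rewrite fineK // fin_num_measure.
have p0 k : 0 <= p k by exact: fine_ge0.
pose b := C / (delta ^+ 2 * m).
have bE k : C / (e k ^+ 2 * (m * lam ^+ k)) = b * q ^+ k.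
  rewrite /b /q /e !exprMn -!exprM mulnC exprM.
  rewrite [_ * _ * (m * _)]mulrACA -exprMn invfM mulrA; congr (_ * _).
  by rewrite exprVn.
have V0 := V_ge0.
have C0 : 0 < C by rewrite /C; lra.
have b0 : 0 <= b by rewrite divr_ge0 ?(ltW C0) // mulr_ge0 ?sqr_ge0 // ltW.
have pS k : p k - b * q ^+ k * p k <= p k.+1.
  have H := @atypical_step (K + k) (Ak k) (m * lam ^+ k) (e k) (e1 k) _ (FAk k) (popk k).
  have {}H := H (mulr_gt0 m0 (exprn_gt0 k l0)); rewrite bE pE in H.
  have mB' : measurable (Ak k `&` [set w | ~ typical_step (e k) (K + k) w]).
    apply: (@measurable_Fn (K + k).+1); apply: (sigma_setI (sG _)); first exact: Fn_sub (FAk k).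
    by apply: (sigma_setC (sG _)); exact: typical_step_F.
  have : (P (Ak k) <= P (Ak k.+1) + P (Ak k `&` [set w | ~ typical_step (e k) (K + k) w]))%E.
    apply: le_trans (measureU2 _ (mAk k.+1) mB'); apply: le_measure; rewrite ?inE //.
      exact: measurableU.
    by move=> w Aw; have [t|t] := pselect (typical_step (e k) (K + k) w); [left|right].
  rewrite !pE => /le_trans /(_ (leeD2l _ H)).
  by rewrite -EFinM -EFinD lee_fin; lra.
have pdec k : p k.+1 <= p k.
  by rewrite -lee_fin -!pE; apply: le_measure; rewrite ?inE // => w [].
have pA k : p k <= p 0%N.
  by elim: k => // k IH; exact: le_trans (pdec k) IH.
have plow k : p 0%N * (1 - b * \sum_(j < k) q ^+ j) <= p k.
  elim: k => [|k IH]; first by rewrite big_ord0 mulr0 subr0 mulr1.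
  apply: le_trans (pS k); rewrite big_ord_recr /=.
  have : b * q ^+ k * p k <= b * q ^+ k * p 0%N.
    by rewrite ler_wpM2l // mulr_ge0 // exprn_ge0.
  by lra.
have phalf k : p 0%N / 2 <= p k.
  apply: le_trans (plow k); rewrite ler_wpM2l // -/(1 / 2).
  have : b * (\sum_(j < k) q ^+ j) <= b * (1 - q)^-1.
    by rewrite ler_wpM2l //; exact: geometric_sum_le.
  have : b * (1 - q)^-1 <= 2^-1.
    rewrite (_ : b * (1 - q)^-1 = C / delta ^+ 2 * (1 - q)^-1 / m).
      by rewrite ler_pdivrMr //; move: mC; rewrite -/q; lra.
    by rewrite /b invfM; ring.
  by lra.
have EE : E = \bigcap_k Ak k.
  apply/seteqP; split => w.
    by move=> [Aw typ] k _; elim: k => // k IH; split => //; exact: typ.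
  move=> H; split; first exact: (H 0%N).
  by move=> k; have [] := H k.+1 Logic.I.
have mE : measurable E by rewrite EE; exact: bigcapT_measurable.
split=> //; rewrite EE.
have Ahomo : {homo Ak : n m / (n <= m)%N >-> (m <= n)%O}.
  apply/nonincreasing_seqP => k; apply/subsetPset => w [].
  by [].
have mcap : measurable (\bigcap_k Ak k) by rewrite -EE.
have Afin : (P (Ak 0%N) < +oo)%E by rewrite pE ltry.
have cvg := nonincreasing_cvg_mu Afin mAk mcap Ahomo.
have <- : limn (P \o Ak) = P (\bigcap_k Ak k) by apply/cvg_lim.
apply: (@lt_le_trans _ _ (p 0%N / 2)%:E).
  by rewrite lte_fin divr_gt0 // -lte_fin -pE.
apply: lime_ge; first by apply/cvg_ex; exists (P (\bigcap_k Ak k)).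
by apply: nearW => k; rewrite /= pE lee_fin.
Qed.

(** * Normalised trajectories *)

Definition total_weight n w : R := \sum_i T n w 0 i.
Definition density n w i : R := (N n w i)%:R / (population n w)%:R.
Definition portion n w i : R := T n w 0 i / total_weight n w.
Definition fresh_share n w : R := (population n w)%:R / total_weight n w.

Lemma total_weight_gt0 n w : 0 < total_weight n w.
Proof. by rewrite /total_weight sum3 !addr_gt0 // weights_gt0. Qed.

Lemma portionE n w i : proportions N0 T0 Z B n w 0 i = portion n w i.
Proof.
rewrite /proportions mxE mulrC /portion /norm1; congr (_ / _).
by apply: eq_bigr => j _; rewrite ger0_norm // ltW // weights_gt0.
Qed.

Lemma total_weightS n w : (forall i, (B n.+1 i w <= off n i w)%N) ->
  total_weight n.+1 w = total_weight n w + (population n.+1 w)%:R.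
Proof.
move=> Boff; rewrite (populationS Boff) /total_weight !sum3 /= !mxE /Bbar !natrD.
rewrite !natrB // !ord3E; ring.
Qed.

Lemma portion_gt0 n w i : 0 < portion n w i.
Proof. by rewrite divr_gt0 ?weights_gt0 ?total_weight_gt0. Qed.

Lemma portion_prob_vec n w : prob_vec (portion n w).
Proof.
split; first by move=> i; rewrite ltW // portion_gt0.
by rewrite -mulr_suml divff // gt_eqF // total_weight_gt0.
Qed.

Lemma density_prob_vec n w : (0 < population n w)%N -> prob_vec (density n w).
Proof.
move=> M0; split; first by move=> i; rewrite divr_ge0.
by rewrite -mulr_suml -natr_sum divff // pnatr_eq0 -lt0n.
Qed.

Lemma turn_portion n w i : turn (portion n w) i = pr n i w.
Proof.
rewrite /turn /step_prob /portion.
have := weights_gt0 n w (i - 1); have := weights_gt0 n w (i + 1).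
have := total_weight_gt0 n w; move: (total_weight n w) (T n w 0 _) (T n w 0 _) => S b a S0 b0 a0.
by field; rewrite (gt_eqF S0) /= !gt_eqF ?addr_gt0.
Qed.

Lemma offspring_density e n w i : typical_step e n w -> (0 < population n w)%N ->
  (population n w <= population n.+1 w)%N ->
  `|(off n i w)%:R / (population n.+1 w)%:R - density n w i| <= 4%:R * e.
Proof.
move=> typ M0 MM'; have [h _ _] := typ i.
apply: ratio_error h (population_growth typ) => //; rewrite ?ler_nat ?ltr0n //.
by rewrite ler0n /population (bigD1 i) //= leq_addr.
Qed.

(** The constant [14]: [arrivals] collects two errors [e] of the splittings and two
errors [4 * e] of the offspring, and for the weights the starting points
contribute another [4 * e]. *)
Lemma noisy_typical_step e n w : typical_step e n w -> (0 < population n w)%N ->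
  (population n w <= population n.+1 w)%N ->
  noisy_step (14%:R * e) (fresh_share n.+1 w) (density n w) (portion n w)
    (density n.+1 w) (portion n.+1 w).
Proof.
move=> typ M0 MM' i.
have e0 : 0 <= e.
  have [h _ _] := typ i; have := le_trans (normr_ge0 _) h.
  by rewrite pmulr_lge0 // ltr0n.
have M'0 : 0 < (population n.+1 w)%:R :> R by rewrite ltr0n (leq_trans M0).
have Boff j : (B n.+1 j w <= off n j w)%N by have [] := typ j.
have Oerr j := offspring_density j typ M0 MM'.
have prob j : 0 <= pr n j w <= 1 by exact: step_prob_ge0_le1.
set M' : R := (population n.+1 w)%:R in M'0 Oerr *.
pose o j : R := (off n j w)%:R / M'; pose b j : R := (B n.+1 j w)%:R / M'.
have Berr j : `|b j - pr n j w * o j| <= e.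
  have [_ _ h] := typ j.
  have -> : b j - pr n j w * o j = ((B n.+1 j w)%:R - (off n j w)%:R * pr n j w) / M'.
    by rewrite /b /o; ring.
  rewrite normrM normfV (gtr0_norm M'0) ler_pdivrMr // (le_trans h) //.
  by rewrite ler_wpM2l // ler_nat.
have xE : density n.+1 w i = b (i - 1) + o (i + 1) - b (i + 1).
  by rewrite /density particlesS natrD natrB // -/M' /b /o; ring.
have so : o 0 + o 1 + o 2%:R = 1.
  have popE := populationS Boff; rewrite sum3 in popE.
  rewrite /o -!mulrDl -!natrD (_ : (_ + _)%N = population n.+1 w); last exact: esym popE.
  by rewrite divff // gt_eqF.
have W p j : 0 <= p <= 1 -> `|p * (o j - density n w j)| <= 4%:R * e.
  move=> /andP[p0 p1]; rewrite normrM (ger0_norm p0).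
  by apply: le_trans (Oerr j); rewrite ler_piMl.
have Aerr : `|density n.+1 w i - arrivals (portion n w) (density n w) i| <= 10%:R * e.
  rewrite /arrivals !turn_portion xE.
  have -> : b (i - 1) + o (i + 1) - b (i + 1) -
     (density n w (i - 1) * pr n (i - 1) w + density n w (i + 1) * (1 - pr n (i + 1) w)) =
     (b (i - 1) - pr n (i - 1) w * o (i - 1)) + pr n (i - 1) w * (o (i - 1) - density n w (i - 1)) +
     (1 - pr n (i + 1) w) * (o (i + 1) - density n w (i + 1)) - (b (i + 1) - pr n (i + 1) w * o (i + 1)).
    by ring.
  have q01 : 0 <= 1 - pr n (i + 1) w <= 1 by have /andP[? ?] := prob (i + 1); apply/andP; split; lra.
  apply: (le_trans (ler_normB _ _)); have := Berr (i + 1).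
  have := ler_normD (b (i - 1) - pr n (i - 1) w * o (i - 1) + pr n (i - 1) w * (o (i - 1) - density n w (i - 1)))
      ((1 - pr n (i + 1) w) * (o (i + 1) - density n w (i + 1))).
  have := ler_normD (b (i - 1) - pr n (i - 1) w * o (i - 1)) (pr n (i - 1) w * (o (i - 1) - density n w (i - 1))).
  have := W _ (i + 1) q01; have := W _ (i - 1) (prob (i - 1)); have := Berr (i - 1).
  lra.
have S0 := total_weight_gt0 n w; have S'0 := total_weight_gt0 n.+1 w.
have SE := total_weightS Boff; rewrite -/M' in SE.
split; first by apply: (le_trans Aerr); rewrite ler_wpM2r // ler_nat.
have s01 : 0 <= fresh_share n.+1 w <= 1.
  by rewrite divr_ge0 ?(ltW S'0) //= ler_pdivrMr // mul1r SE lerDr ltW.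
have -> : portion n.+1 w i = portion n w i + fresh_share n.+1 w *
    (1 - portion n w i - o i - density n.+1 w i).
  have TE : T n.+1 w 0 i = T n w 0 i + M' * (1 - o i - density n.+1 w i).
    rewrite xE -so /b /o /= mxE /Bbar natrB //.
    have M'n : M' != 0 by rewrite gt_eqF.
    by case: (ord3P i) => ->; rewrite !ord3E; field.
  rewrite /portion /fresh_share TE -/M' SE.
  field; rewrite -SE !gt_eqF //.
have -> : portion n w i + fresh_share n.+1 w * (1 - portion n w i - o i - density n.+1 w i) -
    (portion n w i + fresh_share n.+1 w * (1 - portion n w i - density n w i -
     arrivals (portion n w) (density n w) i)) =
    - (fresh_share n.+1 w * ((o i - density n w i) +
    (density n.+1 w i - arrivals (portion n w) (density n w) i))) by ring.
have [s0 s1] := andP s01.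
rewrite normrN normrM (ger0_norm s0) (le_trans (ler_piMl _ s1)) //.
apply: (le_trans (ler_normD _ _)); have := Oerr i; move: Aerr; rewrite -/(o i); lra.
Qed.

Lemma fresh_share_step e n w : typical_step e n w -> (0 < population n w)%N ->
  exists m, `|m - mu| <= 3%:R * e /\
    fresh_share n.+1 w * (1 + m * fresh_share n w) = m * fresh_share n w.
Proof.
move=> typ M0; exists ((population n.+1 w)%:R / (population n w)%:R).
have {}M0 : 0 < (population n w)%:R :> R by rewrite ltr0n.
have Boff j : (B n.+1 j w <= off n j w)%N by have [] := typ j.
have S0 := total_weight_gt0 n w; have S'0 := total_weight_gt0 n.+1 w.
have SE := total_weightS Boff.
split.
  rewrite -(ler_pM2r M0) -[X in _ * X](gtr0_norm M0) -normrM mulrBl divfK ?gt_eqF //.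
  exact: population_growth typ.
rewrite /fresh_share SE; field; rewrite -SE !gt_eqF //.
Qed.

(** * States reached with positive probability *)

(** Witnessed by an event of the past, so that the next generation may be examined
on this event. *)
Definition reachable n (nu e : 'I_3 -> nat) := exists A, [/\ F n A, (0 < P A)%E &
  forall w, A w -> forall i, N n w i = nu i /\ traversals n w i = e i].

Lemma reachable0 : reachable 0 N0 (fun=> 0%N).
Proof.
by exists setT; split => //; [right|rewrite probability_setT].
Qed.

Lemma reachable_ext n nu e nu' e' : nu =1 nu' -> e =1 e' ->
  reachable n nu e -> reachable n nu' e'.
Proof.
move=> nuE eE [A [FA PA AE]]; exists A; split => // w Aw i.
by rewrite -nuE -eE; exact: AE.
Qed.

(** Each particle has [z] children with positive probability, independently of the
past, and then every splitting [b] has a positive binomial weight, because the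
splitting probabilities lie strictly between 0 and 1. *)
Lemma reachable_step n nu e (b : 'I_3 -> nat) : (forall i, (b i <= z * nu i)%N) ->
  reachable n nu e ->
  reachable n.+1 (fun i => b (i - 1)%R + (z * nu (i + 1)%R - b (i + 1)%R))%N
    (fun i => e i + b (i + 1)%R + (z * nu (i - 1)%R - b (i - 1)%R))%N.
Proof.
move=> bz [A [FA PA AE]].
pose C := [set w | forall i k, (k < nu i)%N -> Z n.+1 i k w = z].
have sG := smallest_sigma_algebra setT (gen_offspring Z n.+1).
have sGs := Fstar_sigma_algebra n.
pose J := [seq (i, k) | i <- enum 'I_3, k <- iota 0 (nu i)].
have JE i k : ((i, k) \in J) = (k < nu i)%N.
  apply/allpairsPdep/idP => [[i' [k' [_ + [-> ->]]]]|ki]; first by rewrite mem_iota add0n.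
  by exists i, k; rewrite mem_enum mem_iota add0n.
have Juniq : uniq J.
  apply: allpairs_uniq_dep; first exact: enum_uniq.
    by move=> i _; exact: iota_uniq.
  by move=> [i k] [i' k'] _ _ /= [-> ->].
have fC : <<s gen_offspring Z n.+1 >> C.
  have -> : C = \bigcap_(ik : 'I_3 * nat) [set w | (ik.2 < nu ik.1)%N -> Z n.+1 ik.1 ik.2 w = z].
    apply/seteqP; split => [w Cw [i k] _ /= ki|w Cw i k ki]; first exact: Cw.
    by have := Cw (i, k) Logic.I ki.
  rewrite -[X in _ X]setCK setC_bigcap; apply: (sigma_setC sG).
  apply: (sigma_countable_union sG) => -[i k]; apply: (sigma_setC sG) => /=.
  have [ki|ki] := boolP (k < nu i)%N.
    have := @adapted_fresh n.+1 i k [set z]; congr (_ _).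
    by apply/seteqP; split => w /=; [move=> ->|apply].
  rewrite (_ : [set _ | _] = setT); first exact: sigma_setT sG.
  by apply/seteqP; split.
have PC : (0 < P C)%E.
  have -> : C = [set w | forall j, j \in J -> [set z] (Z n.+1 j.1 j.2 w)].
    apply/seteqP; split => [w Cw [i k]|w Cw i k ki]; first by rewrite JE; exact: Cw.
    by apply: (Cw (i, k)); rewrite JE.
  rewrite (independent_Z n (fun=> [set z]) Juniq).
  by apply: (big_ind (fun x => (0 < x)%E)) => [|x y|j _]; [exact: lte01|exact: mule_gt0|exact: atom_Z].
pose A1 := A `&` C.
have PA1 : (0 < P A1)%E by rewrite (independent_past FA fC) mule_gt0.
have FA1 : Fs n A1.
  by apply: (sigma_setI sGs); [exact: Fn_sub_Fstar|exact: fresh_sub_Fstar].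
have offE w i : A1 w -> off n i w = (z * nu i)%N.
  move=> [Aw Cw]; rewrite /offspring; have [-> _] := AE w Aw i.
  rewrite (eq_bigr (fun=> z)); last by move=> k _; exact: Cw.
  by rewrite sum_nat_const card_ord mulnC.
have [w0 A1w0] : A1 !=set0.
  by apply/set0P; apply: contraTneq PA1 => ->; rewrite measure0 ltxx.
have prE w i : A1 w -> pr n i w = pr n i w0.
  move=> [Aw _]; have [Aw0 _] := A1w0; rewrite /step_prob !weightsE.
  by have [_ ->] := AE w Aw (i - 1); have [_ ->] := AE w Aw (i + 1);
     have [_ ->] := AE w0 Aw0 (i - 1); have [_ ->] := AE w0 Aw0 (i + 1).
pose A2 := A1 `&` [set w | forall i, [set b i] (B n.+1 i w)].
exists A2; split.
- have sF := Fn_sigma_algebra n.+1.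
  apply: (sigma_setI sF); first exact: Fstar_sub_Fn.
  have -> : [set w | forall i, [set b i] (B n.+1 i w)] =
      (fun w => [ffun i => B n.+1 i w]) @^-1` [set [ffun i => b i]].
    apply/seteqP; split => w /= H; first by apply/ffunP => i; rewrite !ffunE; exact: H.
    by move=> i; move/ffunP: H => /(_ i); rewrite !ffunE.
  by apply: adapted_ffun => // i; exact: adapted_B.
- rewrite /A2 (@step_law n A1
    (\prod_(i : 'I_3) binomial_prob (z * nu i) (pr n i w0) [set b i])%E (fun i => [set b i])) //.
    rewrite mule_gt0 //; apply: (big_ind (fun x => (0 < x)%E)) => [|x y|i _].
    - exact: lte01.
    - exact: mule_gt0.
    by apply: binomial_point => //; exact: step_prob_gt0_lt1.
  by move=> w A1w; apply: eq_bigr => i _; rewrite offE // prE.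
- move=> w [A1w Bw] i; have [Aw _] := A1w; rewrite particlesS /= /Bbar.
  have [_ ->] := AE w Aw i; have /= -> := Bw (i - 1); have /= -> := Bw (i + 1).
  by rewrite !offE.
Qed.

Definition at_hub (m : nat) (i : 'I_3) : nat := if i == 0 then m else 0%N.

(** The first step empties vertex [0], the second one sends everybody there. *)
Lemma reachable_hub : exists e, reachable 2 (at_hub (z * z * \sum_i N0 i)) e.
Proof.
pose b1 (i : 'I_3) := (if i == 2%:R then 0 else z * N0 i)%N.
have b1P i : (b1 i <= z * N0 i)%N by rewrite /b1; case: ifP.
have r1 := reachable_step b1P reachable0.
set nu1 := (fun i => _) in r1.
pose b2 (i : 'I_3) := (if i == 2%:R then z * nu1 i else 0)%N.
have b2P i : (b2 i <= z * nu1 i)%N by rewrite /b2; case: ifP.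
have r2 := reachable_step b2P r1.
eexists; apply: reachable_ext (fun=> erefl) r2 => i.
have -> : (\sum_i N0 i = N0 0%R + N0 1%R + N0 2%:R)%N by exact: sum3.
rewrite /at_hub /b2 /nu1 /b1.
by case: (ord3P i) => ->; rewrite !ord3E /=; nia.
Qed.

(** From the hub [h] particles go to vertex [1] and the others to vertex [2], then
all return; edge [0] is not used. *)
Lemma reachable_round_trip n m e h : (h <= z * m)%N -> reachable n (at_hub m) e ->
  exists e', [/\ reachable n.+2 (at_hub (z * z * m)) e', e' 0 = e 0,
    e' 1 = (e 1%R + (1 + z) * (z * m - h))%N & e' 2%:R = (e 2%:R + (1 + z) * h)%N].
Proof.
move=> hm r.
pose b1 (i : 'I_3) := if i == 0 then h else 0%N.
have b1P i : (b1 i <= z * at_hub m i)%N by rewrite /b1 /at_hub; case: ifP.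
have r1 := reachable_step b1P r.
set nu1 := (fun i => _) in r1.
pose b2 (i : 'I_3) := (if i == 2%:R then z * nu1 i else 0)%N.
have b2P i : (b2 i <= z * nu1 i)%N by rewrite /b2; case: ifP.
have r2 := reachable_step b2P r1.
eexists; split.
- apply: reachable_ext (fun=> erefl) r2 => i.
  rewrite /at_hub /b2 /nu1 /b1 /at_hub.
  by case: (ord3P i) => ->; rewrite !ord3E /=; nia.
- by rewrite /b2 /nu1 /b1 /at_hub !ord3E /=; lia.
- by rewrite /b2 /nu1 /b1 /at_hub !ord3E /=; nia.
- by rewrite /b2 /nu1 /b1 /at_hub !ord3E /=; nia.
Qed.

(** * Large states at the hub and near the centre *)

(** Round trips from the hub with an even splitting. A round trip multiplies [m] by
[z ^+ 2] and adds [z * (1 + z) * m] to the weight, so that the total weight less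
[z / (z - 1) * m] is invariant; this is the constant [c]. The thin edge keeps its
initial weight, and the last trip alone gives each thick edge nearly three
eighths of the total or more. *)
Lemma hub_scenario : exists (c : R) (e0 : nat), forall L : R, exists n m e,
  [/\ reachable n (at_hub m) e, L <= m%:R, e 0 = e0,
    \sum_i (T0 0 i + (e i)%:R) = zR / (zR - 1) * m%:R + c &
    (1 + zR) * (m%:R - zR) <= 2 * zR * (e 1)%:R /\
    (1 + zR) * (m%:R - zR) <= 2 * zR * (e 2%:R)%:R].
Proof.
have [e r] := reachable_hub.
set m := (z * z * _)%N in r.
have m0 : (0 < m)%N.
  have [i Ni] := N0_neq0.
  by rewrite /m !muln_gt0 !(ltnW z_gt1) /= (bigD1 i) //= ltn_addr // lt0n.
have z1 : zR - 1 != 0 by rewrite gt_eqF //; have := zR_gt1; lra.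
exists (\sum_i (T0 0 i + (e i)%:R) - zR / (zR - 1) * m%:R), (e 0).
have trips k : exists n m' e', [/\ reachable n (at_hub m') e', (k < m')%N, e' 0 = e 0,
    \sum_i (T0 0 i + (e' i)%:R) = zR / (zR - 1) * m'%:R +
      (\sum_i (T0 0 i + (e i)%:R) - zR / (zR - 1) * m%:R) &
    (k != 0)%N -> (1 + zR) * (m'%:R - zR) <= 2 * zR * (e' 1)%:R /\
      (1 + zR) * (m'%:R - zR) <= 2 * zR * (e' 2%:R)%:R].
  elim: k => [|k [n [m' [e' [r' km' e0' S' _]]]]].
    by exists 2%N, m, e; split => //; ring.
  pose h := ((z * m')./2)%N.
  have hm : (h <= z * m')%N by rewrite /h; lia.
  have [e'' [r'' e0 e1 e2]] := reachable_round_trip hm r'.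
  have E1 : (e'' 1)%:R = (e' 1)%:R + (1 + zR) * (zR * m'%:R - h%:R).
    by rewrite e1 natrD natrM natrB // natrD natrM.
  have E2 : (e'' 2%:R)%:R = (e' 2%:R)%:R + (1 + zR) * h%:R.
    by rewrite e2 natrD natrM natrD.
  exists n.+2, (z * z * m')%N, e''; split => //.
  - by move: z_gt1 km' => ? ?; nia.
  - by rewrite e0.
  - move: S'; rewrite !sum3 e0 E1 E2 !natrM => S'.
    rewrite (_ : _ + _ + _ = T0 0 0 + (e' 0)%:R + (T0 0 1 + (e' 1)%:R) +
      (T0 0 2%:R + (e' 2%:R)%:R) + (1 + zR) * (zR * m'%:R)); last by ring.
    by rewrite S'; field.
  - move=> _; rewrite E1 E2 !natrM.
    have h1 : 2 * h%:R <= zR * m'%:R.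
      by rewrite -natrM -natrM ler_nat /h; lia.
    have h2 : zR * m'%:R - 1 <= 2 * h%:R.
      by rewrite lerBlDr -natrM -natrM natr1 ler_nat /h; lia.
    have zz : 0 <= zR * (1 + zR) by rewrite mulr_ge0 //; have := zR_gt1; lra.
    have ze1 : 0 <= zR * (e' 1)%:R by rewrite mulr_ge0.
    have ze2 : 0 <= zR * (e' 2%:R)%:R by rewrite mulr_ge0.
    have := ler_wpM2l zz h1; have := ler_wpM2l zz h2.
    by split; lra.
move=> L; have [n [m' [e' [r' km' e0' S' H']]]] := trips (Num.bound `|L|).+1.
exists n, m', e'; split => //; last exact: H'.
have LL := archi_boundP (normr_ge0 L).
apply: (le_trans (ler_norm L)); apply: (le_trans (ltW LL)).
by rewrite ler_nat ltnW // ltnW.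
Qed.

Lemma reachable_split n nu e : reachable n nu e -> exists nu' e',
  [/\ reachable n.+1 nu' e',
    (\sum_i nu' i = z * \sum_i nu i)%N &
    forall i, `|2 * (nu' i)%:R - zR * ((\sum_i nu i)%N%:R - (nu i)%:R)| <= 1 :> R /\
    (e' i)%:R = (e i)%:R + ((\sum_i nu' i)%N%:R - zR * (nu i)%:R - (nu' i)%:R) :> R].
Proof.
move=> r; pose b (i : 'I_3) := ((z * nu i)./2)%N.
have bP i : (b i <= z * nu i)%N by rewrite /b; lia.
have r' := reachable_step bP r.
eexists; eexists; split; first exact: r'.
  rewrite !(@sum3 nat) !ord3E; have := bP 0; have := bP 1; have := bP 2%:R.
  by move: (b 0) (b 1) (b 2%:R) => b0 b1 b2 *; nia.
have half i : zR * (nu i)%:R - 1 <= 2 * (b i)%:R <= zR * (nu i)%:R.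
  rewrite lerBlDr -!natrM natr1 !ler_nat /b; apply/andP; split; lia.
move=> i; rewrite !(@sum3 nat) !ord3E !natrD !natrB // !natrM.
have /andP[? ?] := half 0; have /andP[? ?] := half 1; have /andP[? ?] := half 2%:R.
rewrite ler_norml.
by case: (ord3P i) => ->; rewrite !ord3E; (split; [apply/andP; split|]); lra.
Qed.

(** Even splittings from a large state at the hub. The share of the new particles in
the total weight is bounded below by [sg], which does not depend on the size, so
the deviation decreases geometrically; the rounding errors are of the order of
the inverse of the initial number of particles. *)
Lemma balanced_scenario (L eta : R) : 0 < eta -> exists n nu e,
  [/\ reachable n nu e, L <= (\sum_i nu i)%N%:R, (0 < \sum_i nu i)%N &
    forall i, `|(T0 0 i + (e i)%:R) / (\sum_j (T0 0 j + (e j)%:R)) - 1 / 3%:R| +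
      4%:R * `|(nu i)%:R / (\sum_j nu j)%N%:R - 1 / 3%:R| <= eta].
Proof.
move=> eta0; have [c [e0 scen]] := hub_scenario.
pose sg := (8%:R + `|c|)^-1.
have cn : 0 <= `|c| by [].
have sg0 : 0 < sg by rewrite invr_gt0; lra.
have sg8 : sg <= 1 / 8%:R by rewrite div1r lef_pV2 ?posrE; lra.
have [k0 Hk0] : exists k, 5%:R * (1 - sg) ^+ k <= eta / 2.
  have /cvgrPdist_lt /(_ (eta / 10%:R)) : (fun k => (1 - sg) ^+ k) @ \oo --> (0 : R).
    by apply: cvg_expr; rewrite ger0_norm; lra.
  case; first by lra.
  move=> k _ /(_ k (leqnn k)); rewrite sub0r normrN ger0_norm; last by rewrite exprn_ge0 //; lra.
  by move=> h; exists k; lra.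
have [n [m [e [r Lm _ SE _]]]] := scen (Num.max (Num.max L 1) (4%:R / (eta * sg))).
move: Lm; rewrite !ge_max => /andP[/andP[Lm m1] etam].
have m0 : 0 < m%:R :> R by lra.
have zz : 1 <= zR / (zR - 1) <= 2.
  have := zR_gt1; move=> z2; rewrite ler_pdivlMr ?ler_pdivrMr; lra.
have [zz1 zz2] := andP zz.
have sums (nu : 'I_3 -> nat) : (\sum_i nu i)%N%:R = (nu 0%R)%:R + (nu 1%R)%:R + (nu 2%:R)%:R :> R.
  by rewrite (@sum3 nat) !natrD.
have posS (f : 'I_3 -> nat) : 0 < \sum_i (T0 0 i + (f i)%:R).
  have p j : 0 < T0 0 j + (f j)%:R by rewrite ltr_wpDr.
  by rewrite sum3; have := p 0; have := p 1; have := p 2%:R; lra.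
have steps l : exists n nu e, [/\ reachable n nu e, m%:R <= (\sum_i nu i)%N%:R :> R,
    \sum_i (T0 0 i + (e i)%:R) = zR / (zR - 1) * (\sum_i nu i)%N%:R + c &
    forall i, `|(T0 0 i + (e i)%:R) / (\sum_j (T0 0 j + (e j)%:R)) - 1 / 3%:R| +
      4%:R * `|(nu i)%:R / (\sum_j nu j)%N%:R - 1 / 3%:R| <= 5%:R * (1 - sg) ^+ l + 2 / m%:R / sg].
  elim: l => [|l [n1 [nu1 [e1 [r1 m1' S1 H1]]]]].
    exists n, (at_hub m), e.
    have hubE : (\sum_i at_hub m i = m)%N.
      transitivity (at_hub m 0%R + at_hub m 1%R + at_hub m 2%:R)%N; first exact: sum3.
      by rewrite /at_hub /= !addn0.
    split => //; rewrite ?hubE // => i; rewrite expr0 mulr1.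
    have extra : 0 <= 2 / m%:R / sg by rewrite !divr_ge0 // ltW.
    have unit_dev (a b : R) : 0 <= a <= b -> 0 < b -> `|a / b - 1 / 3%:R| <= 1.
      move=> /andP[a0 ab] b0.
      have : 0 <= a / b <= 1 by rewrite divr_ge0 ?(ltW b0) //= ler_pdivrMr // mul1r.
      by move=> /andP[? ?]; rewrite ler_norml; apply/andP; split; lra.
    have D1 : `|(T0 0 i + (e i)%:R) / (\sum_j (T0 0 j + (e j)%:R)) - 1 / 3%:R| <= 1.
      have p j : 0 < T0 0 j + (e j)%:R by rewrite ltr_wpDr.
      apply: unit_dev; last exact: posS.
      by rewrite ltW //= sum3; case: (ord3P i) => ->; have := p 0; have := p 1; have := p 2%:R; lra.
    have D2 : `|(at_hub m i)%:R / m%:R - 1 / 3%:R| <= 1 :> R.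
      apply: unit_dev => //; rewrite ler0n ler_nat /at_hub /=.
      by case: (i == 0); rewrite ?leqnn ?leq0n.
    lra.
  have [nu2 [e2 [r2 M2 H2]]] := reachable_split r1.
  have MR : (\sum_i nu2 i)%N%:R = zR * (\sum_i nu1 i)%N%:R :> R by rewrite M2 natrM.
  have M1 : 0 < (\sum_i nu1 i)%N%:R :> R by exact: lt_le_trans m1'.
  have S2 : \sum_i (T0 0 i + (e2 i)%:R) =
      \sum_i (T0 0 i + (e1 i)%:R) + zR * (\sum_i nu1 i)%N%:R.
    have [_ A0] := H2 0; have [_ A1] := H2 1; have [_ A2] := H2 2%:R.
    rewrite !sum3 A0 A1 A2 MR; move: MR; rewrite !sums; lra.
  have z1 : zR - 1 != 0 by rewrite gt_eqF //; have := zR_gt1; lra.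
  exists n1.+1, nu2, e2; split => //.
  - by rewrite MR (le_trans m1') // ler_peMl //; have := zR_gt1; lra.
  - by rewrite S2 S1 MR; field.
  move=> i; rewrite S2 MR.
  have [A0 A1] := H2 i.
  have S10 : 0 < \sum_i (T0 0 i + (e1 i)%:R).
    exact: posS.
  have sgS : sg * (\sum_i (T0 0 i + (e1 i)%:R) + zR * (\sum_i nu1 i)%N%:R) <=
      zR * (\sum_i nu1 i)%N%:R.
    rewrite /sg ler_pdivrMl; last by lra.
    rewrite S1; have z2 := zR_gt1; have := ler_norm c.
    move: (_%:R) (le_trans m1 m1') => M M1'; have : zR / (zR - 1) * M <= 2 * M.
      by rewrite ler_wpM2r //; lra.
    have : `|c| <= `|c| * (zR * M) by rewrite ler_peMr //; nra.
    have : 2 * M <= zR * M by rewrite ler_wpM2r //; lra.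
    lra.
  apply: le_trans (split_contraction zR_gt1 M1 S10 _ sgS A0 _) _.
  - by rewrite ltW.
  - by rewrite A1 MR addrA.
  have q0 : 0 <= 1 - sg by lra.
  have mi : 2 / (\sum_i nu1 i)%N%:R <= 2 / m%:R :> R by rewrite ler_pM2l // lef_pV2.
  have sgE : 2 / m%:R / sg * sg = 2 / m%:R :> R by rewrite divfK // gt_eqF.
  apply: le_trans (lerD (ler_wpM2l q0 (H1 i)) mi) _.
  by rewrite exprS -{2}sgE; lra.
have [n1 [nu [e1 [r1 mM _ H]]]] := steps k0.
exists n1, nu, e1; split => //.
- exact: le_trans mM.
- by rewrite -(ltr0n R) (lt_le_trans m0).
move=> i; apply: (le_trans (H i)).
have : 2 / m%:R / sg <= eta / 2.
  move: etam; rewrite ler_pdivrMr ?mulr_gt0 // => etam.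
  rewrite ler_pdivrMr // ler_pdivrMr //; lra.
lra.
Qed.

(** * Trajectories controlled forever *)

(** Ratio of the successive error bounds. With [lam = (1 + mu) / 2] a lower bound for
the growth of the population, [rate] is less than 1, so that the errors are
summable, but [rate ^+ 2 * lam = (1 + lam) ^+ 2 / (4 * lam)] exceeds 1, so that
errors of this size become ever less likely to be exceeded. *)
Definition rate : R := let lam := (1 + mu) / 2 in (1 + lam) / (2 * lam).

Lemma rate_bounds : 0 < rate < 1 /\ 1 < rate ^+ 2 * ((1 + mu) / 2).
Proof.
rewrite /rate; have : 1 < (1 + mu) / 2 by have := mu_gt1; lra.
move: ((1 + mu) / 2) => lam l1; have l0 : 0 < lam by lra.
split.
  by rewrite divr_gt0 /= ?ltr_pdivrMr ?mulr_gt0 //; lra.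
rewrite (_ : _ * lam = (1 + lam) ^+ 2 / (4%:R * lam)).
  by rewrite ltr_pdivlMr ?mulr_gt0 //; nra.
by field; rewrite gt_eqF.
Qed.

(** Turns a reachable state into random trajectories of the normalised dynamics. The
threshold [L] depends on the error level only, so it may be fixed before the
scenario that leads to the state is chosen. *)
Lemma controlled_event (delta : R) : 0 < delta <= 1 -> 3%:R * delta <= (mu - 1) / 8%:R ->
  exists L : R, forall K nu e, reachable K nu e -> L <= (\sum_i nu i)%N%:R ->
  exists E : set Omega, [/\ measurable E, (0 < P E)%E & forall w, E w ->
    (forall i, N K w i = nu i /\ traversals K w i = e i) /\
    (forall k, [/\ typical_step (delta * rate ^+ k) (K + k) w, (0 < population (K + k) w)%N &
      (population (K + k) w <= population (K + k).+1 w)%N])].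
Proof.
move=> d01 dmu; have [r01 g1] := rate_bounds; have [d0 d1] := andP d01.
set lam := (1 + mu) / 2 in g1.
have l1 : 1 < lam by rewrite /lam; have := mu_gt1; lra.
pose L := Num.max 1 (2 * ((V + mu + 3%:R) / (delta ^+ 2)) * (1 - (rate ^+ 2 * lam)^-1)^-1).
exists L => K nu e [A [FA PA AE]] LM.
have L1 : 1 <= L by rewrite le_max lexx.
have popA w : A w -> population K w = (\sum_i nu i)%N.
  by move=> Aw; apply: eq_bigr => i _; have [] := AE w Aw i.
have [|||||mE PE] := @typical_forever delta rate lam L A K d01 r01 g1 _ _ _ _ FA PA.
- by lra.
- by rewrite /lam; have := mu_gt1; lra.
- by lra.
- by rewrite le_max lexx orbT.
- by move=> w /popA ->.
eexists; split; [exact: mE|exact: PE|move=> w [Aw typ]; split; first exact: AE].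
have grow k : (population (K + k) w <= population (K + k).+1 w)%N.
  rewrite -(ler_nat R); have [rr0 rr1] := andP r01.
  have := population_ge (typ k) (_ : 1 <= mu - 3%:R * (delta * rate ^+ k)).
  rewrite mul1r; apply.
  have : delta * rate ^+ k <= delta by rewrite ler_piMr ?exprn_ile1 // ltW.
  by have := mu_gt1; lra.
move=> k; split => //; elim: k => [|k IH].
  by rewrite addn0 -(ltr0n R) popA //; apply: lt_le_trans LM; lra.
by rewrite addnS (leq_trans IH).
Qed.

Lemma noise_level (eta : R) : 0 < eta -> exists delta : R,
  [/\ 0 < delta <= 1, 3%:R * delta <= (mu - 1) / 8%:R &
    forall n, \sum_(k < n) 14%:R * (delta * rate ^+ k) <= eta].
Proof.
move=> eta0; have [/andP[r0 r1] _] := rate_bounds.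
have m0 : 0 < (mu - 1) / 24%:R by have := mu_gt1; lra.
have q0 : 0 < (1 - rate) * eta / 14%:R by rewrite divr_gt0 // mulr_gt0 //; lra.
exists (Num.min 1 (Num.min ((mu - 1) / 24%:R) ((1 - rate) * eta / 14%:R))).
set delta := Num.min _ _.
have d0 : 0 < delta by rewrite !lt_min ltr01 m0.
have [d1 [d2 d3]] : delta <= 1 /\ delta <= (mu - 1) / 24%:R /\ delta <= (1 - rate) * eta / 14%:R.
  by rewrite !ge_min !lexx !orbT.
split; [by rewrite d0|by lra|move=> n].
under eq_bigr do rewrite mulrA; rewrite -mulr_sumr.
apply: (@le_trans _ _ (14%:R * delta * (1 - rate)^-1)).
  by rewrite ler_wpM2l ?mulr_ge0 ?(ltW d0) // geometric_sum_le // ltW.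
by rewrite ler_pdivrMr; lra.
Qed.

Lemma total_weight_state K w (e : 'I_3 -> nat) :
  (forall i, traversals K w i = e i) ->
  total_weight K w = \sum_i (T0 0 i + (e i)%:R).
Proof. by move=> eE; apply: eq_bigr => i _; rewrite weightsE eE. Qed.

Lemma portion_state K w (e : 'I_3 -> nat) i :
  (forall i, traversals K w i = e i) ->
  portion K w i = (T0 0 i + (e i)%:R) / \sum_j (T0 0 j + (e j)%:R).
Proof. by move=> eE; rewrite /portion (total_weight_state eE) weightsE eE. Qed.

Lemma population_state K w (nu : 'I_3 -> nat) :
  (forall i, N K w i = nu i) -> population K w = (\sum_i nu i)%N.
Proof. by move=> nuE; apply: eq_bigr => i _. Qed.

Lemma density_state K w (nu : 'I_3 -> nat) i :
  (forall i, N K w i = nu i) ->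
  density K w i = (nu i)%:R / (\sum_j nu j)%N%:R.
Proof. by move=> nuE; rewrite /density nuE (population_state nuE). Qed.

Lemma fresh_share_bounds K w : (forall i, (B K.+1 i w <= off K i w)%N) ->
  0 <= fresh_share K.+1 w <= 1.
Proof.
move=> Boff; have S0 := total_weight_gt0 K w.
have S1 := total_weight_gt0 K.+1 w.
by rewrite divr_ge0 ?(ltW S1) //= ler_pdivrMr // mul1r total_weightS // lerDr ltW.
Qed.

Lemma interior_event : exists K (E : set Omega), [/\ measurable E, (0 < P E)%E &
  forall w, E w -> forall n i, 1 / 6%:R <= portion (K + n) w i].
Proof.
have eta0 : 0 < 1 / 10%:R ^+ 4 :> R by rewrite divr_gt0 ?exprn_gt0.
have [delta [d01 dmu sumd]] := noise_level eta0.
have [L ctrl] := controlled_event d01 dmu.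
have [K [nu [e [r LM M0 bal]]]] := balanced_scenario L eta0.
have [E [mE PE EH]] := ctrl K nu e r LM.
exists K, E; split => // w Ew; have [st typ] := EH w Ew.
have [nuE eE] : (forall i, N K w i = nu i) /\
  (forall i, traversals K w i = e i) by split=> i; have [] := st i.
apply: (@interior_persists _ (fun k => density (K + k) w) (fun k => portion (K + k) w)
  (fun k => fresh_share (K + k).+1 w) (fun k => 14%:R * (delta * rate ^+ k))).
- by move=> n; apply: fresh_share_bounds => i; have [/(_ i)[]] := typ n.
- by move=> n; apply: density_prob_vec; have [] := typ n.
- by move=> n; exact: portion_prob_vec.
- by move=> n; rewrite !addnS; have [*] := typ n; exact: noisy_typical_step.
- move=> i; rewrite addn0 (portion_state _ eE).
  have : `|(T0 0 i + (e i)%:R) / (\sum_j (T0 0 j + (e j)%:R)) - 1 / 3%:R| <= 1 / 10%:R ^+ 4.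
    by apply: le_trans (bal i); rewrite lerDl mulr_ge0.
  by rewrite ler_norml => /andP[+ _]; lra.
- rewrite addn0 /imbalance.
  apply: (@le_trans _ _ (\sum_(i < 3) (1 / 10%:R ^+ 4 : R))); last first.
    by rewrite sumr_const card_ord; lra.
  apply: ler_sum => i _; rewrite (portion_state _ eE) (density_state _ nuE).
  apply: le_trans (bal i).
  move: ((T0 0 i + _) / _) ((nu i)%:R / _) => t y.
  rewrite (_ : y - (1 - t) / 2 = (y - 1 / 3%:R) + (t - 1 / 3%:R) / 2); last by field.
  apply: (le_trans (ler_normD _ _)); rewrite normrM (ger0_norm (_ : 0 <= 2^-1)) //.
  have := normr_ge0 (y - 1 / 3%:R); have := normr_ge0 (t - 1 / 3%:R); lra.
- exact: sumd.
Qed.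

(** Only the even times after [K] matter: then nearly all
particles are at the hub, and over
a round trip the thin edge shrinks by the factor [1 - k] up to an error [e n]
that tends to zero. *)
Lemma boundary_event : exists K (E : set Omega) (k : R) (e : nat -> R),
  [/\ measurable E, (0 < P E)%E, 0 < k, e @ \oo --> (0 : R) & forall w, E w -> forall n,
  [/\ 1 / 4%:R <= portion (K + n.*2) w 1, 1 / 4%:R <= portion (K + n.*2) w 2%:R &
    portion (K + n.*2.+2) w 0 <= (1 - k) * portion (K + n.*2) w 0 + e n]].
Proof.
have mu1 := mu_gt1.
(* [p] is the fixed point of the share, [k] the rate from [share_product]. *)
pose p := (mu - 1) / mu; have pE : p * mu = mu - 1 by rewrite divfK // gt_eqF //; lra.
have p01 : 0 < p < 1.
  by rewrite divr_gt0 /= ?ltr_pdivrMr; lra.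
have [p0 p1] := andP p01.
pose k := p ^+ 2 / (32%:R * mu).
have k0 : 0 < k by rewrite divr_gt0 ?exprn_gt0 // mulr_gt0 //; lra.
have kle : k <= 1 - 2 * mu / (1 + 2 * mu).
  rewrite (_ : 1 - _ = (1 + 2 * mu)^-1); last by field; rewrite gt_eqF //; lra.
  rewrite /k ler_pdivrMr; last by lra.
  rewrite mulrC ler_pdivlMr; last by lra.
  have : p ^+ 2 <= 1 by rewrite exprn_ile1 // ltW.
  have : p ^+ 2 * mu <= mu by rewrite ler_piMl ?exprn_ile1 // ?ltW //; lra.
  by lra.
have k1 : k <= 1.
  by apply: le_trans kle _; rewrite gerBl divr_ge0 //; lra.
have eta0 : 0 < k ^+ 3 / 10%:R ^+ 6 by rewrite divr_gt0 ?exprn_gt0.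
have [delta [d01 dmu sumd]] := noise_level eta0.
have [L ctrl] := controlled_event d01 dmu.
have [c [e0 scen]] := hub_scenario.
pose zr : R := z%:R; pose eps := k ^+ 3 / 10%:R ^+ 5; pose t0 := T0 0 0 + e0%:R.
have eps0 : 0 < eps by rewrite divr_gt0 ?exprn_gt0.
have t00 : 0 < t0 by rewrite ltr_wpDr.
have z2 : 2 <= zr by rewrite (ler_nat _ 2).
have [K [m [e [r Lm e0E SE [eS1 eS2]]]]] := scen (Num.max L (Num.max 1 (Num.max (3%:R * `|c|)
  (Num.max ((zr - 1) * `|c|) (Num.max
  (10%:R * zr * (zr ^+ 2 - 1) + 6%:R * zr * (zr - 1) * `|c|) (t0 / eps)))))).
move: Lm; rewrite !ge_max => /andP[Lm /andP[m1 /andP[cm1 /andP[cm2 /andP[cm3 tm]]]]].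
have [mS sS tS eS] := hub_initial_bounds mu_gt1 z2 mu_le_z pE eps0 t00 m1 cm1 cm2 cm3 tm SE.
have hubE : (\sum_i at_hub m i = m)%N.
  transitivity (at_hub m 0%R + at_hub m 1%R + at_hub m 2%:R)%N; first exact: sum3.
  by rewrite /at_hub /= !addn0.
have [E [mE PE EH]] := ctrl K (at_hub m) e r ltac:(by rewrite hubE).
(* The error over a round trip, as in [hub_persists]. *)
pose err (n : nat) : R := 3%:R * (14%:R * (delta * rate ^+ n.*2)) + 14%:R * (delta * rate ^+ n.*2.+1).
have [/andP[r0 r1] _] := rate_bounds.
exists K, E, k, err; split => //.
  have cvgr : (fun n => 3%:R * (14%:R * (delta * rate ^+ n)) + 14%:R * rate * (delta * rate ^+ n))
      @ \oo --> (0 : R).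
    have q : (fun n => rate ^+ n) @ \oo --> (0 : R) by apply: cvg_expr; rewrite gtr0_norm.
    rewrite (_ : 0 = 3%:R * (14%:R * (delta * 0)) + 14%:R * rate * (delta * 0)); last by ring.
    by apply: cvgD; repeat apply: cvgMr; exact: q.
  have := cvg_along (phi := double) _ cvgr; rewrite /comp /err.
  under [in X in _ -> X]eq_fun do rewrite exprS.
  move=> H; apply: cvg_trans (H _).
    by apply: near_eq_cvg; apply: nearW => n /=; ring.
  by move=> n; rewrite -addnn leq_addr.
move=> w Ew; have [st typ] := EH w Ew.
have [nuE eE] : (forall i, N K w i = at_hub m i) /\
  (forall i, traversals K w i = e i) by split=> i; have [] := st i.
have S0 : 0 < \sum_j (T0 0 j + (e j)%:R) by apply: lt_le_trans mS; lra.
have share0 : 3%:R / 4%:R * p <= fresh_share K w <= 1.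
  rewrite /fresh_share (total_weight_state eE) (population_state nuE) hubE.
  by rewrite ler_pdivlMr // ler_pdivrMr // mul1r sS.
have mean_err n : 3%:R * (delta * rate ^+ n) <= (mu - 1) / 8%:R.
  apply: le_trans dmu; rewrite ler_wpM2l //.
  by case/andP: d01 => d0 _; rewrite ler_piMr ?exprn_ile1 ?ltW.
have share n : 3%:R / 4%:R * p <= fresh_share (K + n) w <= 1 /\
    3%:R / 4%:R * p <= fresh_share (K + n).+1 w <= 2 * mu / (1 + 2 * mu).
  elim: n => [|n [_ IH]].
    rewrite addn0; split => //; have [ty M0 _] := typ 0%N; rewrite addn0 in ty M0.
    have [mh [Hm Em]] := fresh_share_step ty M0.
    by apply: share_bounds pE (le_trans Hm (mean_err _)) share0 Em.
  have IH1 : 3%:R / 4%:R * p <= fresh_share (K + n.+1) w <= 1.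
    rewrite addnS; case/andP: IH => -> /= /le_trans; apply; rewrite ler_pdivrMr; lra.
  split => //; have [ty M0 _] := typ n.+1.
  have [mh [Hm Em]] := fresh_share_step ty M0.
  by apply: share_bounds pE (le_trans Hm (mean_err _)) IH1 Em.
suff H n : [/\ 1 / 4%:R <= portion (K + n.*2) w 1, 1 / 4%:R <= portion (K + n.*2) w 2%:R &
    portion (K + n.*2.+2) w 0 <= (1 - k) * portion (K + n.*2) w 0 +
      3%:R * (14%:R * (delta * rate ^+ n.*2)) + 14%:R * (delta * rate ^+ n.*2.+1)].
  by move=> n; have [h1 h2 h3] := H n; split => //; rewrite /err addrA.
move: n; apply: (@hub_persists _ k (fun n => density (K + n) w) (fun n => portion (K + n) w)
  (fun n => fresh_share (K + n).+1 w) (fun n => 14%:R * (delta * rate ^+ n))).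
- by rewrite k0.
- move=> n; have [_ /andP[lo hi]] := share n; apply/andP; split.
    by apply: le_trans lo; rewrite mulr_ge0 // ltW.
  by apply: (le_trans hi); lra.
- move=> n; have [ty M0 _] := typ n.+1; rewrite addnS in ty M0.
  have [mh [Hm Em]] := fresh_share_step ty M0.
  rewrite addnS; have [] := share n.+1; rewrite addnS => s1 _.
  exact: share_product pE (le_trans Hm (mean_err _)) s1 Em.
- by move=> n; rewrite !mulr_ge0 ?exprn_ge0 ?(ltW r0) //; case/andP: d01 => /ltW.
- exact: sumd.
- by move=> n; apply: density_prob_vec; have [] := typ n.
- by move=> n; exact: portion_prob_vec.
- by move=> n; exact: portion_gt0.
- by move=> n; rewrite !addnS; have [*] := typ n; exact: noisy_typical_step.
- by rewrite addn0 (density_state _ nuE) mul0r.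
- by rewrite addn0 (density_state _ nuE) mul0r.
- by rewrite addn0 (portion_state _ eE) ler_pdivrMr // e0E.
- by rewrite addn0 (portion_state _ eE) ler_pdivlMr // (le_trans (eS _ eS1)) // lerDr ltW.
- by rewrite addn0 (portion_state _ eE) ler_pdivlMr // (le_trans (eS _ eS2)) // lerDr ltW.
Qed.

End Process.

(** * Conclusion *)

Theorem theorem2 (R : realType) (d d' : measure_display)
    (Omega : measurableType d) (Omega' : measurableType d')
    (P : probability Omega R) (Q : probability Omega' R)
    (zeta : {RV Q >-> nat})
    (zeta_neq0 : Q (zeta @^-1` [set 0%N]) = 0%E)
    (mu_gt1 : (1 < 'E_Q[fun w => ((zeta w)%:R)%R])%E)
    (mu_fin : ('E_Q[fun w => ((zeta w)%:R)%R] < +oo)%E)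
    (zeta_L2 : ('E_Q[fun w => ((zeta w)%:R ^+ 2)%R] < +oo)%E)
    (N0 : 'I_3 -> nat) (N0_neq0 : exists i, N0 i != 0%N)
    (T0 : 'rV[R]_3) (T0_gt0 : forall i, 0 < T0 0 i)
    (Z : nat -> 'I_3 -> nat -> {RV P >-> nat})
    (B : nat -> 'I_3 -> {RV P >-> nat})
    (process : triangle_process zeta N0 T0 Z B)
    (Theta : Omega -> 'rV[R]_3)
    (Theta_meas : forall i, measurable_fun setT (fun w => Theta w 0 i))
    (Theta_simplex : forall w, simplex (Theta w))
    (Theta_lim : {ae P, forall w,
       (fun n => proportions N0 T0 Z B n w) @ \oo --> Theta w}) :
  (0 < P [set w | (simplex `\` simplex_boundary) (Theta w)])%E /\
  (0 < P [set w | (simplex_boundary `\` simplex_vertices) (Theta w)])%E.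
Proof.
have [copies indZ indF lawB] := process.
have [mu Emu] : {mu : R | 'E_Q[fun w => ((zeta w)%:R)%R] = mu%:E}%E.
  exists (fine 'E_Q[fun w => ((zeta w)%:R)%R]); rewrite fineK //.
  by rewrite ge0_fin_numE // ltW // (lt_trans _ mu_gt1).
have [V EV] : {V : R | 'E_Q[fun w => ((zeta w)%:R ^+ 2)%R] = V%:E}%E.
  exists (fine 'E_Q[fun w => ((zeta w)%:R ^+ 2)%R]); rewrite fineK // ge0_fin_numE //.
  by apply: expectation_ge0 => w; exact: sqr_ge0.
have {}mu_gt1 : 1 < mu by rewrite -lte_fin -Emu.
have mZ n i k : adapted measurable (Z n i k : Omega -> nat) by exact: adapted_RV.
have mB n i : adapted measurable (B n i : Omega -> nat) by exact: adapted_RV.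
have EZ n i k : (\int[P]_w ((Z n.+1 i k w)%:R)%:E = mu%:E)%E.
  rewrite -Emu; apply: (same_law_integral (f := fun y => y%:R)) => // S; exact: copies.
have EZ2 n i k : (\int[P]_w ((Z n.+1 i k w)%:R ^+ 2)%:E <= V%:E)%E.
  have law S : distribution P (Z n.+1 i k) S = distribution Q zeta S by exact: copies.
  by rewrite -EV (same_law_integral (f := fun y => y%:R ^+ 2) law) // => y; exact: sqr_ge0.
have mu0 : 0 < mu by rewrite (lt_trans ltr01).
have [z mu_le_z atom] := atom_above_mean mu0 Emu.
have atom_z n i k : (0 < P (Z n.+1 i k @^-1` [set z]))%E.
  by have := copies n i k [set z]; rewrite /distribution /pushforward => ->.
pose portion := portion N0 T0 (fun n i k => Z n i k : Omega -> nat) (fun n i => B n i : Omega -> nat).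
have lim i w : (fun n => proportions N0 T0 Z B n w) @ \oo --> Theta w ->
    (fun n => portion n w i) @ \oo --> Theta w 0 i.
  move=> cv; rewrite /portion; under eq_fun do rewrite -portionE //.
  exact: (@cvg_comp _ _ _ (fun n => proportions N0 T0 Z B n w) (fun M : 'rV[R]_3 => M 0 i)
    _ _ _ cv (@coord_continuous _ _ _ 0 i (Theta w))).
split.
  have [K [E [mE PE HE]]] := interior_event N0_neq0 T0_gt0 mZ mB mu_gt1 EZ EZ2 atom_z mu_le_z
    indZ indF lawB.
  apply: (positive_probability mE PE Theta_lim); first exact: measurable_interior.
  move=> w Ew cv; rewrite -[X in X w]/(fun w => _) /=; split => // -[_ [i Ti0]].
  have := limit_ge (cvg_along (leq_addl K) (lim i w cv)) (fun n => HE w Ew n i).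
  by rewrite Ti0; lra.
have [K [E [k [e [mE PE k0 e0 HE]]]]] := boundary_event N0_neq0 T0_gt0 mZ mB mu_gt1 EZ EZ2 atom_z mu_le_z
    indZ indF lawB.
apply: (positive_probability mE PE Theta_lim); first exact: measurable_open_sides.
move=> w Ew cv.
have phi n : (n <= K + n.*2)%N by rewrite -addnn addnA leq_addl.
have phi2 n : (n <= K + n.*2.+2)%N by rewrite (leq_trans (phi n)) // leq_add2l -addn2 leq_addr.
have T1 : 1 / 4%:R <= Theta w 0 1.
  by apply: limit_ge (cvg_along phi (lim 1 w cv)) _ => n; have [] := HE w Ew n.
have T2 : 1 / 4%:R <= Theta w 0 2%:R.
  by apply: limit_ge (cvg_along phi (lim 2%:R w cv)) _ => n; have [] := HE w Ew n.
(* In the limit [Theta 0 <= (1 - k) * Theta 0]. *)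
have T0le : 0 <= (1 - k) * Theta w 0 0 + 0 - Theta w 0 0.
  apply: (@limit_ge _ (fun n => (1 - k) * portion (K + n.*2)%N w 0 + e n - portion (K + n.*2.+2)%N w 0)).
    apply: cvgB; last exact: cvg_along phi2 (lim 0 w cv).
    apply: cvgD => //; apply: cvgMr; exact: cvg_along phi (lim 0 w cv).
  by move=> n; have [_ _] := HE w Ew n; rewrite subr_ge0.
have [T01 _] := Theta_simplex w.
have T00 : Theta w 0 0 = 0.
  apply/eqP; rewrite eq_le; have /andP[-> _] := T01 0; rewrite andbT.
  by rewrite -(pmulr_rle0 _ k0); lra.
split; first by split => //; exists 0.
move=> [i _ iE]; move: T1 T2; rewrite -iE !mxE !eqxx /=.
by case: (ord3P i) => -> /=; lra.
Qed.
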